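(* Let $n$ be a positive integer, $\lambda\in\mathbb T$ and $f\in\mathcal O(\mathbb D)$. Then $f\in\mathcal H_{\lambda,n}$ if and only if $f=\alpha+(z-\lambda)g$ for some $g\in\mathcal H_{\sigma,n-1}$ and some $\alpha\in\mathbb C$. Moreover, in this case: (i) $D_{\lambda,n}(f)=D_{\sigma,n-1}(g)$; (ii) $f(z)\to\alpha$ as $z\to\lambda$ within each oricyclic approach region $\{z\in\mathbb D:|z-\lambda|<\kappa(1-|z|^2)^{1/2}\}$, $\kappa>0$. In particular $f^*(\lambda)$ exists and equals $\alpha$.
   Context: $\mathbb D$ is the open unit disc, $\mathbb T$ the unit circle, $dA$ the normalized Lebesgue area measure on $\mathbb D$, $\sigma$ the normalized arc-length measure on $\mathbb T$, $\mathcal O(\mathbb D)$ the holomorphic functions on $\mathbb D$. For a finite non-negative Borel measure $\mu$ on $\mathbb T$, $P_\mu(z)=\int_{\mathbb T}\frac{1-|z|^2}{|z-\zeta|^2}\,d\mu(\zeta)$. For $n\geq 1$ and $f\in\mathcal O(\mathbb D)$, $D_{\mu,n}(f)=\frac{1}{n!(n-1)!}\int_{\mathbb D}|f^{(n)}(z)|^2P_\mu(z)(1-|z|^2)^{n-1}dA(z)$. For $f=\sum_k a_kz^k$ and $j\ge 0$, $D_{\sigma,j}(f)=\sum_{k\geq j}\binom{k}{j}|a_k|^2$ (so $D_{\sigma,0}(f)$ is the squared Hardy norm), and $\mathcal H_{\sigma,j}=\{f\in\mathcal O(\mathbb D):D_{\sigma,j}(f)<\infty\}$ (so $\mathcal H_{\sigma,0}=H^2$).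 For $\lambda\in\mathbb T$, $D_{\lambda,n}:=D_{\delta_\lambda,n}$ where $\delta_\lambda$ is the Dirac measure at $\lambda$, and $\mathcal H_{\lambda,n}=\{f\in\mathcal O(\mathbb D):D_{\lambda,n}(f)<\infty\}$. For $f\in\mathcal O(\mathbb D)$, $f^*(\lambda):=\lim_{r\to1^-}f(r\lambda)$ when it exists. *)

(* Defs.v *)
(* MathComp-Analysis over an abstract R : realType,
   complex numbers are R[i] (mathcomp-real-closed), equipped with the
   normed-module structure of a numClosedFieldType over itself. *)
From HB Require Import structures.
From mathcomp Require Import all_boot all_order all_algebra.
From mathcomp Require Import all_classical all_reals all_analysis.
From mathcomp Require Import complex.
Import Order.TTheory GRing.Theory Num.Theory.
Import numFieldNormedType.Exports.

Set Implicit Arguments.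
Unset Strict Implicit.
Unset Printing Implicit Defensive.

Local Open Scope ring_scope.
Local Open Scope complex_scope.
Local Open Scope classical_set_scope.

Definition Cplx (R : realType) : numClosedFieldType := R[i].

Section defs.
Variable R : realType.
Local Notation C := (Cplx R).

Definition cabs (z : C) : R := Num.sqrt (complex.Re z ^+ 2 + complex.Im z ^+ 2).

Definition disc : set C := [set z | cabs z < 1].

Definition holo_disc (f : C -> C) : Prop :=
  forall z : C, z \in disc -> derivable f z 1.

Definition cderiv (n : nat) (f : C -> C) : C -> C := derive1n n f.

(* integral with respect to the normalized area measure dA = dx dy / pi
   over D, of a nonnegative extended-real valued function *)
Definition area_int_disc (F : C -> \bar R) : \bar R :=
  ((\int[(@lebesgue_measure R \x @lebesgue_measure R)%E]_(p in
        [set p : R * R | (p.1 ^+ 2 + p.2 ^+ 2 < 1)%R]) F ((p.1 +i* p.2)%C))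
    * (pi^-1)%:E)%E.

Definition poisson_dirac (lam z : C) : R :=
  (1 - cabs z ^+ 2) / cabs (z - lam) ^+ 2.

Definition D_lambda (n : nat) (lam : C) (f : C -> C) : \bar R :=
  (((n`! * (n.-1)`!)%:R)^-1%:E *
   area_int_disc (fun z => (cabs (cderiv n f z) ^+ 2 * poisson_dirac lam z
                            * (1 - cabs z ^+ 2) ^+ n.-1)%:E))%E.

Definition taylor_coef (f : C -> C) (k : nat) : C :=
  cderiv k f 0 / (k`!)%:R.

Definition D_sigma (j : nat) (f : C -> C) : \bar R :=
  (\sum_(j <= k <oo) (('C(k, j))%:R * cabs (taylor_coef f k) ^+ 2)%:E)%E.

Definition H_lambda (n : nat) (lam : C) (f : C -> C) : Prop :=
  holo_disc f /\ (D_lambda n lam f < +oo)%E.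

Definition H_sigma (j : nat) (f : C -> C) : Prop :=
  holo_disc f /\ (D_sigma j f < +oo)%E.

Definition oricyclic (kappa : R) (lam : C) : set C :=
  [set z | z \in disc /\ cabs (z - lam) < kappa * Num.sqrt (1 - cabs z ^+ 2)].

End defs.

(* Main.v *)
Require Import Defs.
From HB Require Import structures.
From mathcomp Require Import all_boot all_order all_algebra.
From mathcomp Require Import all_classical all_reals all_analysis.
From mathcomp Require Import measurable_realfun complex ring lra.
Import Order.TTheory GRing.Theory Num.Theory.
Import numFieldNormedType.Exports.
Import ComplexField.Normc.
Local Open Scope ring_scope.
Local Open Scope complex_scope.
Local Open Scope classical_set_scope.

Set Implicit Arguments.
Unset Strict Implicit.
Unset Printing Implicit Defensive.

(** Let [F = f^(n) / (z - lam)]; the Poisson kernel turns [D_lambda] into a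
    multiple of the integral of [|F|^2 (1 - |z|^2)^n], which Parseval expresses
    through the Taylor coefficients [b_k] of [F].  If [f = alpha + (z - lam) g] and
    [m = n - 1], put [c_j = (j+m)!/j! lam^(j+m) g_(j+m)] and [S_k = c_0 + ... + c_k].
    Then [lam^(k+n) b_k = (k+1) c_(k+1) - n S_k], and with the weights
    [wc_k = k!/(k+m)!], [wB_k = k!/(k+n+1)!], [tau_k = k!/(k+n)!],
    [|b_k|^2 wB_k = |c_(k+1)|^2 wc_(k+1) + n |S_k|^2 tau_k - n |S_(k+1)|^2 tau_(k+1)],
    a telescoping identity.  If [sum |c_k|^2 wc_k] is finite the boundary term tends
    to [0], which is (i).  Conversely, finiteness of [sum |b_k|^2 wB_k] only makes
    [n tau_k S_k] converge; changing [alpha] translates this sequence by a constant,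
    so one choice of [alpha] makes the limit [0] and the boundary terms bounded.
    For (ii), [g] is in [H^2], so [g(z) = o((1 - |z|^2)^(-1/2))]. *)

(** [holo_disc] provides complex differentiability only, so the Taylor expansion has to be derived:
    Goursat's theorem on triangles, then inscribed regular polygons as contours, Riemann sums over
    roots of unity as Cauchy integrals, and limits along an ultrafilter. The weight wB_k comes from
    the moment pi k! n! / (k+n+1)! of |z|^(2k) (1 - |z|^2)^n over the disc. Changing alpha is
    invisible to f^(n): it adds to c_j a multiple of 1 / wc_j, and this sequence spans the kernel of
    the map from c to the numbers lam^(k+n) b_k. Since n tau_k times the sum of 1 / wc_j over j <= k
    is 1, the sequence n tau_k S_k is translated by a constant. That n tau_k S_k tends to 0 would
    not by itself bound the boundary term n |S_k|^2 tau_k; the rate |n tau_k S_k - l|^2 <= n tau_k D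
    from Cauchy-Schwarz does, because |n tau_k S_k|^2 is n tau_k times the boundary term. *)

Section Modulus.
Context {R : realType}.
Local Notation C := (Cplx R).
Implicit Types z w : C.

Lemma cabsE z : cabs z = normc z.
Proof. by case: z. Qed.

Lemma norm_cabs z : `|z| = (cabs z)%:C :> C.
Proof. by rewrite cabsE. Qed.

Lemma cabs_ge0 z : 0 <= cabs z.
Proof. exact: sqrtr_ge0. Qed.

Lemma cabs0 : cabs (0 : C) = 0.
Proof. by rewrite cabsE; apply: normc0. Qed.

Lemma cabs1 : cabs (1 : C) = 1.
Proof. by rewrite cabsE; apply: normc1. Qed.

Lemma cabs_eq0 z : (cabs z == 0) = (z == 0).
Proof.
apply/eqP/eqP => [|->]; last exact: cabs0.
by rewrite cabsE; apply: eq0_normc.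
Qed.

Lemma cabs_gt0 z : (0 < cabs z) = (z != 0).
Proof. by rewrite lt_def cabs_eq0 cabs_ge0 andbT. Qed.

Lemma cabsM z w : cabs (z * w) = cabs z * cabs w.
Proof. by rewrite !cabsE; apply: normcM. Qed.

Lemma cabsD z w : cabs (z + w) <= cabs z + cabs w.
Proof. by rewrite !cabsE; apply: le_normcD. Qed.

Lemma cabsN z : cabs (- z) = cabs z.
Proof. by rewrite !cabsE; apply: normcN. Qed.

Lemma cabsB z w : cabs (z - w) <= cabs z + cabs w.
Proof. by rewrite -(cabsN w) cabsD. Qed.

Lemma cabsC z w : cabs (z - w) = cabs (w - z).
Proof. by rewrite -cabsN opprB. Qed.

Lemma cabsX z n : cabs (z ^+ n) = cabs z ^+ n.
Proof. by elim: n => [|n IH]; rewrite ?expr0 ?cabs1 // !exprS cabsM IH. Qed.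

Lemma cabsV z : cabs z^-1 = (cabs z)^-1.
Proof. by rewrite !cabsE; apply: normcV. Qed.

Lemma cabs_real (x : R) : cabs (x%:C : C) = `|x|.
Proof. by rewrite /cabs /= expr0n addr0 sqrtr_sqr. Qed.

Lemma natrC (n : nat) : (n%:R : C) = (n%:R : R)%:C.
Proof. by rewrite rmorph_nat. Qed.

Lemma cabs_nat (n : nat) : cabs (n%:R : C) = n%:R.
Proof. by rewrite natrC cabs_real ger0_norm. Qed.

Lemma cabs_sum (I : Type) (r : seq I) (P : pred I) (F : I -> C) :
  cabs (\sum_(i <- r | P i) F i) <= \sum_(i <- r | P i) cabs (F i).
Proof.
elim/big_rec2: _ => [|i x y _ IH]; first by rewrite cabs0.
by apply: le_trans (cabsD _ _) _; rewrite lerD2l.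
Qed.

Lemma cabs_sqr z : cabs z ^+ 2 = complex.Re z ^+ 2 + complex.Im z ^+ 2.
Proof. by rewrite sqr_sqrtr // addr_ge0 ?sqr_ge0. Qed.

Lemma Re_le_cabs z : `|complex.Re z| <= cabs z.
Proof. by rewrite -sqrtr_sqr /cabs; apply: ler_wsqrtr; rewrite lerDl sqr_ge0. Qed.

Lemma Im_le_cabs z : `|complex.Im z| <= cabs z.
Proof. by rewrite -sqrtr_sqr /cabs; apply: ler_wsqrtr; rewrite lerDr sqr_ge0. Qed.

Lemma cabs_le_ReIm z : cabs z <= `|complex.Re z| + `|complex.Im z|.
Proof.
rewrite -[leRHS]ger0_norm ?addr_ge0// -[leRHS]sqrtr_sqr /cabs; apply: ler_wsqrtr.
by rewrite sqrrD !real_normK ?num_real// addrAC lerDl mulrn_wge0// mulr_ge0.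
Qed.

Lemma ReD z w : complex.Re (z + w) = complex.Re z + complex.Re w.
Proof. by case: z w => ? ? []. Qed.

Lemma ImD z w : complex.Im (z + w) = complex.Im z + complex.Im w.
Proof. by case: z w => ? ? []. Qed.

Lemma ReB z w : complex.Re (z - w) = complex.Re z - complex.Re w.
Proof. by case: z w => ? ? []. Qed.

Lemma ImB z w : complex.Im (z - w) = complex.Im z - complex.Im w.
Proof. by case: z w => ? ? []. Qed.

Lemma lt0_realC (e : C) : 0 < e -> exists2 d : R, 0 < d & e = d%:C.
Proof.
case: e => a b; rewrite ltcE /= => /andP[/eqP -> a0].
by exists a.
Qed.

(** The norm of [C] takes values in [C] itself, so radii of balls are complex; by [lt0_realC] a
    positive one is real. This lets all later estimates be made in [R] through [cabs]. *)
Lemma nbhs_cabsP z (P : set C) :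
  nbhs z P <-> exists2 d : R, 0 < d & forall w, cabs (w - z) < d -> P w.
Proof.
split.
  move=> /nbhs_ballP[e /= /lt0_realC[d d0 ->]] dP; exists d => // w wz.
  by apply: dP; rewrite -ball_normE /= norm_cabs ltcR cabsC.
move=> [d d0 dP]; apply/nbhs_ballP; exists d%:C => /=; first by rewrite ltcR.
by move=> w; rewrite -ball_normE /= norm_cabs ltcR cabsC => /dP.
Qed.

Lemma cvg_cabsP (T : Type) (F : set_system T) {FF : Filter F} (u : T -> C) (l : C) :
  u @ F --> l <-> forall e : R, 0 < e -> \forall x \near F, cabs (u x - l) < e.
Proof.
split.
  move=> ul e e0; apply: (ul (fun w => cabs (w - l) < e)).
  by apply/nbhs_cabsP; exists e.
move=> H P /nbhs_cabsP[d d0 dP].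
by move: (H d d0); rewrite /nbhs/=; apply: filterS => x /dP.
Qed.

(** The first-order expansion is stated without dividing by w - z, so errors can be summed and
    integrated without excluding w = z. *)
Definition has_cderiv (f : C -> C) z (l : C) := forall e : R, 0 < e ->
  exists2 d : R, 0 < d & forall w, cabs (w - z) < d ->
    cabs (f w - f z - l * (w - z)) <= e * cabs (w - z).

Lemma has_cderiv_is_derive (f : C -> C) z l :
  has_cderiv f z l -> is_derive z (1 : C) f l.
Proof.
move=> H.
have Hc : (fun h : C => h^-1 *: (f (h *: (1 : C) + z) - f z)) @ 0^' --> l.
  apply/cvg_cabsP => e e0.
  have [d d0 Hd] := H _ (divr_gt0 e0 (ltr0n _ 2)).
  apply/nbhs_cabsP; exists d => // h; rewrite subr0 => hd /= h0.
  have := Hd (h + z); rewrite addrK => /(_ hd) Hh.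
  rewrite [h *: _]mulr1 [_ *: _]mulrC.
  have -> : (f (h + z) - f z) * h^-1 - l = (f (h + z) - f z - l * h) / h.
    by rewrite [RHS]mulrBl mulfK.
  rewrite cabsM cabsV ltr_pdivrMr ?cabs_gt0//.
  by apply: le_lt_trans Hh _; rewrite ltr_pM2r ?cabs_gt0// gtr_pMr// invf_lt1// ltr1n.
apply: DeriveDef; first by apply/cvg_ex; exists l.
by apply: cvg_lim.
Qed.

Lemma derivable_has_cderiv (f : C -> C) z :
  derivable f z 1 -> has_cderiv f z (derive1 f z).
Proof.
move=> H e e0; move: H; rewrite derive1E /derive /derivable => /cvg_cabsP.
move=> /(_ _ e0) /nbhs_cabsP[d d0 Hd]; exists d => // w wz.
have [->|wz0] := eqVneq w z; first by rewrite !subrr mulr0 subrr cabs0 mulr0.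
have := Hd (w - z); rewrite subr0 => /(_ wz); rewrite subr_eq0 => /(_ wz0).
rewrite /= [_ *: 1]mulr1 [_ *: _]mulrC subrK => /ltW.
set l := lim _ => Hl.
have -> : f w - f z - l * (w - z) = ((f w - f z) / (w - z) - l) * (w - z).
  by rewrite [RHS]mulrBl divfK// subr_eq0.
by rewrite cabsM ler_wpM2r// cabs_ge0.
Qed.

Lemma has_cderiv_derive1 (f : C -> C) z l : has_cderiv f z l -> derive1 f z = l.
Proof. by move=> /has_cderiv_is_derive H; rewrite derive1E derive_val. Qed.

End Modulus.

(** * Goursat's theorem *)

Section SegmentIntegral.
Context {R : realType}.
Local Notation C := (Cplx R).
Local Notation mu := (@lebesgue_measure R).
Implicit Types (u v : R -> C) (q : C -> C).

Definition cint u : C :=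
  Complex (\int[mu]_(t in `[0, 1]) complex.Re (u t))%R
          (\int[mu]_(t in `[0, 1]) complex.Im (u t))%R.

Definition ccont u := {within `[0, 1], continuous (fun t => complex.Re (u t))} /\
  {within `[0, 1], continuous (fun t => complex.Im (u t))}.

Lemma ccont_eps u : (forall t, 0 <= t <= 1 -> forall e : R, 0 < e ->
    exists2 d : R, 0 < d & forall s, 0 <= s <= 1 -> `|s - t| < d ->
      cabs (u s - u t) < e) -> ccont u.
Proof.
move=> H; split; apply/subspace_continuousP => t; rewrite /= in_itv/= => t01; apply/cvgrPdist_lt => e e0;
  have [d d0 Hd] := H t t01 e e0; rewrite near_withinE;
  apply/nbhs_ballP; exists d => //= s; rewrite /ball/= distrC => st; rewrite in_itv/= => s01;
  apply: le_lt_trans (Hd s s01 st); rewrite -normrN opprB.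
- by rewrite -ReB Re_le_cabs.
- by rewrite -ImB Im_le_cabs.
Qed.

Lemma within01_integrable (h : R -> R) : {within `[0, 1], continuous h} ->
  mu.-integrable `[0, 1] (EFin \o h).
Proof.
by move=> ch; apply: continuous_compact_integrable => //; exact: segment_compact.
Qed.

Lemma cintD u v : ccont u -> ccont v -> cint (fun t => u t + v t) = cint u + cint v.
Proof.
move=> [uR uI] [vR vI]; rewrite /cint [RHS]/=.
rewrite -[RHS]/(Complex (_ + _) (_ + _)) -!RintegralD//; try exact: within01_integrable.
by congr Complex; apply: eq_Rintegral => t _; case: (u t) => ? ?; case: (v t).
Qed.

Lemma Rintegral01_le (h : R -> R) M : {within `[0, 1], continuous h} ->
  (forall t, 0 <= t <= 1 -> `|h t| <= M) ->
  `|\int[mu]_(t in `[0, 1]) h t| <= M.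
Proof.
move=> ch hM; apply: (le_trans (le_normr_Rintegral _ _)) => //; first exact: within01_integrable.
apply: (@le_trans _ _ (\int[mu]_(t in `[0, 1]) M)).
  apply: le_Rintegral => //.
  - exact: integrable_norm (within01_integrable ch).
  - by apply: within01_integrable => x; exact: cst_continuous.
rewrite Rintegral_cst//= lebesgue_measure_itv/= lte_fin ltr01 sube0 /=.
by rewrite mulr1.
Qed.

(** The factor 2 comes from bounding the modulus by |Re| + |Im|. It is harmless, because the bound
    only serves to show that error terms become arbitrarily small. *)
Lemma cint_le u M : ccont u -> (forall t, 0 <= t <= 1 -> cabs (u t) <= M) ->
  cabs (cint u) <= M * 2.
Proof.
move=> [uR uI] uM; apply: le_trans (cabs_le_ReIm _) _ => /=.
rewrite mulr_natr mulr2n; apply: lerD; apply: Rintegral01_le => // t t01.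
- exact: le_trans (Re_le_cabs _) (uM t t01).
- exact: le_trans (Im_le_cabs _) (uM t t01).
Qed.

End SegmentIntegral.

(** * Halving the interval of integration *)

Section SegmentIntegralSplit.
Context {R : realType}.
Local Notation C := (Cplx R).
Local Notation mu := (@lebesgue_measure R).
Implicit Types (u v : R -> C) (q : C -> C).

Lemma Rintegral_affine (h : R -> R) (c k : R) : 0 < k ->
  {within `[c, c + k], continuous h} ->
  \int[mu]_(t in `[c, c + k]) h t = k * \int[mu]_(t in `[0, 1]) h (c + k * t).
Proof.
move=> k0 ch; pose F t : R := c + k * t.
have dF t : is_derive t (1 : R) F k.
  by apply: is_derive_eq; rewrite add0r mul1r /GRing.scale/= mulr1.
have F'E : derive1 F = cst k by apply/funext => t; rewrite derive1E derive_val.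
have Fc t : F x @[x --> t] --> F t.
  by apply: differentiable_continuous; apply/derivable1_diffP; apply: ex_derive.
have F0 : F 0 = c by rewrite /F mulr0 addr0.
have F1 : F 1 = c + k by rewrite /F mulr1.
have chF : {within `[0, 1], continuous (h \o F)}.
  apply/subspace_continuousP => t; rewrite /= in_itv/= => /andP[t0 t1].
  have FI x : 0 <= x <= 1 -> c <= F x <= c + k.
    by move=> /andP[x0 x1]; rewrite lerDl mulr_ge0//= ?lerD2l ?ger_pMr// ltW.
  have H : h x @[x --> within `[c, c + k] (nbhs (F t))] --> h (F t).
    have /subspace_continuousP Hc := ch.
    by apply: Hc; rewrite /= in_itv/= FI ?t0.
  move=> P /H HP; have HQ : \forall x \near t, `[c, c + k] (F x) -> P (h (F x)).
    exact: Fc t _ HP.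
  change (\forall x \near t, `[0, 1] x -> P (h (F x))).
  near=> x; rewrite /= in_itv/= => x01.
  have : `[c, c + k] (F x) -> P (h (F x)) by near: x.
  by apply; rewrite /= in_itv/= FI.
rewrite -RintegralZl//; last exact: within01_integrable.
rewrite /Rintegral.
have -> : `[c, c + k]%classic = `[F 0, F 1]%classic by rewrite F0 F1.
rewrite (@integration_by_substitution_increasing R F h 0 1)//.
- by congr fine; apply: eq_integral => t _ /=; rewrite F'E /= mulrC.
- by move=> x y _ _ xy; rewrite /F ltrD2l ltr_pM2l.
- by rewrite F'E => x _; exact: cst_continuous.
- by rewrite F'E; exact: is_cvg_cst.
- by rewrite F'E; exact: is_cvg_cst.
- split; first by move=> x _; apply: ex_derive.
  + by apply: cvg_at_right_filter; exact: Fc.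
  + by apply: cvg_at_left_filter; exact: Fc.
- by rewrite F0 F1.
Unshelve. all: by end_near. Qed.

Lemma Rintegral01_split (h : R -> R) : {within `[0, 1], continuous h} ->
  \int[mu]_(t in `[0, 1]) h t =
  2^-1 * \int[mu]_(t in `[0, 1]) h (t / 2) +
  2^-1 * \int[mu]_(t in `[0, 1]) h ((1 + t) / 2).
Proof.
move=> ch.
have h2 : (2^-1 : R) + 2^-1 = 1 by lra.
have c1 : {within `[0, 0 + 2^-1], continuous h}.
  apply: continuous_subspaceW ch => x /=; rewrite !in_itv/= => /andP[-> /=]; lra.
have c2 : {within `[2^-1, 2^-1 + 2^-1], continuous h}.
  apply: continuous_subspaceW ch => x /=; rewrite !in_itv/= => /andP[]; lra.
have i1 := Rintegral_affine _ c1; have i2 := Rintegral_affine _ c2.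
have -> : \int[mu]_(t in `[0, 1]) h (t / 2) = \int[mu]_(t in `[0, 1]) h (0 + 2^-1 * t).
  by apply: eq_Rintegral => t _; rewrite add0r mulrC.
have -> : \int[mu]_(t in `[0, 1]) h ((1 + t) / 2) = \int[mu]_(t in `[0, 1]) h (2^-1 + 2^-1 * t).
  by apply: eq_Rintegral => t _; rewrite mulrDl mul1r [t / 2]mulrC.
rewrite -i1 -?i2 ?invr_gt0// add0r h2.
have := @Rintegral_itvB _ h (BLeft 0) (BRight 1) 2^-1 (within01_integrable ch).
rewrite !bnd_simp => /(_ ltac:(lra) ltac:(lra)).
rewrite Rintegral_itv_obnd_cbnd; first lra.
apply: integrableS (within01_integrable ch) => //= x /=.
by rewrite !in_itv/= => /andP[]; lra.
Qed.

End SegmentIntegralSplit.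

(** * Integrals along segments in the complex plane *)

Section Goursat.
Context {R : realType}.
Local Notation C := (Cplx R).
Local Notation mu := (@lebesgue_measure R).
Implicit Types (u v : R -> C) (q : C -> C) (a b c p z w : C).

Lemma ReMr (x : R) z : complex.Re (x%:C * z) = x * complex.Re z.
Proof. by case: z => y y' /=; rewrite mul0r subr0. Qed.

Lemma ImMr (x : R) z : complex.Im (x%:C * z) = x * complex.Im z.
Proof. by case: z => y y' /=; rewrite mul0r addr0. Qed.

Lemma cint_split u : ccont u ->
  cint u = (cint (fun t => u (t / 2)) + cint (fun t => u ((1 + t) / 2))) / 2.
Proof.
move=> [uR uI]; apply/eqP; rewrite mulrC.
have -> : (2^-1 : C) = (2^-1 : R)%:C by rewrite fmorphV rmorph_nat.
rewrite eq_complex ReMr ImMr ReD ImD /cint /=.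
by rewrite (Rintegral01_split uR) (Rintegral01_split uI) !mulrDr !eqxx.
Qed.

(** Halving the interval gives the linear equation I = I / 2 + 1 / 4 for the integral I, which
    determines it without a primitive. *)
Lemma Rintegral01_id : \int[mu]_(t in `[0, 1]) t = 2^-1 :> R.
Proof.
have cid : {within `[0, 1], continuous (id : R -> R)}.
  by apply: continuous_subspaceT => t; exact: cvg_id.
have c1 : {within `[0, 1], continuous ((fun=> 1) : R -> R)}.
  by apply: continuous_subspaceT => t; exact: cst_continuous.
have := Rintegral01_split cid.
under [X in _ + _ * X]eq_Rintegral do rewrite mulrDl mulrC.
rewrite RintegralD//; first last.
- by apply: within01_integrable; apply: continuous_subspaceT => t; apply: cvgMl; exact: cvg_id.
- by apply: within01_integrable; apply: continuous_subspaceT => t; exact: cst_continuous.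
rewrite RintegralZr//; last exact: within01_integrable.
rewrite Rintegral_cst//= lebesgue_measure_itv/= lte_fin ltr01 sube0 /=.
lra.
Qed.

Lemma Rintegral01_affine (x y : R) :
  \int[mu]_(t in `[0, 1]) (x + t * y) = x + y / 2.
Proof.
rewrite RintegralD//; first last.
- by apply: within01_integrable; apply: continuous_subspaceT => t; apply: cvgMl; exact: cvg_id.
- by apply: within01_integrable; apply: continuous_subspaceT => t; exact: cst_continuous.
rewrite RintegralZr//; last first.
  by apply: within01_integrable; apply: continuous_subspaceT => t; exact: cvg_id.
rewrite Rintegral01_id Rintegral_cst//= lebesgue_measure_itv/= lte_fin ltr01 sube0 /=.
by rewrite mulr1 mulrC.
Qed.

Lemma cint_affine z w : cint (fun t => z + t%:C * w) = z + w / 2.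
Proof.
apply/eqP; rewrite eq_complex ReD ImD /=.
have -> : w / 2 = (2^-1 : R)%:C * w by rewrite fmorphV rmorph_nat mulrC.
rewrite ReMr ImMr.
under eq_Rintegral do rewrite ReD ReMr.
under [X in _ && (X == _)]eq_Rintegral do rewrite ImD ImMr.
by rewrite !Rintegral01_affine ![2^-1 * _]mulrC !eqxx.
Qed.

Definition segpt a b (t : R) : C := a + t%:C * (b - a).

Definition segint q a b : C := (b - a) * cint (fun t => q (segpt a b t)).

Definition ccontinuous_at q z := forall e : R, 0 < e ->
  exists2 d : R, 0 < d & forall w, cabs (w - z) < d -> cabs (q w - q z) < e.

Lemma has_cderiv_continuous q z l : has_cderiv q z l -> ccontinuous_at q z.
Proof.
move=> H e e0; have [d d0 Hd] := H _ ltr01.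
have l1 : 0 < 1 + cabs l by rewrite ltr_pwDl ?cabs_ge0.
exists (Num.min d (e / (1 + cabs l))) => [|w].
  by rewrite lt_min d0 divr_gt0.
rewrite lt_min => /andP[wd we].
have -> : q w - q z = (q w - q z - l * (w - z)) + l * (w - z) by rewrite subrK.
apply: le_lt_trans (cabsD _ _) _; rewrite cabsM.
apply: (@le_lt_trans _ _ ((1 + cabs l) * cabs (w - z))).
  by rewrite mulrDl lerD2r Hd.
by rewrite mulrC -ltr_pdivlMr.
Qed.

Lemma segpt_cont q a b : (forall t, 0 <= t <= 1 -> ccontinuous_at q (segpt a b t)) ->
  ccont (fun t => q (segpt a b t)).
Proof.
move=> H; apply: ccont_eps => t t01 e e0.
have [d d0 Hd] := H t t01 e e0.
have l1 : 0 < 1 + cabs (b - a) by rewrite ltr_pwDl ?cabs_ge0.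
exists (d / (1 + cabs (b - a))); first by rewrite divr_gt0.
move=> s s01 st; apply: Hd.
have -> : segpt a b s - segpt a b t = (s - t)%:C * (b - a).
  by rewrite /segpt rmorphB /=; ring.
rewrite cabsM cabs_real; apply: (@le_lt_trans _ _ (`|s - t| * (1 + cabs (b - a)))).
  by rewrite ler_wpM2l// lerDr.
by rewrite -ltr_pdivlMr.
Qed.

Definition cmid a b : C := (a + b) / 2.

Lemma segint_split q a b : (forall t, 0 <= t <= 1 -> ccontinuous_at q (segpt a b t)) ->
  segint q a b = segint q a (cmid a b) + segint q (cmid a b) b.
Proof.
move=> H; rewrite /segint cint_split; last exact: segpt_cont.
have -> : (fun t : R => q (segpt a b (t / 2))) = (fun t => q (segpt a (cmid a b) t)).
  by apply/funext => t; congr q; rewrite /segpt /cmid rmorphM fmorphV rmorph_nat /=; field.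
have -> : (fun t : R => q (segpt a b ((1 + t) / 2))) = (fun t => q (segpt (cmid a b) b t)).
  by apply/funext => t; congr q; rewrite /segpt /cmid rmorphM fmorphV rmorphD rmorph1 rmorph_nat /=; field.
by rewrite /cmid; field.
Qed.

Lemma segintD q1 q2 a b :
    (forall t, 0 <= t <= 1 -> ccontinuous_at q1 (segpt a b t)) ->
    (forall t, 0 <= t <= 1 -> ccontinuous_at q2 (segpt a b t)) ->
  segint (fun z => q1 z + q2 z) a b = segint q1 a b + segint q2 a b.
Proof. by move=> H1 H2; rewrite /segint cintD ?mulrDr//; exact: segpt_cont. Qed.

Lemma segint_le q a b M : (forall t, 0 <= t <= 1 -> ccontinuous_at q (segpt a b t)) ->
  (forall t, 0 <= t <= 1 -> cabs (q (segpt a b t)) <= M) ->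
  cabs (segint q a b) <= cabs (b - a) * (M * 2).
Proof.
move=> H HM; rewrite /segint cabsM ler_wpM2l ?cabs_ge0// cint_le//.
exact: segpt_cont.
Qed.

(** The value is the increment of the primitive z x + w x^2 / 2 from a to b, so affine functions
    drop out of triangle integrals. *)
Lemma segint_affine z w a b :
  segint (fun x => z + w * x) a b = (b - a) * (z + w * (a + b) / 2).
Proof.
rewrite /segint; under eq_fun do rewrite /segpt mulrDr addrA mulrCA.
by rewrite cint_affine; field.
Qed.

End Goursat.

(** * Limits of sequences with geometrically decreasing steps *)

Section GeometricLimits.
Context {R : realType}.
Local Notation C := (Cplx R).

(** Nested intervals: x_n - 2B/2^n increases and x_n + 2B/2^n decreases, so the supremum of the
    lower ends lies in every interval. *)
Lemma geometric_limit_real (x : nat -> R) (B : R) :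
  (forall n, `|x n.+1 - x n| <= B / 2 ^+ n) ->
  exists p, forall n, `|x n - p| <= 2 * B / 2 ^+ n.
Proof.
move=> H.
have B0 : 0 <= B by have := H 0%N; rewrite expr0 divr1; apply: le_trans.
have e0 n : 0 <= B / 2 ^+ n by rewrite divr_ge0// exprn_ge0.
have es n : B / 2 ^+ n.+1 = B / 2 ^+ n / 2 by rewrite exprSr invfM mulrA.
have lo n k : x n - 2 * (B / 2 ^+ n) <= x (n + k)%N - 2 * (B / 2 ^+ (n + k)).
  elim: k => [|k IH]; first by rewrite addn0.
  apply: le_trans IH _; rewrite addnS es.
  have := H (n + k)%N; rewrite ler_norml => /andP[+ _]; lra.
have up n k : x (n + k)%N + 2 * (B / 2 ^+ (n + k)) <= x n + 2 * (B / 2 ^+ n).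
  elim: k => [|k IH]; first by rewrite addn0.
  apply: le_trans IH; rewrite addnS es.
  have := H (n + k)%N; rewrite ler_norml => /andP[_ +]; lra.
pose S := [set x n - 2 * (B / 2 ^+ n) | n in [set: nat]].
have ub n : ubound S (x n + 2 * (B / 2 ^+ n)).
  move=> _ [m _ <-]; have := lo m n; have := up n m; rewrite (addnC n).
  have := e0 (m + n)%N; lra.
have hS : has_sup S.
  by split; [exists (x 0%N - 2 * (B / 2 ^+ 0)), 0%N|exists (x 0%N + 2 * (B / 2 ^+ 0)); exact: ub].
exists (sup S) => n.
have l : x n - 2 * (B / 2 ^+ n) <= sup S.
  by apply: ub_le_sup; [case: hS|exists n].
have u : sup S <= x n + 2 * (B / 2 ^+ n).
  by apply: ge_sup; [case: hS|exact: ub].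
by rewrite -mulrA ler_norml; lra.
Qed.

Lemma geometric_limit (z : nat -> C) (B : R) :
  (forall n, cabs (z n.+1 - z n) <= B / 2 ^+ n) ->
  exists p : C, forall n, cabs (z n - p) <= 4 * B / 2 ^+ n.
Proof.
move=> H.
have [p1 H1] := @geometric_limit_real (fun n => complex.Re (z n)) B
  (fun n => le_trans (eq_ind _ (fun r => `|r| <= _) (Re_le_cabs _) _ (ReB _ _)) (H n)).
have [p2 H2] := @geometric_limit_real (fun n => complex.Im (z n)) B
  (fun n => le_trans (eq_ind _ (fun r => `|r| <= _) (Im_le_cabs _) _ (ImB _ _)) (H n)).
exists (Complex p1 p2) => n; apply: le_trans (cabs_le_ReIm _) _.
rewrite ReB ImB /=; have := H1 n; have := H2 n; lra.
Qed.

End GeometricLimits.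

(** * Triangle integrals and their subdivision *)

Section Triangles.
Context {R : realType}.
Local Notation C := (Cplx R).
Implicit Types (q : C -> C) (a b c p z w : C).

(** The third side is subtracted in the direction from a to c, so that no segment has to be
    reversed; triangles with a common first vertex then telescope. *)
Definition triint q (s : C * C * C) : C :=
  let: (a, b, c) := s in segint q a b + segint q b c - segint q a c.

Definition perimeter (s : C * C * C) : R :=
  let: (a, b, c) := s in cabs (b - a) + cabs (c - b) + cabs (c - a).

Definition cconvex (K : set C) := forall a b (t : R),
  K a -> K b -> 0 <= t <= 1 -> K (segpt a b t).

Definition vertices_in (K : set C) (s : C * C * C) :=
  let: (a, b, c) := s in [/\ K a, K b & K c].

Lemma cconvex_mid (K : set C) a b : cconvex K -> K a -> K b -> K (cmid a b).
Proof.
move=> cK Ka Kb; have -> : cmid a b = segpt a b 2^-1.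
  by rewrite /cmid /segpt fmorphV rmorph_nat; field.
by apply: cK => //; lra.
Qed.

Lemma cabs_half z : cabs (z / 2) = cabs z / 2.
Proof. by rewrite cabsM cabsV cabs_nat. Qed.

(** The vertices of the middle triangle are listed so that its sides are the three inner segments
    with the signs they carry in the outer triangles; hence it is subtracted. *)
Lemma triint_split q (K : set C) a b c : cconvex K ->
  (forall z, K z -> ccontinuous_at q z) -> K a -> K b -> K c ->
  triint q (a, b, c) = triint q (a, cmid a b, cmid a c)
    + triint q (cmid a b, b, cmid b c) + triint q (cmid a c, cmid b c, c)
    - triint q (cmid a b, cmid a c, cmid b c).
Proof.
move=> cK cq Ka Kb Kc; rewrite /triint (@segint_split _ q a b) ?(@segint_split _ q b c)
  ?(@segint_split _ q a c); try by move=> t t01; apply: cq; apply: cK.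
ring.
Qed.

(** One of the four quarters carries at least a quarter of the integral. The bound on the
    displacement of the first vertex makes those vertices converge under iteration. *)
Lemma triint_bisect q (K : set C) (s : C * C * C) : cconvex K ->
  (forall z, K z -> ccontinuous_at q z) -> vertices_in K s ->
  exists s', [/\ vertices_in K s', perimeter s' = perimeter s / 2,
    cabs (s'.1.1 - s.1.1) <= perimeter s & cabs (triint q s) <= 4 * cabs (triint q s')].
Proof.
move=> cK cq; move: s => [[a b] c] [Ka Kb Kc].
have Kab := cconvex_mid cK Ka Kb; have Kbc := cconvex_mid cK Kb Kc.
have Kac := cconvex_mid cK Ka Kc.
have E := triint_split cK cq Ka Kb Kc.
set T0 := cabs (triint q (a, b, c)).
have h1 : 0 <= cabs (b - a) by exact: cabs_ge0.
have h2 : 0 <= cabs (c - b) by exact: cabs_ge0.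
have h3 : 0 <= cabs (c - a) by exact: cabs_ge0.
have m1 : cmid a b - a = (b - a) / 2 by rewrite /cmid; field.
have m2 : cmid a c - a = (c - a) / 2 by rewrite /cmid; field.
have m3 : cmid a c - cmid a b = (c - b) / 2 by rewrite /cmid; field.
have m4 : b - cmid a b = (b - a) / 2 by rewrite /cmid; field.
have m5 : cmid b c - b = (c - b) / 2 by rewrite /cmid; field.
have m6 : cmid b c - cmid a b = (c - a) / 2 by rewrite /cmid; field.
have m7 : cmid b c - cmid a c = (b - a) / 2 by rewrite /cmid; field.
have m8 : c - cmid b c = (c - b) / 2 by rewrite /cmid; field.
have m9 : c - cmid a c = (c - a) / 2 by rewrite /cmid; field.
have [l1|g1] := leP T0 (4 * cabs (triint q (a, cmid a b, cmid a c))).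
  exists (a, cmid a b, cmid a c); split => //=.
  - by rewrite m1 m2 m3 !cabs_half; lra.
  - by rewrite subrr cabs0; lra.
have [l2|g2] := leP T0 (4 * cabs (triint q (cmid a b, b, cmid b c))).
  exists (cmid a b, b, cmid b c); split => //=.
  - by rewrite m4 m5 m6 !cabs_half; lra.
  - by rewrite m1 cabs_half; lra.
have [l3|g3] := leP T0 (4 * cabs (triint q (cmid a c, cmid b c, c))).
  exists (cmid a c, cmid b c, c); split => //=.
  - by rewrite m7 m8 m9 !cabs_half; lra.
  - by rewrite m2 cabs_half; lra.
(* Each outer quarter carries less than a quarter of [T0], so the middle one must carry more. *)
exists (cmid a b, cmid a c, cmid b c); split => //=.
- by rewrite m3 m6 m7 !cabs_half; lra.
- by rewrite m1 cabs_half; lra.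
have : T0 <= cabs (triint q (a, cmid a b, cmid a c))
    + cabs (triint q (cmid a b, b, cmid b c)) + cabs (triint q (cmid a c, cmid b c, c))
    + cabs (triint q (cmid a b, cmid a c, cmid b c)).
  rewrite /T0 E; apply: le_trans (cabsB _ _) _; rewrite lerD2r.
  apply: le_trans (cabsD _ _) _; rewrite lerD2r; exact: cabsD.
lra.
Qed.

(** Subtracting the affine function q p + l (z - p), whose triangle integral vanishes, leaves only
    the first-order error, integrated over the three sides. *)
Lemma triint_affine_error q (K : set C) (s : C * C * C) (p l : C) (e : R) :
  cconvex K -> (forall z, K z -> ccontinuous_at q z) -> vertices_in K s ->
  (forall z, K z -> cabs (z - s.1.1) <= perimeter s ->
     cabs (q z - q p - l * (z - p)) <= e) ->
  cabs (triint q s) <= perimeter s * (e * 2).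
Proof.
move=> cK cq; move: s => [[a b] c] [Ka Kb Kc] He.
pose A z := (q p - l * p) + l * z; pose E z := q z - A z.
have cA z : ccontinuous_at A z.
  apply: (@has_cderiv_continuous _ _ _ l) => d d0; exists 1 => // w _.
  have -> : A w - A z - l * (w - z) = 0 by rewrite /A; ring.
  by rewrite cabs0 mulr_ge0 ?cabs_ge0 ?ltW.
have cE z : K z -> ccontinuous_at E z.
  move=> Kz d d0; have [d1 d10 H1] := cq z Kz _ (divr_gt0 d0 (ltr0n _ 2)).
  have [d2 d20 H2] := cA z _ (divr_gt0 d0 (ltr0n _ 2)).
  exists (Num.min d1 d2) => [|w]; first by rewrite lt_min d10.
  rewrite lt_min => /andP[/H1 w1 /H2 w2].
  have -> : E w - E z = (q w - q z) - (A w - A z) by rewrite /E; ring.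
  by apply: le_lt_trans (cabsB _ _) _; lra.
have qE : q = fun z => A z + E z by apply/funext => z; rewrite /E; ring.
have seg x y : K x -> K y -> segint q x y = segint A x y + segint E x y.
  move=> Kx Ky; by rewrite {1}qE segintD// => t t01; apply/cE/cK.
have -> : triint q (a, b, c) = segint E a b + segint E b c - segint E a c.
  by rewrite /triint !seg// !segint_affine; field.
have sE x y : K x -> K y ->
    (forall t, 0 <= t <= 1 -> cabs (segpt x y t - a) <= perimeter (a, b, c)) ->
    cabs (segint E x y) <= cabs (y - x) * (e * 2).
  move=> Kx Ky Hp; apply: segint_le => t t01; first by apply/cE/cK.
  have -> : E (segpt x y t) = q (segpt x y t) - q p - l * (segpt x y t - p).
    by rewrite /E /A; ring.
  by apply: He => //; [apply: cK|exact: Hp].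
have h1 : 0 <= cabs (b - a) by exact: cabs_ge0.
have h2 : 0 <= cabs (c - b) by exact: cabs_ge0.
have h3 : 0 <= cabs (c - a) by exact: cabs_ge0.
have tz z (t : R) : 0 <= t <= 1 -> cabs (t%:C * z) <= cabs z.
  by move=> /andP[t0 t1]; rewrite cabsM cabs_real ger0_norm// ler_piMl ?cabs_ge0.
have s1 : cabs (segint E a b) <= cabs (b - a) * (e * 2).
  apply: sE => // t t01; rewrite /segpt addrC addKr /=.
  by have := tz (b - a) t t01; lra.
have s2 : cabs (segint E b c) <= cabs (c - b) * (e * 2).
  apply: sE => // t t01; have -> : segpt b c t - a = (b - a) + t%:C * (c - b).
    by rewrite /segpt; ring.
  by apply: le_trans (cabsD _ _) _; have := tz (c - b) t t01 => /=; lra.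
have s3 : cabs (segint E a c) <= cabs (c - a) * (e * 2).
  apply: sE => // t t01; rewrite /segpt addrC addKr /=.
  by have := tz (c - a) t t01; lra.
apply: le_trans (cabsB _ _) _ => /=; rewrite !mulrDl; apply: lerD s3.
by apply: le_trans (cabsD _ _) _; exact: lerD.
Qed.

End Triangles.

(** * Goursat's theorem on a triangle, also with one exceptional vertex *)

Section GoursatTheorem.
Context {R : realType}.
Local Notation C := (Cplx R).
Implicit Types (q : C -> C) (a b c p z w : C) (K : set C).

Definition climit_closed K := forall p,
  (forall e : R, 0 < e -> exists2 z, K z & cabs (z - p) < e) -> K p.

Lemma lt_pow2 (x y : R) : 0 < y -> exists n, x / 2 ^+ n < y.
Proof.
move=> y0; exists (Num.bound (x / y)).
rewrite ltr_pdivrMr ?exprn_gt0// mulrC -ltr_pdivrMr//.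
apply: le_lt_trans (ler_norm _) _.
apply: lt_trans (archi_boundP (normr_ge0 _)) _ => //.
rewrite -natrX ltr_nat.
by apply: leq_trans (ltn_expl _ (ltnSn 1)) _ => //; rewrite leq_exp2l //= /Num.bound normr_id.
Qed.

Theorem goursat q K (s : C * C * C) : cconvex K -> climit_closed K ->
  (forall z, K z -> exists l, has_cderiv q z l) -> vertices_in K s ->
  triint q s = 0.
Proof.
move=> cK clK dq Ks; apply/eqP; rewrite -cabs_eq0; apply/negPn/negP => T0.
have {T0} T0 : 0 < cabs (triint q s) by rewrite lt_def T0 cabs_ge0.
have cq z : K z -> ccontinuous_at q z.
  by move=> /dq[l]; exact: has_cderiv_continuous.
have /choice[nxt Hn] : forall s1 : C * C * C, exists s2 : C * C * C, vertices_in K s1 ->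
    [/\ vertices_in K s2, perimeter s2 = perimeter s1 / 2,
    cabs (s2.1.1 - s1.1.1) <= perimeter s1 &
    cabs (triint q s1) <= 4 * cabs (triint q s2)].
  move=> s1; have [K1|nK1] := pselect (vertices_in K s1); last by exists s1.
  by have [s2 Hs2] := triint_bisect cK cq K1; exists s2.
pose S n := iter n nxt s; pose D := perimeter s.
have HS n : [/\ vertices_in K (S n), perimeter (S n) = D / 2 ^+ n &
    cabs (triint q s) <= 4 ^+ n * cabs (triint q (S n))].
  elim: n => [|n [K1 P1 T1]]; first by rewrite !expr0 divr1 mul1r.
  have [K2 P2 _ T2] := Hn _ K1; split => //.
    by rewrite [LHS]P2 P1 exprSr invfM mulrA.
  by apply: le_trans T1 _; rewrite exprSr -mulrA ler_wpM2l ?exprn_ge0.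
have [p Hp] : exists p, forall n, cabs ((S n).1.1 - p) <= 4 * D / 2 ^+ n.
  apply: geometric_limit => n; have [K1 <- _] := HS n.
  by have [] := Hn _ K1.
have D0 : 0 <= D.
  by rewrite /D; case: (s) => -[a b] c /=; rewrite !addr_ge0 ?cabs_ge0.
have Kp : K p.
  apply: clK => e e0; have [n He] := lt_pow2 (4 * D) e0.
  exists (S n).1.1; last exact: le_lt_trans (Hp n) He.
  by have [+ _ _] := HS n; case: (S n) => -[a b] c [].
have [l Hl] := dq p Kp.
(* In the n-th triangle all points are within (4 + 1) D / 2^n of p, and the perimeter D / 2^n and
   the factor 2 of [segint_le] turn this into 10 e D^2 / 4^n. The summand 1 makes the final
   inequality strict and covers D = 0. *)
pose e := cabs (triint q s) / (10 * D ^+ 2 + 1).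
have d1 : 0 < 10 * D ^+ 2 + 1 by rewrite ltr_pwDr// mulr_ge0// sqr_ge0.
have e0 : 0 < e by rewrite divr_gt0.
have [d d0 Hd] := Hl e e0.
have [n Hn5] := lt_pow2 (5 * D) d0.
have [K1 P1 T1] := HS n.
have Terr : cabs (triint q (S n)) <= perimeter (S n) * (e * (5 * D / 2 ^+ n) * 2).
  apply: (@triint_affine_error _ q K _ p l) => // z Kz; rewrite P1 => zS.
  have zp : cabs (z - p) <= 5 * D / 2 ^+ n.
    have -> : z - p = (z - (S n).1.1) + ((S n).1.1 - p) by ring.
    by apply: le_trans (cabsD _ _) _; have := Hp n; lra.
  apply: le_trans (Hd _ (le_lt_trans zp Hn5)) _.
  by rewrite ler_wpM2l// ltW.
have : cabs (triint q s) <= e * (10 * D ^+ 2).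
  apply: le_trans T1 _; apply: le_trans (ler_wpM2l _ Terr) _; first exact: exprn_ge0.
  have -> : (4 : R) ^+ n = (2 ^+ n) ^+ 2.
    by rewrite -exprM mulnC exprM; congr (_ ^+ _); ring.
  rewrite P1.
  have p0 : (2 : R) ^+ n != 0 by rewrite expf_neq0.
  by rewrite le_eqVlt; apply/orP; left; apply/eqP; field.
rewrite /e mulrAC ler_pdivlMr// ler_pM2l//; lra.
Qed.

(** A difference quotient is only known to be continuous at its centre, which will be the vertex a.
    The conditions on u put b and c in an open half plane bounded by a line through a. The quarters
    not touching a then lie in a closed half plane avoiding a, where [goursat] applies, so the
    triangle can be halved towards a without changing its integral. *)
Theorem goursat_vertex q K a b c (u : C) : cconvex K -> climit_closed K ->
  (forall z, K z -> z != a -> exists l, has_cderiv q z l) -> ccontinuous_at q a ->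
  K a -> K b -> K c ->
  0 < complex.Re ((b - a) * u) -> 0 < complex.Re ((c - a) * u) ->
  triint q (a, b, c) = 0.
Proof.
move=> cK clK dq ca Ka Kb Kc bu cu.
have cq z : K z -> ccontinuous_at q z.
  have [->//|za Kz] := eqVneq z a.
  by have [l] := dq z Kz za; exact: has_cderiv_continuous.
have Rh z : complex.Re (z / 2) = complex.Re z / 2.
  have -> : z / 2 = (2^-1 : R)%:C * z by rewrite fmorphV rmorph_nat mulrC.
  by rewrite ReMr mulrC.
have cone (d : R) : 0 < d -> let K' := [set z | K z /\ d <= complex.Re ((z - a) * u)] in
    [/\ cconvex K', climit_closed K' & forall z, K' z -> exists l, has_cderiv q z l].
  move=> d0 /=; split.
  - move=> x y t [Kx dx] [Ky dy] t01; split; first exact: cK.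
    have -> : (segpt x y t - a) * u =
        (1 - t)%:C * ((x - a) * u) + t%:C * ((y - a) * u).
      by rewrite /segpt rmorphB rmorph1 /=; ring.
    rewrite ReD !ReMr; case/andP: t01 => t0 t1; nra.
  - move=> p Hp; split.
      by apply: clK => e /Hp[z [Kz _] ze]; exists z.
    apply/ler_addgt0Pl => e e0.
    have c1 : 0 < cabs u + 1 by rewrite ltr_pwDr ?cabs_ge0.
    have [z [Kz dz] ze] := Hp (e / (cabs u + 1)) (divr_gt0 e0 c1).
    apply: le_trans dz _.
    have -> : (z - a) * u = (z - p) * u + (p - a) * u by ring.
    rewrite ReD lerD2r; apply: le_trans (ler_norm _) _.
    apply: le_trans (Re_le_cabs _) _; rewrite cabsM.
    move: ze; rewrite ltr_pdivlMr// => /ltW; apply: le_trans.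
    by rewrite ler_wpM2l ?cabs_ge0// lerDl.
  - move=> z [Kz dz]; apply: dq => //; apply: contraTneq dz => ->.
    by rewrite subrr mul0r /= -ltNge.
have half x y : K x -> K y -> 0 < complex.Re ((x - a) * u) ->
    0 < complex.Re ((y - a) * u) ->
    triint q (a, x, y) = triint q (a, cmid a x, cmid a y).
  move=> Kx Ky xu yu.
  (* Halved because the midpoints [cmid a x] and [cmid a y] have half the height of x and y above
     the line through a. *)
  pose d := Num.min (complex.Re ((x - a) * u)) (complex.Re ((y - a) * u)) / 2.
  have dx : d * 2 <= complex.Re ((x - a) * u) by rewrite divfK// ge_min lexx.
  have dy : d * 2 <= complex.Re ((y - a) * u) by rewrite divfK// ge_min lexx orbT.
  have d0 : 0 < d by rewrite divr_gt0// lt_min xu.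
  have [cK' clK' dK'] := cone d d0.
  rewrite (triint_split cK cq Ka Kx Ky).
  have Kax : complex.Re ((cmid a x - a) * u) = complex.Re ((x - a) * u) / 2.
    by rewrite -Rh; congr complex.Re; rewrite /cmid; field.
  have Kay : complex.Re ((cmid a y - a) * u) = complex.Re ((y - a) * u) / 2.
    by rewrite -Rh; congr complex.Re; rewrite /cmid; field.
  have Kxy : complex.Re ((cmid x y - a) * u) =
      complex.Re ((x - a) * u) / 2 + complex.Re ((y - a) * u) / 2.
    by rewrite -!Rh -ReD; congr complex.Re; rewrite /cmid; field.
  have := cconvex_mid cK Ka Kx; have := cconvex_mid cK Ka Ky.
  have := cconvex_mid cK Kx Ky => Mxy May Max.
  rewrite (goursat (s := (cmid a x, x, cmid x y)) cK' clK' dK'); last first.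
    by split; split => //; rewrite ?Kax ?Kxy; lra.
  rewrite (goursat (s := (cmid a y, cmid x y, y)) cK' clK' dK'); last first.
    by split; split => //; rewrite ?Kay ?Kxy; lra.
  rewrite (goursat (s := (cmid a x, cmid a y, cmid x y)) cK' clK' dK'); last first.
    by split; split => //; rewrite ?Kax ?Kay ?Kxy; lra.
  by rewrite subr0 !addr0.
pose h x := cmid a x; pose D := perimeter (a, b, c).
have hS n : [/\ K (iter n h b), K (iter n h c),
      0 < complex.Re ((iter n h b - a) * u), 0 < complex.Re ((iter n h c - a) * u) &
      perimeter (a, iter n h b, iter n h c) = D / 2 ^+ n /\
      triint q (a, b, c) = triint q (a, iter n h b, iter n h c)].
  elim: n => [|n]; first by rewrite expr0 divr1.
  rewrite !iterS; set x := iter n h b; set y := iter n h c.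
  move=> [Kx Ky xu yu [DD TT]].
  split; try exact: cconvex_mid.
  - have -> : (h x - a) * u = (x - a) * u / 2 by rewrite /h /cmid; field.
    by rewrite Rh divr_gt0.
  - have -> : (h y - a) * u = (y - a) * u / 2 by rewrite /h /cmid; field.
    by rewrite Rh divr_gt0.
  - rewrite TT (half x y)//; split=> //.
    rewrite exprSr invfM mulrA -DD /=.
    have -> : h x - a = (x - a) / 2 by rewrite /h /cmid; field.
    have -> : h y - a = (y - a) / 2 by rewrite /h /cmid; field.
    have -> : h y - h x = (y - x) / 2 by rewrite /h /cmid; field.
    by rewrite !cabs_half; lra.
apply/eqP; rewrite -cabs_eq0 eq_le cabs_ge0 andbT.
apply/ler_addgt0Pl => e e0; rewrite addr0.
have [d d0 Hd] := ca 1 ltr01.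
have D0 : 0 <= D by rewrite /D /= !addr_ge0 ?cabs_ge0.
have me : 0 < Num.min e d by rewrite lt_min e0.
have [n] := lt_pow2 (2 * D) me; rewrite lt_min => /andP[ne nd].
have [Kx Ky _ _ [DD ->]] := hS n.
have Dn : 0 <= D / 2 ^+ n by rewrite divr_ge0 ?exprn_ge0.
apply: (@le_trans _ _ (D / 2 ^+ n * (1 * 2))); last by lra.
(* Slope 0 and error 1: continuity at a keeps q within 1 of q a, and the perimeter alone makes the
   bound small. *)
rewrite -DD; apply: (@triint_affine_error _ q K _ a 0) => // z _ /= zp.
rewrite mul0r subr0; apply/ltW/Hd; apply: le_lt_trans nd.
by apply: le_trans zp _; move: DD => /= ->; lra.
Qed.

End GoursatTheorem.

(** * Taylor expansion of holomorphic functions *)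

Section DiscCompactness.
Context {R : realType}.
Local Notation C := (Cplx R).
Implicit Types (q : C -> C) (z w : C).

(** The compact set is the square [-r, r]^2 of R x R, with the claim made conditional on lying in
    the disc; a point outside the disc has a neighbourhood where the claim is void. *)
Lemma disc_near_covering (I : Type) (F : set_system I) {FF : Filter F}
    (P : I -> C -> Prop) (r : R) :
  (forall z, cabs z <= r -> exists2 d : R, 0 < d &
     \forall i \near F, forall w, cabs (w - z) < d -> P i w) ->
  \forall i \near F, forall z, cabs z <= r -> P i z.
Proof.
move=> HP.
pose K : set (R * R) := `[- r, r] `*` `[- r, r].
have cK : compact K by apply: compact_setX; exact: segment_compact.
move/compact_near_coveringP : cK => /(_ I F (fun i p => cabs (Complex p.1 p.2 : C) <= r ->
  P i (Complex p.1 p.2)) FF) H.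
have : \forall i \near F, K `<=` (fun p => cabs (Complex p.1 p.2 : C) <= r -> P i (Complex p.1 p.2)).
  apply: H => -[x y] _ /=; set z : C := Complex x y.
  have [d d0 Hd] : exists2 d : R, 0 < d & \forall i \near F,
      forall w, cabs (w - z) < d -> cabs w <= r -> P i w.
    have [/HP [d d0 Hd]|rz] := leP (cabs z) r.
      exists d => //; near=> i => w wz _.
      suff : forall w, cabs (w - z) < d -> P i w by apply.
      by near: i.
    exists (cabs z - r); first by rewrite subr_gt0.
    near=> i => w wz wr; have : cabs z <= cabs (w - z) + cabs w.
      have -> : cabs z = cabs (w - (w - z)) by congr cabs; ring.
      by apply: le_trans (cabsB _ _) _; rewrite addrC.
    lra.
  have d20 : 0 < d / 2 by rewrite divr_gt0.
  exists ([set p : R * R | `|p.1 - x| < d / 2 /\ `|p.2 - y| < d / 2],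
     [set i | forall w, cabs (w - z) < d -> cabs w <= r -> P i w]) => /=.
    split => //; exists ([set a | `|a - x| < d / 2], [set a | `|a - y| < d / 2]) => /=.
      by split; apply/nbhs_ballP; exists (d / 2) => // a; rewrite /ball/= distrC.
    by move=> [a b] /= [].
  move=> [[a b] i] /= [[ax by_] Pi]; apply: Pi.
  by apply: le_lt_trans (cabs_le_ReIm _) _; rewrite ReB ImB /=; lra.
apply: filterS => i Hi z zr; have := Hi (complex.Re z, complex.Im z).
rewrite /K /= !in_itv/= -!ler_norml.
have -> : (Complex (complex.Re z) (complex.Im z) : C) = z by case: z {zr}.
by apply => //; split; apply: le_trans zr; [exact: Re_le_cabs|exact: Im_le_cabs].
Unshelve. all: by end_near. Qed.

(** The covering argument runs along d tending to 0 from the right, and any d reached by it is a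
    uniform modulus. *)
Lemma disc_unif_cont q (r : R) : (forall z, cabs z <= r -> ccontinuous_at q z) ->
  forall e : R, 0 < e -> exists2 d : R, 0 < d & forall z w, cabs z <= r -> cabs w <= r ->
    cabs (z - w) < d -> cabs (q z - q w) < e.
Proof.
move=> cq e e0.
have : \forall d \near (0 : R)^'+, forall z, cabs z <= r ->
    forall w, cabs (z - w) < d -> cabs (q z - q w) < e.
  apply: disc_near_covering => z zr.
  have [d d0 Hd] := cq z zr (e / 2) (divr_gt0 e0 (ltr0n _ 2)).
  exists (d / 2); first by rewrite divr_gt0.
  near=> s => w wz w' ww'.
  have sd : s < d / 2 by near: s; apply: nbhs_right_lt; rewrite divr_gt0.
  have -> : q w - q w' = (q w - q z) - (q w' - q z) by ring.
  apply: le_lt_trans (cabsB _ _) _.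
  have h1 : cabs (q w - q z) < e / 2 by apply: Hd; apply: lt_trans wz _; lra.
  have h2 : cabs (q w' - q z) < e / 2.
    apply: Hd; have -> : w' - z = (w - z) - (w - w') by ring.
    by apply: le_lt_trans (cabsB _ _) _; lra.
  lra.
move=> H; have [d [Hd d0]] : exists d : R, (forall z, cabs z <= r ->
    forall w, cabs (z - w) < d -> cabs (q z - q w) < e) /\ 0 < d.
  near ((0 : R)^'+) => d; exists d; split; near: d => //.
  exact: nbhs_right_gt.
by exists d => // z w zr _; apply: Hd.
Unshelve. all: by end_near. Qed.

Lemma disc_bounded q (r : R) : (forall z, cabs z <= r -> ccontinuous_at q z) ->
  exists M : R, forall z, cabs z <= r -> cabs (q z) <= M.
Proof.
move=> cq.
have H : \forall M \near (+oo : set_system R), forall z, cabs z <= r -> cabs (q z) <= M.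
  apply: disc_near_covering => z zr; have [d d0 Hd] := cq z zr 1 ltr01.
  exists d => //; near=> M => w /Hd wz.
  have -> : q w = (q w - q z) + q z by ring.
  apply: le_trans (cabsD _ _) _.
  have : 1 + cabs (q z) <= M by near: M; apply: nbhs_pinfty_ge; exact: num_real.
  lra.
by near (+oo : set_system R) => M; exists M; near: M.
Unshelve. all: by end_near. Qed.

End DiscCompactness.

(** * Roots of unity *)

Section RootsOfUnity.
Context {R : realType}.
Local Notation C := (Cplx R).

Definition cis (t : R) : C := Complex (cos t) (sin t).

Definition unity_root (N : nat) : C := cis (2 * pi / N%:R).

Lemma cisD s t : cis (s + t) = cis s * cis t.
Proof.
rewrite /cis cosD sinD; apply/eqP; rewrite eq_complex /=.
by rewrite eqxx /= addrC eqxx.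
Qed.

Lemma cis0 : cis 0 = 1.
Proof. by rewrite /cis cos0 sin0. Qed.

Lemma cisX t n : cis t ^+ n = cis (t *+ n).
Proof. by elim: n => [|n IH]; rewrite ?expr0 ?mulr0n ?cis0// exprS IH mulrS cisD. Qed.

Lemma cabs_cis t : cabs (cis t) = 1.
Proof. by rewrite /cabs /= cos2Dsin2 sqrtr1. Qed.

Lemma cabs_unity_root N : cabs (unity_root N) = 1.
Proof. exact: cabs_cis. Qed.

Lemma unity_root_expn N : unity_root N ^+ N = 1.
Proof.
case: N => [|N]; first exact: expr0.
rewrite cisX -[_ *+ N.+1]mulr_natr divfK ?pnatr_eq0// mulr_natl.
by rewrite /cis cos2pi sin2pi.
Qed.

(** Write the angle as 2x with 0 < x < pi: cos (2x) = 1 would force sin x = 0 by the double angle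
    formula. *)
Lemma unity_root_neq1 N j : (0 < j < N)%N -> unity_root N ^+ j != 1.
Proof.
move=> /andP[j0 jN]; rewrite cisX; apply/negP; rewrite eq_complex /= => /andP[/eqP + _].
set t := _ *+ j => ct.
have N0 : 0 < N%:R :> R by rewrite ltr0n (leq_trans _ jN).
have tE : t = 2 * (pi * (j%:R / N%:R)).
  by rewrite /t -[_ *+ j]mulr_natr; field; rewrite gt_eqF.
have q0 : 0 < j%:R / N%:R :> R by rewrite divr_gt0// ltr0n.
have q1 : j%:R / N%:R < 1 :> R by rewrite ltr_pdivrMr// mul1r ltr_nat.
have : 0 < sin (pi * (j%:R / N%:R) : R).
  apply: sin_gt0_pi; rewrite mulr_gt0 ?pi_gt0//=.
  by rewrite gtr_pMr ?pi_gt0.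
move: ct; rewrite tE mulr2n mulrDl mul1r cosD => ct.
have := cos2Dsin2 (pi * (j%:R / N%:R) : R).
rewrite !expr2; nra.
Qed.

Lemma unity_root_sum N j : (0 < j < N)%N -> \sum_(m < N) (unity_root N ^+ j) ^+ m = 0.
Proof.
move=> jN; have /eqP := subrX1 (unity_root N ^+ j) N.
rewrite exprAC unity_root_expn expr1n subrr eq_sym mulf_eq0 subr_eq0.
by rewrite (negPf (unity_root_neq1 jN)) /= => /eqP.
Qed.

Lemma unity_root_cvg1 (e : R) : 0 < e -> \forall N \near \oo, cabs (unity_root N - 1) < e.
Proof.
move=> e0; pose t (N : nat) : R := 2 * pi / N%:R.
have t0 : t N @[N --> \oo] --> (0 : R).
  rewrite -(mulr0 (2 * pi)); apply: cvgMr.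
  rewrite -(cvg_shiftS (fun n : nat => (n%:R : R)^-1)).
  exact: cvg_harmonic.
have c1 : cos (t N) @[N --> \oo] --> (1 : R).
  by rewrite -cos0; apply: (cvg_comp _ _ t0); exact: continuous_cos.
have s1 : sin (t N) @[N --> \oo] --> (0 : R).
  by rewrite -[X in _ --> X]sin0; apply: (cvg_comp _ _ t0); exact: continuous_sin.
have e2 : 0 < e / 2 by rewrite divr_gt0.
move/cvgrPdist_lt : c1 => /(_ _ e2) c1; move/cvgrPdist_lt : s1 => /(_ _ e2) s1.
near=> N; apply: le_lt_trans (cabs_le_ReIm _) _; rewrite ReB ImB /= -/(t N).
have : `|cos (t N) - 1| < e / 2 by rewrite distrC; near: N.
have : `|sin (t N) - 0| < e / 2 by rewrite distrC; near: N.
lra.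
Unshelve. all: by end_near. Qed.

End RootsOfUnity.

(** * Difference quotients and their averages over a circle *)

Section Interpolation.
Context {R : realType}.
Local Notation C := (Cplx R).
Implicit Types (f q : C -> C) (z w : C).

Lemma geometric_sum_le (q : R) m n : 0 <= q < 1 ->
  \sum_(m <= k < n) q ^+ k <= q ^+ m / (1 - q).
Proof.
move=> /andP[q0 q1]; have q2 : 0 < 1 - q by rewrite subr_gt0.
rewrite ler_pdivlMr//.
have [mn|nm] := leqP m n; last by rewrite big_geq ?mul0r ?exprn_ge0// ltnW.
have -> : (\sum_(m <= k < n) q ^+ k) * (1 - q) = q ^+ m - q ^+ n.
  rewrite mulr_suml -[RHS]opprB -telescope_sumr// -sumrN.
  by apply: eq_bigr => k _; rewrite exprS; ring.
by rewrite gerBl exprn_ge0.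
Qed.

Definition diffquot f z (l : C) (w : C) : C :=
  if w == z then l else (f w - f z) / (w - z).

Lemma diffquot_continuous f z l : has_cderiv f z l ->
  ccontinuous_at (diffquot f z l) z.
Proof.
move=> H e e0; have [d d0 Hd] := H (e / 2) (divr_gt0 e0 (ltr0n _ 2)).
exists d => // w wz; rewrite /diffquot eqxx; case: eqVneq => [_|wz0].
  by rewrite subrr cabs0.
have wz1 : 0 < cabs (w - z) by rewrite cabs_gt0 subr_eq0.
have -> : (f w - f z) / (w - z) - l = (f w - f z - l * (w - z)) / (w - z).
  by rewrite [RHS]mulrBl mulfK// subr_eq0.
rewrite cabsM cabsV ltr_pdivrMr//; apply: le_lt_trans (Hd _ wz) _.
by rewrite ltr_pM2r//; lra.
Qed.

Lemma diffquot_has_cderiv f z l w l' : w != z -> has_cderiv f w l' ->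
  exists m, has_cderiv (diffquot f z l) w m.
Proof.
move=> wz /has_cderiv_is_derive fw.
pose g (y : C) : C := (f y - f z) / (y - z).
have wz0 : w - z != 0 by rewrite subr_eq0.
have dg : derivable g w 1.
  apply: (@derivableM _ _ (fun y => f y - f z) (fun y => (y - z)^-1)).
    by apply: derivableB => //; exact: derivable_cst.
  by apply: derivableV => //; apply: derivableB.
exists (derive1 g w) => e e0; have [d d0 Hd] := derivable_has_cderiv dg e0.
exists (Num.min d (cabs (w - z))).
  by rewrite lt_min d0 cabs_gt0.
move=> y; rewrite lt_min => /andP[yd yz].
rewrite /diffquot (negPf wz) ifN; first exact: Hd.
by apply: contraTneq yz => ->; rewrite cabsC ltxx.
Qed.

Definition circle_pt (r : R) (N m : nat) : C := r%:C * unity_root N ^+ m.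

Lemma cabs_circle_pt r N m : 0 <= r -> cabs (circle_pt r N m) = r.
Proof.
by move=> r0; rewrite cabsM cabs_real cabsX cabs_unity_root expr1n mulr1 ger0_norm.
Qed.

Lemma disc_convex (r : R) : cconvex [set z : C | cabs z <= r].
Proof.
move=> a b t /= ar br /andP[t0 t1].
have -> : segpt a b t = (1 - t)%:C * a + t%:C * b.
  by rewrite /segpt rmorphB rmorph1 /=; ring.
apply: le_trans (cabsD _ _) _; rewrite !cabsM !cabs_real !ger0_norm ?subr_ge0//.
nra.
Qed.

Lemma disc_closed (r : R) : climit_closed [set z : C | cabs z <= r].
Proof.
move=> p Hp /=; apply/ler_addgt0Pl => e e0; have [z /= zr zp] := Hp e e0.
have -> : p = z - (z - p) by ring.
by apply: le_trans (cabsB _ _) _; lra.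
Qed.

Section Kernel.
Variables (f : C -> C) (r : R) (z0 : C).
Hypothesis r01 : 0 < r < 1.
Hypothesis df : forall z, cabs z < 1 -> exists l, has_cderiv f z l.
Hypothesis z0r : cabs z0 < r.
Variable l0 : C.
Hypothesis dfz0 : has_cderiv f z0 l0.
Let q := diffquot f z0 l0.
Let K := [set z : C | cabs z <= r].
Let zeta := circle_pt r.

Let r0 : 0 <= r. Proof. by case/andP: r01 => /ltW. Qed.

Let dq w : cabs w <= r -> w != z0 -> exists m, has_cderiv q w m.
Proof.
move=> wr wz; have [|l Hl] := df (z := w).
  by case/andP: r01 => _; apply: le_lt_trans.
exact: diffquot_has_cderiv wz Hl.
Qed.

Let cq w : cabs w <= r -> ccontinuous_at q w.
Proof.
move=> wr; have [->|wz] := eqVneq w z0; first exact: diffquot_continuous.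
by have [m] := dq wr wz; exact: has_cderiv_continuous.
Qed.

(** The chord is shorter than the distance from z0 to the circle. With u the conjugate of the first
    spoke, both spokes then have positive real part after multiplication by u, as [goursat_vertex]
    requires. *)
Lemma sector_triint N m : r * cabs (unity_root N - 1) < r - cabs z0 ->
  triint q (z0, zeta N m, zeta N m.+1) = 0.
Proof.
move=> Nr.
have zr k : cabs (zeta N k) = r by exact: cabs_circle_pt.
set a := zeta N m; set b := zeta N m.+1.
have ab : cabs (b - a) = r * cabs (unity_root N - 1).
  have -> : b - a = zeta N m * (unity_root N - 1) by rewrite /b /a /zeta /circle_pt exprS; ring.
  by rewrite cabsM zr.
have az : r - cabs z0 <= cabs (a - z0).
  by rewrite lerBlDr; rewrite -{1}(zr m) -{1}(subrK z0 (zeta N m)) cabsD.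
pose u : C := (a - z0)^*%C.
have au : (a - z0) * u = (cabs (a - z0) ^+ 2)%:C.
  rewrite /u -sqr_normc norm_cabs rmorphXn //.
have cu : cabs u = cabs (a - z0).
  by rewrite /u /cabs; case: (a - z0) => x y /=; rewrite sqrrN.
apply: (@goursat_vertex _ q K _ _ _ u).
- exact: disc_convex.
- exact: disc_closed.
- by move=> z Kz; exact: dq.
- exact: cq (ltW z0r).
- exact: ltW z0r.
- by rewrite /K /= zr.
- by rewrite /K /= zr.
- by rewrite au /= exprn_gt0//; apply: lt_le_trans az; rewrite subr_gt0.
- have -> : (b - z0) * u = (a - z0) * u + (b - a) * u by ring.
  rewrite ReD au /=.
  have : `|complex.Re ((b - a) * u)| < cabs (a - z0) ^+ 2.
    apply: le_lt_trans (Re_le_cabs _) _; rewrite cabsM cu ab expr2 ltr_pM2r.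
      exact: lt_le_trans Nr az.
    by apply: lt_le_trans az; rewrite subr_gt0.
  rewrite ltr_norml => /andP[+ _]; lra.
Qed.

Lemma sum_segint_circle N : (0 < N)%N -> r * cabs (unity_root N - 1) < r - cabs z0 ->
  \sum_(m < N) segint q (zeta N m) (zeta N m.+1) = 0.
Proof.
move=> N0 Nr.
transitivity (\sum_(0 <= m < N) (segint q z0 (zeta N m.+1) - segint q z0 (zeta N m))).
  rewrite big_mkord; apply: eq_bigr => m _.
  have := sector_triint m Nr; rewrite /triint => /eqP; rewrite subr_eq0 => /eqP <-.
  by ring.
rewrite telescope_sumr// /zeta /circle_pt unity_root_expn expr0; exact: subrr.
Qed.

(* The Riemann sums of the integral of the difference quotient over the circle
   tend to [0], since the integral over each inscribed polygon vanishes by Goursat. *)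
Lemma kernel_average_cvg0 (e : R) : 0 < e ->
  \forall N \near \oo, cabs (\sum_(m < N) q (zeta N m) * zeta N m) <= e * N%:R.
Proof.
move=> e0; have rr : 0 < r by case/andP: r01.
(* With this oscillation of q along a chord of length r |omega - 1|, omega being the root of unity,
   the factor 2 of [segint_le] gives an error of e |omega - 1| per chord. *)
have e1 : 0 < e / (2 * r) by rewrite divr_gt0// mulr_gt0.
have [d d0 Hd] := disc_unif_cont cq e1.
pose d' := Num.min d (r - cabs z0) / r.
have d'0 : 0 < d' by rewrite divr_gt0// lt_min d0 subr_gt0.
near=> N.
have N2 : (1 < N)%N by near: N; exists 2%N.
have : cabs (unity_root N - 1 : C) < d' by near: N; exact: unity_root_cvg1.
rewrite /d' ltr_pdivlMr// mulrC lt_min => /andP[Nd Nz].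
have o1 : unity_root N - 1 != 0 :> C.
  by rewrite subr_eq0 -(expr1 (unity_root N)) unity_root_neq1.
have co : 0 < cabs (unity_root N - 1 : C) by rewrite cabs_gt0.
have zr k : cabs (zeta N k) = r by exact: cabs_circle_pt.
have zS m : zeta N m.+1 - zeta N m = zeta N m * (unity_root N - 1).
  by rewrite /zeta /circle_pt exprS; ring.
have zn m : cabs (zeta N m.+1 - zeta N m) = r * cabs (unity_root N - 1).
  by rewrite zS cabsM zr.
have approx m : cabs (segint q (zeta N m) (zeta N m.+1) -
    q (zeta N m) * (zeta N m.+1 - zeta N m)) <= e * cabs (unity_root N - 1).
  set a := zeta N m; set b := zeta N m.+1.
  have Kab t : 0 <= t <= 1 -> cabs (segpt a b t) <= r.
    by move=> t01; apply: disc_convex => //=; rewrite /a /b zr.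
  pose k (w : C) := q a + 0 * w; pose g w := q w - k w.
  have ck w : ccontinuous_at k w.
    by move=> s s0; exists 1 => // y _; rewrite /k !mul0r subrr cabs0.
  have cg w : cabs w <= r -> ccontinuous_at g w.
    move=> wr s s0; have [s1 s10 H1] := cq wr s0; exists s1 => // y /H1.
    by rewrite /g /k !mul0r !addr0 opprB addrA subrK.
  have qE : q = fun w => k w + g w by apply/funext => w; rewrite /g; ring.
  have -> : segint q a b = segint k a b + segint g a b.
    by rewrite {1}qE segintD// => t t01; apply/cg/Kab.
  have -> : segint k a b = q a * (b - a) by rewrite segint_affine mul0r mul0r addr0 mulrC.
  rewrite addrAC subrr add0r.
  apply: le_trans (segint_le (M := e / (2 * r)) _ _) _.
  - by move=> t t01; apply/cg/Kab.
  - move=> t t01; rewrite /g /k mul0r addr0; apply/ltW/Hd; first exact: Kab.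
      by rewrite /a zr.
    rewrite /segpt addrC addKr cabsM cabs_real; case/andP: t01 => t0 t1.
    rewrite ger0_norm//; apply: le_lt_trans Nd; rewrite zn ler_piMl//.
    by rewrite mulr_ge0 ?cabs_ge0.
  - rewrite zn le_eqVlt; apply/orP; left; apply/eqP; field.
    by rewrite gt_eqF.
(* Consecutive circle points differ by zeta_m (omega - 1), so multiplication by omega - 1 turns the
   average into a Riemann sum along the closed polygon. *)
rewrite -(ler_pM2r co) -cabsM.
have -> : (\sum_(m < N) q (zeta N m) * zeta N m) * (unity_root N - 1) =
   - \sum_(m < N) (segint q (zeta N m) (zeta N m.+1) -
     q (zeta N m) * (zeta N m.+1 - zeta N m)).
  rewrite sumrB sum_segint_circle ?(ltn_trans _ N2)// sub0r opprK mulr_suml.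
  by apply: eq_bigr => m _; rewrite zS mulrA.
rewrite cabsN; apply: le_trans (cabs_sum _ _ _) _.
apply: (@le_trans _ _ (\sum_(m < N) e * cabs (unity_root N - 1 : C))).
  by apply: ler_sum => m _; exact: approx.
by rewrite sumr_const card_ord -[_ *+ N]mulr_natr mulrAC.
Unshelve. all: by end_near. Qed.

End Kernel.

End Interpolation.

(** * Limits of bounded sequences along an ultrafilter *)

Section UltraLimit.
Context {R : realType}.
Local Notation C := (Cplx R).

Lemma ultra_bounded_real (U : set_system nat) (x : nat -> R) (B : R) :
  UltraFilter U -> (\forall n \near U, `|x n| <= B) ->
  exists l : R, x n @[n --> U] --> l.
Proof.
move=> UU xB; have := @segment_compact _ (- B) B.
rewrite compact_ultra => /(_ (x n @[n --> U])) [].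
- split; first exact: fmap_proper_filter.
  move=> G GF UG; apply/seteqP; split => // A GA.
  have [//|UA] := in_ultra_setVsetC (x @^-1` A) UU.
  have : G (A `&` ~` A) by apply: filterI => //; exact: UG.
  by rewrite setICr => /filter_not_empty.
- by apply: filterS xB => n; rewrite /= in_itv/= ler_norml.
by move=> l [_ /= xl]; exists l.
Qed.

(** A single ultrafilter makes all bounded sequences converge at once; this takes the place of a
    diagonal extraction over the Taylor coefficients. *)
Lemma ultra_bounded (U : set_system nat) (x : nat -> C) (B : R) :
  UltraFilter U -> (\forall n \near U, cabs (x n) <= B) ->
  exists l : C, forall e : R, 0 < e -> \forall n \near U, cabs (x n - l) < e.
Proof.
move=> UU xB.
have [|a Ha] := @ultra_bounded_real U (fun n => complex.Re (x n)) B UU.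
  by apply: filterS xB => n; exact/le_trans/Re_le_cabs.
have [|b Hb] := @ultra_bounded_real U (fun n => complex.Im (x n)) B UU.
  by apply: filterS xB => n; exact/le_trans/Im_le_cabs.
exists (Complex a b) => e e0; have e2 : 0 < e / 2 by rewrite divr_gt0.
move/cvgrPdist_lt : Ha => /(_ _ e2) Ha; move/cvgrPdist_lt : Hb => /(_ _ e2) Hb.
near=> n; apply: le_lt_trans (cabs_le_ReIm _) _; rewrite ReB ImB /=.
have : `|complex.Re (x n) - a| < e / 2 by rewrite distrC; near: n.
have : `|complex.Im (x n) - b| < e / 2 by rewrite distrC; near: n.
lra.
Unshelve. all: by end_near. Qed.

End UltraLimit.

(** * Power series expansion from discrete Cauchy integrals *)

Section PowerSeriesExpansion.
Context {R : realType}.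
Local Notation C := (Cplx R).
Implicit Types (f : C -> C) (z w : C).

(** Riemann sum of the Cauchy integral (2 pi i)^-1 f(w) w^(-k-1) dw over |w| = r. *)
Definition circle_coef f (r : R) (N k : nat) : C :=
  (\sum_(m < N) f (circle_pt r N m) / circle_pt r N m ^+ k) / N%:R.

Lemma circle_pt_expN (r : R) N m : circle_pt r N m ^+ N = (r%:C : C) ^+ N.
Proof. by rewrite exprMn exprAC unity_root_expn expr1n mulr1. Qed.

Lemma circle_coef_le f (r M : R) N k : 0 < r -> (0 < N)%N ->
  (forall z, cabs z <= r -> cabs (f z) <= M) -> cabs (circle_coef f r N k) * r ^+ k <= M.
Proof.
move=> r0 N0 fM; rewrite cabsM cabsV cabs_nat.
rewrite -ler_pdivlMr ?exprn_gt0// ler_pdivrMr ?ltr0n//.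
apply: le_trans (cabs_sum _ _ _) _.
apply: (@le_trans _ _ (\sum_(m < N) M / r ^+ k)).
  apply: ler_sum => m _; rewrite cabsM cabsV cabsX cabs_circle_pt ?(ltW r0)//.
  by rewrite ler_wpM2r ?invr_ge0 ?exprn_ge0 ?(ltW r0)// fM// cabs_circle_pt ?(ltW r0).
by rewrite sumr_const card_ord -[_ *+ N]mulr_natr.
Qed.

(** All circle points have the same N-th power r^N, so the truncated geometric series is the Cauchy
    kernel times a factor that does not depend on m. *)
Lemma circle_geometric (r : R) N m z : 0 < r -> cabs z < r -> (0 < N)%N ->
  \sum_(k < N) (z / circle_pt r N m) ^+ k =
  (1 - (z / r%:C) ^+ N) * (circle_pt r N m / (circle_pt r N m - z)).
Proof.
move=> r0 zr N0; set c := circle_pt r N m.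
have cr : cabs c = r by rewrite cabs_circle_pt ?(ltW r0).
have c0 : c != 0 by rewrite -cabs_gt0 cr.
have cz : c - z != 0.
  by rewrite subr_eq0; apply: contraTneq zr => <-; rewrite cr ltxx.
have := subrX1 (z / c) N.
rewrite [in LHS]expr_div_n circle_pt_expN -expr_div_n => E.
have -> : 1 - (z / r%:C) ^+ N = (1 - z / c) * \sum_(k < N) (z / c) ^+ k.
  by rewrite -[LHS]opprB E; ring.
by field; rewrite c0 cz.
Qed.

(** Discrete Cauchy formula for the constant 1: summed over m first, the powers with 0 < k < N
    vanish, because omega^(-k) = omega^(N-k). *)
Lemma circle_average1 (r : R) N z : 0 < r -> (0 < N)%N ->
  \sum_(m < N) \sum_(k < N) (z / circle_pt r N m) ^+ k = N%:R.
Proof.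
move=> r0 N0; rewrite exchange_big /=.
case: N N0 => // N _; rewrite big_ord_recl /= [X in _ + X]big1.
  by under eq_bigr do rewrite expr0; rewrite sumr_const card_ord addr0.
move=> k _; rewrite /bump /= add1n.
have kN : (0 < N.+1 - k.+1 < N.+1)%N by rewrite subSS subn_gt0 ltn_ord ltnS leq_subr.
have rC : (r%:C : C) != 0 by rewrite -cabs_eq0 cabs_real normr_eq0 gt_eqF.
have o0 : unity_root N.+1 != 0 :> C by rewrite -cabs_gt0 cabs_unity_root.
transitivity (\sum_(m < N.+1) (z / r%:C) ^+ k.+1 * (unity_root N.+1 ^+ (N.+1 - k.+1)) ^+ m).
  apply: eq_bigr => m _; rewrite /circle_pt invfM mulrA exprMn; congr (_ * _).
  rewrite exprVn -exprM -exprM mulnC -[LHS]mul1r.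
  have <- : unity_root N.+1 ^+ (N.+1 * m) = 1 :> C by rewrite exprM unity_root_expn expr1n.
  have -> : (N.+1 * m = (N.+1 - k.+1) * m + k.+1 * m)%N.
    by rewrite -mulnDl subnK// leqW.
  by rewrite exprD mulfK// expf_neq0.
by rewrite -mulr_sumr unity_root_sum ?mulr0.
Qed.

(** By [circle_average1], f z is an average against the same truncated kernel as the interpolating
    polynomial. Subtracting under the sum produces the difference quotient, whose average
    [kernel_average_cvg0] makes small. *)
Lemma interpolation_error f (r : R) N z (l : C) : 0 < r -> cabs z < r -> (0 < N)%N ->
  \sum_(k < N) circle_coef f r N k * z ^+ k - f z =
  (1 - (z / r%:C) ^+ N) *
  ((\sum_(m < N) diffquot f z l (circle_pt r N m) * circle_pt r N m) / N%:R).
Proof.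
move=> r0 zr N0; have NC : (N%:R : C) != 0 by rewrite pnatr_eq0 -lt0n.
have cz m : circle_pt r N m != z.
  by apply: contraTneq zr => <-; rewrite cabs_circle_pt ?ltxx ?(ltW r0).
have c0 m : circle_pt r N m != 0.
  by rewrite -cabs_gt0 cabs_circle_pt ?(ltW r0).
have -> : \sum_(k < N) circle_coef f r N k * z ^+ k =
    (\sum_(m < N) f (circle_pt r N m) * \sum_(k < N) (z / circle_pt r N m) ^+ k) / N%:R.
  under [in RHS]eq_bigr do rewrite mulr_sumr.
  rewrite exchange_big /= mulr_suml; apply: eq_bigr => k _.
  rewrite /circle_coef mulrAC mulr_suml; congr (_ / _); apply: eq_bigr => m _.
  by rewrite expr_div_n mulrAC mulrA.
have -> : f z = (\sum_(m < N) f z * \sum_(k < N) (z / circle_pt r N m) ^+ k) / N%:R.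
  by rewrite -mulr_sumr circle_average1// mulfK.
rewrite -mulrBl -sumrB mulrA; congr (_ / _); rewrite mulr_sumr.
apply: eq_bigr => m _; rewrite circle_geometric// -mulrBl /diffquot (negPf (cz m)).
by field; rewrite subr_eq0.
Qed.

(* The discrete Cauchy coefficients [circle_coef] over the [N]-th roots of unity
   are bounded; their limits along an ultrafilter are the Taylor coefficients. *)
Theorem holo_power_series_radius f (r : R) : 0 < r < 1 ->
  (forall z, cabs z < 1 -> exists l, has_cderiv f z l) ->
  exists (a : nat -> C) (M : R), (forall k, cabs (a k) * r ^+ k <= M) /\
   forall z, cabs z < r -> forall L,
     cabs (f z - \sum_(k < L) a k * z ^+ k) <= M * ((cabs z / r) ^+ L / (1 - cabs z / r)).
Proof.
move=> /andP[r0 r1] df.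
have cf z : cabs z <= r -> ccontinuous_at f z.
  by move=> zr; have [l] := df z (le_lt_trans zr r1); exact: has_cderiv_continuous.
have [M HM] := disc_bounded cf.
have [U [UU oU]] := @ultraFilterLemma nat \oo _.
have U0 : \forall N \near U, (0 < N)%N by apply: oU; exists 1%N.
have /choice[a Ha] : forall k, exists l, forall e : R, 0 < e ->
    \forall N \near U, cabs (circle_coef f r N k - l) < e.
  move=> k; apply: (@ultra_bounded _ _ _ (M / r ^+ k)) => //.
  by apply: filterS U0 => N N0; rewrite ler_pdivlMr ?exprn_gt0// circle_coef_le.
have aM k : cabs (a k) * r ^+ k <= M.
  rewrite -ler_pdivlMr ?exprn_gt0//; apply/ler_addgt0Pl => e e0.
  have [N [N0 HN]] : exists N, (0 < N)%N /\ cabs (circle_coef f r N k - a k) < e.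
    near U => N; exists N; split; near: N => //; exact: Ha.
  have -> : a k = circle_coef f r N k - (circle_coef f r N k - a k) by ring.
  apply: le_trans (cabsB _ _) _; rewrite addrC; apply: lerD; first exact: ltW.
  by rewrite ler_pdivlMr ?exprn_gt0// circle_coef_le.
exists a, M; split => // z zr L.
set q := cabs z / r.
have q01 : 0 <= q < 1 by rewrite divr_ge0 ?cabs_ge0 ?(ltW r0)//= ltr_pdivrMr ?mul1r.
apply/ler_addgt0Pl => e e0; have e2 : 0 < e / 4 by rewrite divr_gt0.
(* Convergence along [U] is known for each coefficient, hence for finitely many at once: the cutoff
   stays fixed while N grows. *)
have partial n (s : R) : 0 < s -> \forall N \near U,
    cabs (\sum_(k < n) circle_coef f r N k * z ^+ k - \sum_(k < n) a k * z ^+ k) < s.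
  elim: n s => [|n IH] s s0.
    by near=> N; rewrite !big_ord0 subrr cabs0.
  have s2 : 0 < s / 2 by rewrite divr_gt0.
  have z1 : 0 < cabs (z ^+ n) + 1 by rewrite ltr_pwDr ?cabs_ge0.
  near=> N; rewrite !big_ord_recr /= opprD addrACA -mulrBl.
  apply: le_lt_trans (cabsD _ _) _; rewrite cabsM.
  have h1 : cabs (\sum_(k < n) circle_coef f r N k * z ^+ k - \sum_(k < n) a k * z ^+ k) < s / 2.
    by near: N; exact: IH.
  have : cabs (circle_coef f r N n - a n) < s / 2 / (cabs (z ^+ n) + 1).
    by near: N; apply: Ha; rewrite divr_gt0.
  rewrite ltr_pdivlMr// => h2.
  have h3 : cabs (circle_coef f r N n - a n) * cabs (z ^+ n) <=
      cabs (circle_coef f r N n - a n) * (cabs (z ^+ n) + 1).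
    by rewrite ler_wpM2l ?cabs_ge0// lerDl.
  lra.
have [l Hl] := df z (lt_trans zr r1).
have [N [[N0 LN] [h1 h2]]] : exists N, ((0 < N)%N /\ (L <= N)%N) /\
    (cabs (\sum_(k < L) circle_coef f r N k * z ^+ k - \sum_(k < L) a k * z ^+ k) < e / 4 /\
     cabs (\sum_(m < N) diffquot f z l (circle_pt r N m) * circle_pt r N m) <= e / 4 * N%:R).
  near U => N; exists N; split; split; near: N => //.
  - by apply: oU; exists L.
  - exact: partial.
  - apply: oU; apply: kernel_average_cvg0 => //; exact/andP.
have h3 : cabs (\sum_(k < N) circle_coef f r N k * z ^+ k - f z) <= e / 2.
  rewrite (interpolation_error f l r0 zr N0) cabsM.
  have : cabs (1 - (z / r%:C) ^+ N) <= 2.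
    apply: le_trans (cabsB _ _) _; rewrite cabs1 cabsX cabsM cabsV cabs_real gtr0_norm// -/q.
    have : q ^+ N <= 1 by case/andP: q01 => ? ?; rewrite exprn_ile1// ltW.
    lra.
  have : cabs ((\sum_(m < N) diffquot f z l (circle_pt r N m) * circle_pt r N m) / N%:R) <= e / 4.
    by rewrite cabsM cabsV cabs_nat ler_pdivrMr ?ltr0n.
  have := cabs_ge0 ((\sum_(m < N) diffquot f z l (circle_pt r N m) * circle_pt r N m) / N%:R).
  have := cabs_ge0 (1 - (z / r%:C) ^+ N).
  nra.
have h4 : cabs (\sum_(k < N) circle_coef f r N k * z ^+ k -
    \sum_(k < L) circle_coef f r N k * z ^+ k) <= M * (q ^+ L / (1 - q)).
  have M0 : 0 <= M by apply: le_trans (HM 0 _); rewrite ?cabs_ge0// cabs0 ltW.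
  have -> : \sum_(k < N) circle_coef f r N k * z ^+ k - \sum_(k < L) circle_coef f r N k * z ^+ k
    = \sum_(L <= k < N) circle_coef f r N k * z ^+ k.
    by rewrite -!(big_mkord xpredT (fun k => circle_coef f r N k * z ^+ k))
      (big_cat_nat (leq0n L) LN)/= addrAC subrr add0r.
  apply: le_trans (cabs_sum _ _ _) _.
  apply: le_trans (ler_wpM2l M0 (geometric_sum_le L N q01)); rewrite mulr_sumr.
  apply: ler_sum => k _; rewrite cabsM cabsX /q expr_div_n [X in M * X]mulrC mulrA.
  rewrite ler_wpM2r ?exprn_ge0 ?cabs_ge0// ler_pdivlMr ?exprn_gt0//.
  exact: circle_coef_le.
set p := \sum_(k < N) _ in h3 h4; set pL := \sum_(k < L) circle_coef _ _ _ _ * _ in h1 h4.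
set s := \sum_(k < L) _ in h1 *.
(* Three errors: coefficients against their limits, at most e/4; the geometric tail from L to N; the
   interpolation error, at most e/2. *)
have -> : f z - s = (pL - s) + (p - pL) - (p - f z) by ring.
apply: le_trans (cabsB _ _) _; have := cabsD (pL - s) (p - pL); lra.
Unshelve. all: by end_near. Qed.

End PowerSeriesExpansion.

(** * Power series: convergence, differentiation, uniqueness of coefficients *)

Section PowerSeries.
Context {R : realType}.
Local Notation C := (Cplx R).
Implicit Types (f : C -> C) (z w : C) (a : nat -> C) (r : R).

(** For r > 0 this says that the radius of convergence is at least r. A bound is required at each
    smaller s, with its own constant, so that the property survives multiplication by k. *)
Definition coef_growth r a := forall s : R, 0 < s < r ->
  exists M : R, forall k, cabs (a k) * s ^+ k <= M.

Definition psum_on r a f := coef_growth r a /\ forall z, cabs z < r ->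
  forall e : R, 0 < e -> \forall L \near \oo, cabs (f z - \sum_(k < L) a k * z ^+ k) < e.

(** Read the left side as k copies of q^k and compare them with q^j for j < k in the geometric
    series. *)
Lemma natmul_pow_le (q : R) k : 0 <= q < 1 -> k%:R * q ^+ k <= (1 - q)^-1.
Proof.
move=> q01; have := geometric_sum_le 0 k q01; rewrite expr0 div1r; apply: le_trans.
case/andP: q01 => q0 /ltW q1; rewrite big_mkord.
have -> : k%:R * q ^+ k = \sum_(j < k) q ^+ k.
  by rewrite sumr_const card_ord -[RHS]mulr_natl.
by apply: ler_sum => j _; rewrite ler_wiXn2l// ltnW.
Qed.

Lemma coef_growthMn r a : coef_growth r a -> coef_growth r (fun k => k%:R * a k).
Proof.
move=> Ha s /andP[s0 sr].
pose t := (s + r) / 2.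
have [M HM] : exists M : R, forall k, cabs (a k) * t ^+ k <= M.
  by apply: Ha; rewrite /t; lra.
have t0 : 0 < t by rewrite /t; lra.
have q01 : 0 <= s / t < 1.
  by rewrite divr_ge0 ?(ltW s0) ?(ltW t0)//= ltr_pdivrMr// mul1r /t; lra.
exists (M * (1 - s / t)^-1) => k; rewrite cabsM cabs_nat.
have -> : k%:R * cabs (a k) * s ^+ k = (cabs (a k) * t ^+ k) * (k%:R * (s / t) ^+ k).
  have T0 : t ^+ k != 0 by rewrite expf_neq0// gt_eqF.
  by rewrite (expr_div_n s t); move: (t ^+ k) (s ^+ k) (k%:R : R) T0 => T S n T0; field.
apply: ler_pM => //; last exact: natmul_pow_le.
- by rewrite mulr_ge0 ?cabs_ge0 ?exprn_ge0 ?(ltW t0).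
- by rewrite mulr_ge0 ?exprn_ge0//; case/andP: q01.
Qed.

Lemma coef_growthS r a : coef_growth r a -> coef_growth r (fun k => a k.+1).
Proof.
move=> Ha s s0r; have [M HM] := Ha s s0r; exists (M / s) => k.
by have /andP[s0 _] := s0r; rewrite ler_pdivlMr// -mulrA -exprSr.
Qed.

Lemma coef_growth_deriv r a : coef_growth r a -> coef_growth r (fun k => k.+1%:R * a k.+1).
Proof. by move=> Ha; apply: (coef_growthS (a := fun k => k%:R * a k)); exact: coef_growthMn. Qed.

Lemma partial_sum_dist a (s M : R) z L N : 0 < s -> (forall k, cabs (a k) * s ^+ k <= M) ->
  cabs z < s -> (L <= N)%N ->
  cabs (\sum_(k < N) a k * z ^+ k - \sum_(k < L) a k * z ^+ k) <=
    M * ((cabs z / s) ^+ L / (1 - cabs z / s)).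
Proof.
move=> s0 HM zs LN.
have q01 : 0 <= cabs z / s < 1.
  by rewrite divr_ge0 ?cabs_ge0 ?(ltW s0)//= ltr_pdivrMr ?mul1r.
have M0 : 0 <= M by apply: le_trans (HM 0%N); rewrite expr0 mulr1 cabs_ge0.
have -> : \sum_(k < N) a k * z ^+ k - \sum_(k < L) a k * z ^+ k = \sum_(L <= k < N) a k * z ^+ k.
  by rewrite -!(big_mkord xpredT (fun k => a k * z ^+ k))
    (big_cat_nat (leq0n L) LN)/= addrAC subrr add0r.
apply: le_trans (cabs_sum _ _ _) _.
apply: le_trans (ler_wpM2l M0 (geometric_sum_le L N q01)); rewrite mulr_sumr.
apply: ler_sum => k _; rewrite cabsM cabsX expr_div_n [X in M * X]mulrC mulrA.
by rewrite ler_wpM2r ?exprn_ge0 ?cabs_ge0// ler_pdivlMr ?exprn_gt0.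
Qed.

Lemma geometric_tail_cvg0 (q M e : R) : 0 <= q < 1 -> 0 < e ->
  \forall L \near \oo, M * (q ^+ L / (1 - q)) < e.
Proof.
move=> /andP[q0 q1] e0.
have : M * (q ^+ L / (1 - q)) @[L --> \oo] --> (0 : R).
  rewrite -(mulr0 M); apply: cvgMr; rewrite -(mul0r (1 - q)^-1); apply: cvgMl.
  by apply: cvg_expr; rewrite ger0_norm.
move/cvgrPdist_lt => /(_ e e0); apply: filterS => L.
by rewrite sub0r normrN; apply: le_lt_trans; exact: ler_norm.
Qed.

Lemma psum_error r a f (s M : R) z L : psum_on r a f -> 0 < s -> s <= r ->
  (forall k, cabs (a k) * s ^+ k <= M) -> cabs z < s ->
  cabs (f z - \sum_(k < L) a k * z ^+ k) <= M * ((cabs z / s) ^+ L / (1 - cabs z / s)).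
Proof.
move=> [_ af] s0 sr HM zs; apply/ler_addgt0Pl => e e0.
have H := af z (lt_le_trans zs sr) e e0.
near \oo => N.
have -> : f z - \sum_(k < L) a k * z ^+ k = (f z - \sum_(k < N) a k * z ^+ k) +
   (\sum_(k < N) a k * z ^+ k - \sum_(k < L) a k * z ^+ k) by ring.
apply: le_trans (cabsD _ _) _; apply: lerD; first by apply/ltW; near: N.
by apply: partial_sum_dist => //; near: N; exists L.
Unshelve. all: by end_near. Qed.

(** The bounded partial sums have a limit along an ultrafilter, and the geometric tail bound
    upgrades it to an ordinary limit. *)
Lemma psum_exists r a z : coef_growth r a -> cabs z < r ->
  exists w, forall e : R, 0 < e -> \forall L \near \oo, cabs (w - \sum_(k < L) a k * z ^+ k) < e.
Proof.
move=> Ha zr; pose s := (cabs z + r) / 2.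
have s0 : 0 < s by have := cabs_ge0 z; rewrite /s; lra.
have zs : cabs z < s by rewrite /s; lra.
have [M HM] := Ha s (ltac:(apply/andP; split => //; rewrite /s; lra)).
have q01 : 0 <= cabs z / s < 1.
  by rewrite divr_ge0 ?cabs_ge0 ?(ltW s0)//= ltr_pdivrMr ?mul1r.
have [U [UU oU]] := @ultraFilterLemma nat \oo _.
have [w Hw] : exists w : C, forall e : R, 0 < e ->
    \forall n \near U, cabs (\sum_(k < n) a k * z ^+ k - w) < e.
  apply: (@ultra_bounded _ _ _ (M * ((cabs z / s) ^+ 0 / (1 - cabs z / s)))) => //.
  near=> n; have := partial_sum_dist s0 HM zs (leq0n n).
  by rewrite big_ord0 subr0.
exists w => e e0; have e2 : 0 < e / 2 by rewrite divr_gt0.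
have Ht := geometric_tail_cvg0 M q01 e2.
near=> L.
have h1 : M * ((cabs z / s) ^+ L / (1 - cabs z / s)) < e / 2 by near: L.
have [N [h2 h3]] : exists N, cabs (\sum_(k < N) a k * z ^+ k - w) < e / 2 /\ (L <= N)%N.
  by near U => N; exists N; split; near: N; [exact: Hw|apply: oU; exists L].
have := partial_sum_dist s0 HM zs h3.
set p := \sum_(k < N) _ in h2 *; set l := \sum_(k < L) _.
have -> : w - l = (p - l) - (p - w) by ring.
move=> h4; apply: le_lt_trans (cabsB _ _) _; lra.
Unshelve. all: by end_near. Qed.

(** Second-order remainder of a power, by induction on k. The factor s^2 stands on the left so that
    no exponent k - 2 appears. *)
Lemma expr_taylor2 z w (s : R) k : 0 <= s -> cabs z <= s -> cabs w <= s ->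
  s ^+ 2 * cabs (w ^+ k - z ^+ k - k%:R * z ^+ k.-1 * (w - z)) <=
    k%:R ^+ 2 * s ^+ k * cabs (w - z) ^+ 2.
Proof.
move=> s0 zs ws; elim: k => [|k IH].
  by rewrite !expr0 subrr !mul0r subr0 cabs0 mulr0 expr0n /= !mul0r.
set E := w ^+ k - z ^+ k - k%:R * z ^+ k.-1 * (w - z) in IH.
have -> : w ^+ k.+1 - z ^+ k.+1 - k.+1%:R * z ^+ k.+1.-1 * (w - z) =
    w * E + k%:R * z ^+ k.-1 * (w - z) ^+ 2.
  rewrite /E; case: k {IH E} => [|k] /=; first by rewrite !expr0; ring.
  by rewrite !exprS -(natr1 k.+1); ring.
apply: (@le_trans _ _ (s ^+ 2 * (s * cabs E + k%:R * s ^+ k.-1 * cabs (w - z) ^+ 2))).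
  rewrite ler_wpM2l ?exprn_ge0//; apply: le_trans (cabsD _ _) _.
  rewrite !cabsM !cabsX cabs_nat -expr2; apply: lerD; first by rewrite ler_wpM2r ?cabs_ge0.
  rewrite ler_wpM2r ?exprn_ge0 ?cabs_ge0// ler_wpM2l ?ler0n//.
  by rewrite lerXn2r ?nnegrE ?cabs_ge0.
have d0 : 0 <= cabs (w - z) ^+ 2 by rewrite exprn_ge0 ?cabs_ge0.
rewrite mulrDr mulrCA.
apply: (@le_trans _ _ (s * (k%:R ^+ 2 * s ^+ k * cabs (w - z) ^+ 2) +
   k%:R * s ^+ k.+1 * cabs (w - z) ^+ 2)).
  apply: lerD; first by rewrite ler_wpM2l.
  case: k {IH E} => [|k]; first by rewrite !mul0r mulr0.
  rewrite /= (_ : s ^+ k.+2 = s ^+ 2 * s ^+ k); last by rewrite -exprD add2n.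
  by move: (s ^+ k) (k.+1%:R : R) => S n; rewrite le_eqVlt; apply/orP; left; apply/eqP; ring.
have -> : s * (k%:R ^+ 2 * s ^+ k * cabs (w - z) ^+ 2) +
    k%:R * s ^+ k.+1 * cabs (w - z) ^+ 2 = (k%:R ^+ 2 + k%:R) * (s ^+ k.+1 * cabs (w - z) ^+ 2).
  by rewrite (exprS s k); move: (s ^+ k) => S; ring.
rewrite -mulrA; apply: ler_wpM2r; first by rewrite mulr_ge0// exprn_ge0.
have -> : k.+1%:R = k%:R + 1 :> R by rewrite -natr1.
have : 0 <= k%:R :> R by [].
nra.
Qed.

(** The remainders of the single powers sum to a quadratic bound B |w - z|^2 on a disc of radius s <
    r, which is stronger than differentiability. *)
Lemma psum_has_cderiv r a f z l : psum_on r a f -> cabs z < r ->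
  (forall e : R, 0 < e -> \forall L \near \oo,
     cabs (l - \sum_(k < L) k.+1%:R * a k.+1 * z ^+ k) < e) ->
  has_cderiv f z l.
Proof.
move=> [Ha af] zr Hl.
pose s := (cabs z + r) / 2; pose t := (s + r) / 2.
have s0 : 0 < s by have := cabs_ge0 z; rewrite /s; lra.
have zs : cabs z < s by rewrite /s; lra.
have st : s < t by rewrite /t /s; lra.
have t0 : 0 < t by apply: lt_trans st.
(* Applied twice to absorb the factor k^2 of [expr_taylor2]. *)
have [M HM] := coef_growthMn (coef_growthMn Ha) (s := t) (ltac:(rewrite t0/= /t /s; lra)).
pose q := s / t.
have q01 : 0 <= q < 1.
  by rewrite divr_ge0 ?(ltW s0) ?(ltW t0)//= ltr_pdivrMr ?mul1r.
pose B := M * (1 / (1 - q)) / s ^+ 2.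
have M0 : 0 <= M by apply: le_trans (HM 0%N); rewrite expr0 mulr1 cabs_ge0.
have B0 : 0 <= B.
  by rewrite /B !mulr_ge0// ?invr_ge0 ?exprn_ge0 ?(ltW s0) ?subr_ge0//; case/andP: q01 => _ /ltW.
have key w : cabs w <= s -> cabs (f w - f z - l * (w - z)) <= B * cabs (w - z) ^+ 2.
  move=> ws; apply/ler_addgt0Pl => e e0.
  have e3 : 0 < e / 3 by rewrite divr_gt0.
  have e4 : 0 < e / 3 / (1 + cabs (w - z)).
    by rewrite divr_gt0// ltr_pwDl ?cabs_ge0.
  have [N1 _ H1] := af w (ltac:(rewrite /s in ws; lra)) _ e3.
  have [N2 _ H2] := af z zr _ e3.
  have [N3 _ H3] := Hl _ e4.
  (* The series of f is cut after L + 1 terms and that of its derivative after L, since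
     differentiation shifts the index by one. *)
  pose L := (N1 + N2 + N3)%N.
  have h1 : cabs (f w - \sum_(k < L.+1) a k * w ^+ k) < e / 3.
    by apply: H1; rewrite /= /L -addnA leqW// leq_addr.
  have h2 : cabs (f z - \sum_(k < L.+1) a k * z ^+ k) < e / 3.
    by apply: H2; rewrite /= /L leqW// addnAC leq_addl.
  have h3 : cabs (l - \sum_(k < L) k.+1%:R * a k.+1 * z ^+ k) < e / 3 / (1 + cabs (w - z)).
    by apply: H3; rewrite /= /L leq_addl.
  set Sw := \sum_(k < L.+1) _ in h1; set Sz := \sum_(k < L.+1) _ in h2.
  set Sl := \sum_(k < L) _ in h3.
  have h4 : cabs ((l - Sl) * (w - z)) <= e / 3.
    rewrite cabsM; move: h3; rewrite ltr_pdivlMr ?ltr_pwDl ?cabs_ge0// => /ltW.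
    by apply: le_trans; rewrite ler_wpM2l ?cabs_ge0// lerDr.
  have h5 : cabs (Sw - Sz - Sl * (w - z)) <= B * cabs (w - z) ^+ 2.
    have -> : Sw - Sz - Sl * (w - z) =
        \sum_(k < L.+1) a k * (w ^+ k - z ^+ k - k%:R * z ^+ k.-1 * (w - z)).
      have -> : Sl = \sum_(k < L.+1) a k * (k%:R * z ^+ k.-1).
        rewrite big_ord_recl mul0r mulr0 add0r; apply: eq_bigr => k _ /=.
        by rewrite /bump /= add1n /=; ring.
      rewrite mulr_suml -!sumrB; apply: eq_bigr => k _; ring.
    apply: le_trans (cabs_sum _ _ _) _.
    apply: (@le_trans _ _ (\sum_(k < L.+1) M / s ^+ 2 * cabs (w - z) ^+ 2 * q ^+ k)).
      apply: ler_sum => k _; rewrite cabsM.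
      have E2 := expr_taylor2 k (ltW s0) (ltW zs) ws.
      have s2 : 0 < s ^+ 2 by rewrite exprn_gt0.
      rewrite -(ler_pM2l s2) mulrCA.
      apply: le_trans (ler_wpM2l (cabs_ge0 _) E2) _.
      have := HM k; rewrite !cabsM cabs_nat.
      have T0 : 0 < t ^+ k by rewrite exprn_gt0.
      rewrite -ler_pdivlMr// => hk.
      have d0 : 0 <= s ^+ k * cabs (w - z) ^+ 2 by rewrite mulr_ge0 ?exprn_ge0 ?cabs_ge0 ?(ltW s0).
      have := ler_wpM2r d0 hk; rewrite /q (expr_div_n s t) => hk2.
      have -> : cabs (a k) * (k%:R ^+ 2 * s ^+ k * cabs (w - z) ^+ 2) =
        k%:R * (k%:R * cabs (a k)) * (s ^+ k * cabs (w - z) ^+ 2) by ring.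
      apply: le_trans hk2 _; rewrite le_eqVlt; apply/orP; left; apply/eqP.
      move: (t ^+ k) (s ^+ k) T0 => T S T0; field; by rewrite !gt_eqF.
    have := geometric_sum_le 0 L.+1 q01; rewrite expr0 big_mkord -mulr_sumr => hg.
    have c0 : 0 <= M / s ^+ 2 * cabs (w - z) ^+ 2.
      by rewrite !mulr_ge0 ?invr_ge0 ?exprn_ge0 ?cabs_ge0 ?(ltW s0).
    apply: le_trans (ler_wpM2l c0 hg) _.
    rewrite /B le_eqVlt; apply/orP; left; apply/eqP; ring.
  have -> : f w - f z - l * (w - z) = (Sw - Sz - Sl * (w - z)) + (f w - Sw)
      - (f z - Sz) - (l - Sl) * (w - z) by ring.
  apply: le_trans (cabsB _ _) _.
  have := cabsB (Sw - Sz - Sl * (w - z) + (f w - Sw)) (f z - Sz).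
  have := cabsD (Sw - Sz - Sl * (w - z)) (f w - Sw).
  lra.
move=> e e0; have B1 : 0 < B + 1 by rewrite ltr_pwDr.
exists (Num.min (s - cabs z) (e / (B + 1))).
  by rewrite lt_min subr_gt0 zs divr_gt0.
move=> w; rewrite lt_min => /andP[w1 w2].
have ws : cabs w <= s.
  have -> : w = (w - z) + z by ring.
  by apply: le_trans (cabsD _ _) _; lra.
apply: le_trans (key w ws) _; rewrite expr2 mulrA ler_wpM2r ?cabs_ge0//.
move: w2; rewrite ltr_pdivlMr// => /ltW; apply: le_trans.
by rewrite mulrC ler_wpM2l ?cabs_ge0// lerDl.
Qed.

Lemma psum_derive1 r a f : psum_on r a f ->
  psum_on r (fun k => k.+1%:R * a k.+1) (derive1 f).
Proof.
move=> af; have Ha := coef_growth_deriv af.1; split=> // z zr.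
have [l Hl] := psum_exists Ha zr.
by rewrite (has_cderiv_derive1 (psum_has_cderiv af zr Hl)).
Qed.

Lemma psum_derivable r a f z : psum_on r a f -> cabs z < r -> derivable f z 1.
Proof.
move=> af zr; have [l Hl] := psum_exists (coef_growth_deriv af.1) zr.
by have := has_cderiv_is_derive (psum_has_cderiv af zr Hl); case.
Qed.

Lemma psum_derive1n r a f n : psum_on r a f ->
  psum_on r (fun k => ((k + n)`!%:R / k`!%:R) * a (k + n)%N) (cderiv n f).
Proof.
move=> af; elim: n => [|n IH].
  have -> : (fun k => (k + 0)`!%:R / k`!%:R * a (k + 0)%N) = a => //.
  by apply/funext => k; rewrite addn0 divff ?mul1r// pnatr_eq0 -lt0n fact_gt0.
have := psum_derive1 IH; rewrite /cderiv derive1nS.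
congr psum_on; apply/funext => k.
rewrite addSnnS mulrA; congr (_ * _).
by rewrite [k.+1`!]factS natrM invfM mulrCA mulVKf// pnatr_eq0.
Qed.

Lemma psum_at0 r a f : 0 < r -> psum_on r a f -> f 0 = a 0%N.
Proof.
move=> r0 [_ af]; apply/eqP; rewrite -subr_eq0 -cabs_eq0 eq_le cabs_ge0 andbT.
apply/ler_addgt0Pl => e e0; rewrite addr0.
have [|N _ HN] := af 0 _ e e0; first by rewrite cabs0.
have /= := HN N.+1 (leqnSn N); rewrite big_ord_recl expr0 mulr1 big1 ?addr0; first exact: ltW.
by move=> k _; rewrite expr0n mulr0.
Qed.

Lemma psum_taylor_coef r a f k : 0 < r -> psum_on r a f -> taylor_coef f k = a k.
Proof.
move=> r0 af; rewrite /taylor_coef (psum_at0 r0 (psum_derive1n k af)).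
by rewrite fact0 divr1 add0n mulrAC divff ?mul1r// pnatr_eq0 -lt0n fact_gt0.
Qed.

(** The expansion on the disc of radius s comes with coefficients that might depend on s;
    [psum_taylor_coef] identifies them with derivatives at 0, so one series serves all s < 1. *)
Theorem holo_disc_psum f : holo_disc f -> psum_on 1 (taylor_coef f) f.
Proof.
move=> Hf.
have df z : cabs z < 1 -> exists l, has_cderiv f z l.
  move=> z1; exists (derive1 f z); apply: derivable_has_cderiv.
  by apply: Hf; rewrite inE.
have H s : 0 < s < 1 -> psum_on s (taylor_coef f) f /\
    exists M : R, forall k, cabs (taylor_coef f k) * s ^+ k <= M.
  move=> s01; have [a [M [HM Ha]]] := holo_power_series_radius s01 df.
  have /andP[s0 s1] := s01.
  suff af : psum_on s a f.
    have E : taylor_coef f = a by apply/funext => k; exact: psum_taylor_coef af.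
    by rewrite E; split=> //; exists M.
  split=> [t /andP[t0 ts]|z zs e e0].
    exists M => k; apply: le_trans (HM k); rewrite ler_wpM2l ?cabs_ge0//.
    by rewrite lerXn2r ?nnegrE ?(ltW t0) ?(ltW s0) ?(ltW ts).
  have q01 : 0 <= cabs z / s < 1.
    by rewrite divr_ge0 ?cabs_ge0 ?(ltW s0)//= ltr_pdivrMr ?mul1r.
  apply: filterS (geometric_tail_cvg0 M q01 e0) => L.
  by apply: le_lt_trans; exact: Ha.
split=> [s /H[]//|z z1].
have z0 := cabs_ge0 z.
have [[_ +] _] := H ((cabs z + 1) / 2) (ltac:(lra)).
by apply; lra.
Qed.

Lemma psum_holo_disc a f : psum_on 1 a f -> holo_disc f.
Proof. by move=> af z; rewrite inE => z1; exact: psum_derivable af z1. Qed.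

End PowerSeries.

(** * Integration over the disc and Parseval's identity *)

Section PlaneMeasure.
Context {R : realType}.
Local Notation mu := (@lebesgue_measure R).
Local Notation mu2 := (@lebesgue_measure R \x @lebesgue_measure R)%E.
Local Notation RM := (measurableTypeR R).

Lemma preimage_translate_itv (a b c : R) :
  (fun x : R => x + c) @^-1` `]a, b] = `](a - c), (b - c)]%classic.
Proof. by apply/seteqP; split => x /=; rewrite !in_itv/= => /andP[? ?]; lra. Qed.

Local Open Scope ereal_scope.

Lemma measurable_translate (c : R) : measurable_fun [set: RM] ((fun x : R => x + c)%R : RM -> RM).
Proof. by apply: measurable_funD; [exact: measurable_id|exact: measurable_cst]. Qed.

(** The pushforward of Lebesgue measure by a translation agrees with it on half-open intervals,
    hence on all measurable sets. *)
Lemma integral_translate (c : R) (f : RM -> \bar R) : measurable_fun setT f ->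
  (forall x, 0 <= f x) -> \int[mu]_x f (x + c)%R = \int[mu]_x f x.
Proof.
move=> mf f0; have mt := measurable_translate c.
have := ge0_integral_pushforward mt mu measurableT mf (fun x _ => f0 x).
rewrite preimage_setT => <-; apply: eq_measure_integral => A mA _.
apply/esym.
apply: (@lebesgue_measure_unique R
  (measure_function_pushforward__canonical__measure_function_Measure mu mt)) => //.
move=> X [[a b] _ <-] /=; rewrite /pushforward.
rewrite preimage_translate_itv !lebesgue_measure_itv /= !lte_fin ltrD2r.
by case: ifP => // ab; rewrite -!EFinB; congr EFin; ring.
Qed.

Definition linear2 (a b c d : R) (p : R * R) : R * R :=
  ((a * p.1 + b * p.2)%R, (c * p.1 + d * p.2)%R).

Lemma linear2_comp a b c d a' b' c' d' p :
  linear2 a b c d (linear2 a' b' c' d' p) =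
  linear2 (a * a' + b * c') (a * b' + b * d') (c * a' + d * c') (c * b' + d * d') p.
Proof. by rewrite /linear2 /=; congr pair; ring. Qed.

Lemma measurable_linear2 a b c d :
  measurable_fun [set: RM * RM] (linear2 a b c d : RM * RM -> RM * RM).
Proof.
by apply: measurable_fun_pair; apply: measurable_funD; apply: measurable_funM => //.
Qed.

(** On each horizontal line the shear is a translation, so Fubini-Tonelli reduces the claim to
    [integral_translate]. *)
Lemma integral_shear1 (a : R) (G : RM * RM -> \bar R) : measurable_fun setT G ->
  (forall p, 0 <= G p) -> \int[mu2]_p G (linear2 1 a 0 1 p) = \int[mu2]_p G p.
Proof.
move=> mG G0; have mL := measurableT_comp mG (measurable_linear2 1 a 0 1).
rewrite (fubini_tonelli2 G)// (fubini_tonelli2 _ mL); last by move=> p; exact: G0.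
apply: eq_integral => y _; rewrite /fubini_G /=.
have my : measurable_fun setT (fun x => G (x, y)) by exact: measurable_fun_pair1.
rewrite -(integral_translate (a * y) my)//; apply: eq_integral => x _.
by rewrite /linear2 /= !mul1r mul0r add0r.
Qed.

Lemma integral_shear2 (a : R) (G : RM * RM -> \bar R) : measurable_fun setT G ->
  (forall p, 0 <= G p) -> \int[mu2]_p G (linear2 1 0 a 1 p) = \int[mu2]_p G p.
Proof.
move=> mG G0; have mL := measurableT_comp mG (measurable_linear2 1 0 a 1).
rewrite (fubini_tonelli1 G)// (fubini_tonelli1 _ mL); last by move=> p; exact: G0.
apply: eq_integral => x _; rewrite /fubini_F /=.
have mx : measurable_fun setT (fun y => G (x, y)) by exact: measurable_fun_pair2.
rewrite -(integral_translate (a * x) mx)//; apply: eq_integral => y _.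
by rewrite /linear2 /= !mul1r mul0r addr0 addrC.
Qed.

(* A rotation that is not a half turn is a product of three shears. *)
Lemma integral_rotate (c s : R) (G : RM * RM -> \bar R) : (c ^+ 2 + s ^+ 2 = 1)%R ->
  measurable_fun setT G -> (forall p, 0 <= G p) ->
  \int[mu2]_p G (linear2 c (- s) s c p) = \int[mu2]_p G p.
Proof.
have main c' s' (H : RM * RM -> \bar R) : (c' ^+ 2 + s' ^+ 2 = 1)%R -> s' != 0%R ->
    measurable_fun setT H -> (forall p, 0 <= H p) ->
    \int[mu2]_p H (linear2 c' (- s') s' c' p) = \int[mu2]_p H p.
  move=> cs s0 mH H0; set t := ((c' - 1) / s')%R.
  have m1 := measurableT_comp mH (measurable_linear2 1 t 0 1).
  have m2 := measurableT_comp m1 (measurable_linear2 1 0 s' 1).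
  rewrite -(integral_shear1 t mH H0).
  rewrite -(integral_shear2 s' m1)//=.
  rewrite -(integral_shear1 t m2)//=.
  apply: eq_integral => p _; congr H; rewrite !linear2_comp /t.
  have E : (s' ^+ 2 = 1 - c' ^+ 2)%R by rewrite -cs addrAC subrr add0r.
  congr linear2; try by field.
  by rewrite -[LHS](mulfK s0) mulNr -expr2 E; field.
move=> cs mG G0; have [s0|] := eqVneq s 0%R; last by move=> s0; exact: main.
have : ((c == 1) || (c == -1))%R.
  by rewrite -eqf_sqr expr1n -cs s0 expr0n addr0.
have m1 := measurableT_comp mG (measurable_linear2 0 (- 1) 1 0).
case/orP => /eqP ->.
  by apply: eq_integral => -[x y] _; rewrite /linear2 s0 /= oppr0 !mul1r !mul0r addr0 add0r.
(* The half turn is the square of the quarter turn, which [main] covers. *)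
rewrite -(@main 0 1 G)%R ?oner_eq0 ?expr0n ?expr1n ?add0r//.
rewrite -(@main 0 1 _ _ _ m1)%R ?oner_eq0 ?expr0n ?expr1n ?add0r//; last by move=> p; exact: G0.
apply: eq_integral => p _ /=; congr G; rewrite linear2_comp s0.
by congr linear2; ring.
Qed.

End PlaneMeasure.

(** * One-dimensional integrals over chords of the disc *)

Section ChordIntegrals.
Context {R : realType}.
Local Notation mu := (@lebesgue_measure R).

Lemma derivable_LRcontinuous (F : R -> R) (a b : R) :
  (forall x, derivable F x 1) -> derivable_oo_LRcontinuous F a b.
Proof.
move=> dF; have cF x : F y @[y --> x] --> F x.
  by apply: differentiable_continuous; apply/derivable1_diffP.
split; first by move=> x _.
- by apply: cvg_at_right_filter; exact: cF.
- by apply: cvg_at_left_filter; exact: cF.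
Qed.

Lemma continuous_FTC2_derivable (F f : R -> R) (a b : R) : a < b -> continuous f ->
  (forall x, is_derive x (1 : R) F (f x)) ->
  (\int[mu]_(x in `[a, b]) (f x)%:E = (F b - F a)%:E)%E.
Proof.
move=> ab cf dF; rewrite (continuous_FTC2 ab (F := F))//.
- exact: continuous_subspaceT.
- by apply: derivable_LRcontinuous => x; case: (dF x).
- by move=> x _; rewrite derive1E derive_val.
Qed.

Lemma continuous_horner (p : {poly R}) : continuous (horner p).
Proof.
move=> x; apply: differentiable_continuous; apply/derivable1_diffP.
by have [] := is_derive_poly p x.
Qed.

Lemma integrable_horner (p : {poly R}) (a b : R) :
  mu.-integrable `[a, b] (EFin \o (fun x => p.[x])).
Proof.
apply: continuous_compact_integrable; first exact: segment_compact.
by apply: continuous_subspaceT; exact: continuous_horner.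
Qed.

(** The polynomial x (r^2 - x^2)^(n+1) vanishes at both ends, and its derivative is the difference
    of the two integrands. *)
Lemma chord_by_parts (r : R) n : 0 < r ->
  (\int[mu]_(x in `[(- r)%R, r]) ((r ^+ 2 - x ^+ 2) ^+ n.+1)%:E =
  \int[mu]_(x in `[(- r)%R, r]) (2 * n.+1%:R * (x ^+ 2 * (r ^+ 2 - x ^+ 2) ^+ n))%:E)%E.
Proof.
move=> r0.
pose p : {poly R} := (r ^+ 2)%:P - 'X ^+ 2.
have pE x : p.[x] = r ^+ 2 - x ^+ 2 by rewrite /p !hornerE.
pose P1 := p ^+ n.+1; pose P2 : {poly R} := (2 * n.+1%:R) *: ('X ^+ 2 * p ^+ n).
have P1E x : P1.[x] = (r ^+ 2 - x ^+ 2) ^+ n.+1 by rewrite /P1 horner_exp pE.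
have P2E x : P2.[x] = 2 * n.+1%:R * (x ^+ 2 * (r ^+ 2 - x ^+ 2) ^+ n).
  by rewrite /P2 /p !(hornerE, horner_exp).
pose F := 'X * P1.
have F' : deriv F = P1 - P2.
  rewrite /F derivM derivX mul1r /P1 /P2 deriv_exp /p derivB derivC deriv_exp derivX.
  rewrite sub0r /= expr1 mul1r -/p -scaler_nat -mul_polyC.
  congr (_ + _); rewrite -[in RHS]mul_polyC polyCM.
  have -> : (2 : R)%:P = 2 :> {poly R} by rewrite rmorph_nat.
  by move: (_%:P) (p ^+ n) => c q; ring.
have := @continuous_FTC2_derivable (horner F) (horner (P1 - P2)) (- r) r
  (ltac:(lra)) (@continuous_horner _).
have -> : F.[r] = 0 by rewrite /F hornerM P1E subrr expr0n mulr0.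
have -> : F.[- r] = 0 by rewrite /F hornerM P1E sqrrN subrr expr0n mulr0.
rewrite subrr => /(_ _) H.
have /H {}H : forall x, is_derive x (1 : R) (horner F) (P1 - P2).[x].
  by move=> x; rewrite -F'; exact: is_derive_poly.
have i1 := integrable_horner P1 (- r) r; have i2 := integrable_horner P2 (- r) r.
have -> : (\int[mu]_(x in `[(- r)%R, r]) ((r ^+ 2 - x ^+ 2) ^+ n.+1)%:E =
    \int[mu]_(x in `[(- r)%R, r]) (P1.[x])%:E)%E.
  by apply: eq_integral => x _; rewrite P1E.
have -> : (\int[mu]_(x in `[(- r)%R, r]) (2 * n.+1%:R * (x ^+ 2 * (r ^+ 2 - x ^+ 2) ^+ n))%:E =
    \int[mu]_(x in `[(- r)%R, r]) (P2.[x])%:E)%E.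
  by apply: eq_integral => x _; rewrite P2E.
apply/eqP; rewrite -[X in _ == X]add0e -sube_eq//; last exact: integrable_fin_num.
rewrite -integralB//; apply/eqP; rewrite -[RHS]H; apply: eq_integral => x _ /=.
by rewrite hornerD hornerN.
Qed.

(** For y^2 >= 1 the square root has the value 0 and both sides are empty, so no case distinction is
    left to the iterated integrals. *)
Lemma disc_chord (y : R) : [set x : R | x ^+ 2 + y ^+ 2 < 1] =
  `](- Num.sqrt (1 - y ^+ 2)), (Num.sqrt (1 - y ^+ 2))[%classic.
Proof.
have [y1|y1] := ltP (y ^+ 2) 1.
  apply/seteqP; split => x /=; rewrite in_itv/= -ltr_norml.
    by rewrite -sqrtr_sqr ltr_sqrt ?subr_gt0//; lra.
  by rewrite -sqrtr_sqr ltr_sqrt ?subr_gt0//; lra.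
rewrite ler0_sqrtr ?subr_le0// oppr0; apply/seteqP; split => x /=; rewrite in_itv/=.
  by have := sqr_ge0 x; lra.
by move=> /andP[? ?]; lra.
Qed.

(** The substitution x = sin t gives the integrand 2 cos^2 t, with primitive t + sin t cos t. *)
Lemma area_chord :
  (\int[mu]_(x in `[(- 1)%R, 1%R]) (2 * Num.sqrt (1 - x ^+ 2))%:E = (pi : R)%:E)%E.
Proof.
have pi0 : 0 < pi :> R := pi_gt0 R.
have s1 : sin (pi / 2) = 1 :> R by rewrite sin_pihalf.
have sN1 : sin (- (pi / 2)) = -1 :> R by rewrite sinN s1.
have F'E : derive1 (@sin R) = cos.
  by apply/funext => t; rewrite derive1E; apply: derive_val.
have -> : `[- 1, 1]%classic = `[sin (- (pi / 2)), sin (pi / 2)]%classic :> set R.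
  by rewrite s1 sN1.
have cs x : 1 - sin x ^+ 2 = cos x ^+ 2 :> R by rewrite -(cos2Dsin2 x) addrK.
rewrite (@integration_by_substitution_increasing R sin (fun x => 2 * Num.sqrt (1 - x ^+ 2))).
- rewrite F'E.
  transitivity (\int[mu]_(x in `[(- (pi / 2))%R, (pi / 2)%R]) (2 * cos x ^+ 2)%:E)%E.
    apply: eq_integral => x; rewrite inE /= in_itv/= => xpi.
    rewrite [LHS](_ : _ = (2 * Num.sqrt (1 - sin x ^+ 2) * cos x)%:E)//.
    by rewrite cs sqrtr_sqr ger0_norm ?cos_ge0_pihalf//; congr EFin; ring.
  apply: etrans; first apply: (@continuous_FTC2_derivable (fun x => x + sin x * cos x) (fun x => 2 * cos x ^+ 2)).
  + lra.
  + move=> x; apply: cvgMr; apply: cvgM; exact: continuous_cos.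
  + move=> x; apply: is_derive_eq.
    by have := cos2Dsin2 x; rewrite /GRing.scale/=; lra.
  + rewrite /= s1 sN1 cosN cos_pihalf !mulr0 !addr0 opprK; congr EFin; lra.
- lra.
- by move=> x y xI yI xy; rewrite ltr_sin.
- by rewrite F'E => x _; exact: continuous_cos.
- by rewrite F'E; apply/cvg_ex; exists (cos (- (pi / 2))); apply: cvg_at_right_filter; exact: continuous_cos.
- by rewrite F'E; apply/cvg_ex; exists (cos (pi / 2)); apply: cvg_at_left_filter; exact: continuous_cos.
- by apply: derivable_LRcontinuous => x; exact: derivable_sin.
- apply: continuous_subspaceT => x; apply: cvgMr.
  apply: (cvg_comp _ Num.sqrt); last exact: sqrt_continuous.
  by apply: cvgB; [exact: cvg_cst|exact: exprn_continuous].
Qed.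

End ChordIntegrals.

(** * Moments of radial functions on the disc *)

Section DiscIntegral.
Context {R : realType}.
Local Notation mu := (@lebesgue_measure R).
Local Notation mu2 := (@lebesgue_measure R \x @lebesgue_measure R)%E.
Local Notation RM := (measurableTypeR R).

Definition plane_disc : set (R * R) := [set p | p.1 ^+ 2 + p.2 ^+ 2 < 1].

Definition sqnorm (p : R * R) : R := p.1 ^+ 2 + p.2 ^+ 2.

Lemma measurable_sqnorm : measurable_fun [set: RM * RM] (sqnorm : RM * RM -> RM).
Proof.
by apply: measurable_funD; apply: measurable_funX => //.
Qed.

Lemma measurable_plane_disc : measurable (plane_disc : set (RM * RM)).
Proof.
have -> : (plane_disc : set (RM * RM)) = [set: RM * RM] `&` (sqnorm @^-1` `]-oo, 1[).
  by apply/seteqP; split => p /=; rewrite in_itv/=; [|case].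
by apply: measurable_sqnorm.
Qed.

Lemma chord_closed (g : RM -> \bar R) (r : R) : measurable_fun setT g ->
  (\int[mu]_(x in `](- r)%R, r[) g x = \int[mu]_(x in `[(- r)%R, r]) g x)%E.
Proof.
move=> mg; have mi (i : interval R) : measurable_fun [set` i] g by exact: measurable_funTS.
by rewrite [RHS]integral_itv_bndoo.
Qed.

Lemma disc_iter1 (g : RM * RM -> \bar R) : measurable_fun setT g -> (forall p, plane_disc p -> 0 <= g p)%E ->
  (\int[mu2]_(p in plane_disc) g p =
   \int[mu]_y \int[mu]_(x in `[(- Num.sqrt (1 - y ^+ 2))%R, Num.sqrt (1 - y ^+ 2)]) g (x, y))%E.
Proof.
move=> mg g0; rewrite integral_mkcond fubini_tonelli2; first last.
- by move=> p; rewrite patchE; case: ifPn => // /set_mem /g0.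
- exact/(measurable_restrictT _ measurable_plane_disc)/measurable_funTS.
apply: eq_integral => y _; rewrite /fubini_G -chord_closed; last exact: measurable_fun_pair1.
rewrite -disc_chord [RHS]integral_mkcond; apply: eq_integral => x _.
by rewrite !patchE; congr (if _ then _ else _); apply/idP/idP; rewrite !inE.
Qed.

Lemma disc_iter2 (g : RM * RM -> \bar R) : measurable_fun setT g -> (forall p, plane_disc p -> 0 <= g p)%E ->
  (\int[mu2]_(p in plane_disc) g p =
   \int[mu]_x \int[mu]_(y in `[(- Num.sqrt (1 - x ^+ 2))%R, Num.sqrt (1 - x ^+ 2)]) g (x, y))%E.
Proof.
move=> mg g0; rewrite integral_mkcond fubini_tonelli1; first last.
- by move=> p; rewrite patchE; case: ifPn => // /set_mem /g0.
- exact/(measurable_restrictT _ measurable_plane_disc)/measurable_funTS.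
apply: eq_integral => x _; rewrite /fubini_F -chord_closed; last exact: measurable_fun_pair2.
rewrite -disc_chord [RHS]integral_mkcond; apply: eq_integral => y _.
by rewrite !patchE; congr (if _ then _ else _); apply/idP/idP; rewrite !inE /plane_disc /= addrC.
Qed.

Lemma rho_gt0 p : plane_disc p -> 0 < 1 - sqnorm p.
Proof. by rewrite subr_gt0. Qed.

Lemma sqnorm_ge0 p : 0 <= sqnorm p.
Proof. by rewrite addr_ge0 ?sqr_ge0. Qed.

Lemma measurable_rho_pow n : measurable_fun [set: RM * RM] ((fun p => (1 - sqnorm p) ^+ n) : RM * RM -> RM).
Proof.
by apply: measurable_funX; apply: measurable_funB => //; exact: measurable_sqnorm.
Qed.

Lemma chord_integral_by_parts (y : R) n :
  (\int[mu]_(x in `[(- Num.sqrt (1 - y ^+ 2))%R, Num.sqrt (1 - y ^+ 2)])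
     ((1 - (x ^+ 2 + y ^+ 2)) ^+ n.+1)%:E =
   \int[mu]_(x in `[(- Num.sqrt (1 - y ^+ 2))%R, Num.sqrt (1 - y ^+ 2)])
     (2 * n.+1%:R * (x ^+ 2 * (1 - (x ^+ 2 + y ^+ 2)) ^+ n))%:E)%E.
Proof.
have [y1|y1] := ltP (y ^+ 2) 1; last first.
  by rewrite ler0_sqrtr ?subr_le0// oppr0 set_itv1 !integral_set1.
have E x : 1 - (x ^+ 2 + y ^+ 2) = Num.sqrt (1 - y ^+ 2) ^+ 2 - x ^+ 2.
  by rewrite sqr_sqrtr ?subr_ge0 ?ltW//; ring.
under eq_integral do rewrite E; under [RHS]eq_integral do rewrite E.
by apply: chord_by_parts; rewrite sqrtr_gt0 subr_gt0.
Qed.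

Lemma rho_by_parts1 n : (\int[mu2]_(p in plane_disc) ((1 - sqnorm p) ^+ n.+1)%:E =
  \int[mu2]_(p in plane_disc) ((2 * n.+1%:R)%:E * (p.1 ^+ 2 * (1 - sqnorm p) ^+ n)%:E))%E.
Proof.
rewrite !disc_iter1.
- by apply: eq_integral => y _; rewrite chord_integral_by_parts.
- apply/measurable_EFinP; apply: measurable_funM => //; apply: measurable_funM.
    exact: measurable_funX.
  exact: measurable_rho_pow.
- by move=> p /rho_gt0/ltW pd; rewrite -EFinM lee_fin; apply: mulr_ge0 => //; apply: mulr_ge0; [exact: sqr_ge0|exact: exprn_ge0].
- by apply/measurable_EFinP; exact: measurable_rho_pow.
- by move=> p /rho_gt0/ltW pd; rewrite lee_fin exprn_ge0.
Qed.

Lemma rho_by_parts2 n : (\int[mu2]_(p in plane_disc) ((1 - sqnorm p) ^+ n.+1)%:E =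
  \int[mu2]_(p in plane_disc) ((2 * n.+1%:R)%:E * (p.2 ^+ 2 * (1 - sqnorm p) ^+ n)%:E))%E.
Proof.
rewrite !disc_iter2.
- apply: eq_integral => x _; have sC y : sqnorm (x, y) = y ^+ 2 + x ^+ 2 by rewrite addrC.
  under eq_integral do rewrite sC; rewrite chord_integral_by_parts.
  by apply: eq_integral => y _; rewrite sC.
- apply/measurable_EFinP; apply: measurable_funM => //; apply: measurable_funM.
    exact: measurable_funX.
  exact: measurable_rho_pow.
- by move=> p /rho_gt0/ltW pd; rewrite -EFinM lee_fin; apply: mulr_ge0 => //; apply: mulr_ge0; [exact: sqr_ge0|exact: exprn_ge0].
- by apply/measurable_EFinP; exact: measurable_rho_pow.
- by move=> p /rho_gt0/ltW pd; rewrite lee_fin exprn_ge0.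
Qed.

Lemma disc_area : (\int[mu2]_(p in plane_disc) 1%:E = (pi : R)%:E)%E.
Proof.
rewrite (disc_iter1 (g := cst 1%E))//.
rewrite -area_chord [RHS]integral_mkcond; apply: eq_integral => y _ /=.
rewrite integral_cst//= mul1e lebesgue_measure_itv /= lte_fin patchE mem_setE in_itv/=.
set r := Num.sqrt _; have r0 : 0 <= r by exact: sqrtr_ge0.
have -> : (if (- r < r)%R then (r%:E - (- r)%:E)%E else 0%E) = (2 * r)%:E.
  case: ifPn => [_|]; first by rewrite -EFinB; congr EFin; ring.
  by rewrite -leNgt => h; congr EFin; lra.
case: ifPn => // h; rewrite /r ler0_sqrtr ?mulr0//.
by rewrite subr_le0 expr2; case/nandP: h; rewrite -ltNge => h; nra.
Qed.

(** Let I_n be the integral. Integration by parts in x and in y expresses I_(n+1) through the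
    moments of x^2 and y^2; as x^2 + y^2 = 1 - (1 - x^2 - y^2), this closes up to (n + 2) I_(n+1) =
    (n + 1) I_n, without polar coordinates. *)
Lemma disc_rho n : (\int[mu2]_(p in plane_disc) ((1 - sqnorm p) ^+ n)%:E = (pi / n.+1%:R)%:E)%E.
Proof.
have mD := measurable_plane_disc.
elim: n => [|n IH].
  by rewrite divr1 -disc_area; apply: eq_integral => p _; rewrite expr0.
have m1 : measurable_fun (plane_disc : set (RM * RM)) (fun p : RM * RM => (p.1 ^+ 2 * (1 - sqnorm p) ^+ n)%:E).
  apply/measurable_funTS/measurable_EFinP; apply: measurable_funM.
    exact: measurable_funX.
  exact: measurable_rho_pow.
have m2 : measurable_fun (plane_disc : set (RM * RM)) (fun p : RM * RM => (p.2 ^+ 2 * (1 - sqnorm p) ^+ n)%:E).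
  apply/measurable_funTS/measurable_EFinP; apply: measurable_funM.
    exact: measurable_funX.
  exact: measurable_rho_pow.
have m3 : measurable_fun (plane_disc : set (RM * RM)) (fun p : RM * RM => ((1 - sqnorm p) ^+ n.+1)%:E).
  by apply/measurable_funTS/measurable_EFinP; exact: measurable_rho_pow.
have g1 p : plane_disc p -> (0 <= (p.1 ^+ 2 * (1 - sqnorm p) ^+ n)%:E)%E.
  by move=> /rho_gt0/ltW pd; rewrite lee_fin mulr_ge0 ?sqr_ge0 ?exprn_ge0.
have g2 p : plane_disc p -> (0 <= (p.2 ^+ 2 * (1 - sqnorm p) ^+ n)%:E)%E.
  by move=> /rho_gt0/ltW pd; rewrite lee_fin mulr_ge0 ?sqr_ge0 ?exprn_ge0.
have g3 p : plane_disc p -> (0 <= ((1 - sqnorm p) ^+ n.+1)%:E)%E.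
  by move=> /rho_gt0/ltW pd; rewrite lee_fin exprn_ge0.
have c0 : 0 <= 2 * n.+1%:R :> R by [].
have E1 := rho_by_parts1 n; have E2 := rho_by_parts2 n.
rewrite ge0_integralZl_EFin// in E1; rewrite ge0_integralZl_EFin// in E2.
have E3 : (\int[mu2]_(p in plane_disc) (p.1 ^+ 2 * (1 - sqnorm p) ^+ n)%:E +
   \int[mu2]_(p in plane_disc) (p.2 ^+ 2 * (1 - sqnorm p) ^+ n)%:E +
   \int[mu2]_(p in plane_disc) ((1 - sqnorm p) ^+ n.+1)%:E = (pi / n.+1%:R)%:E)%E.
  rewrite -IH -ge0_integralD// -ge0_integralD//.
  - apply: eq_integral => p _; rewrite -!EFinD; congr EFin.
    by rewrite (exprS _ n) /sqnorm; move: (_ ^+ n) => q; ring.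
  - by move=> p pd; rewrite adde_ge0 ?g1 ?g2.
  - exact: emeasurable_funD.
move: E1 E2 E3.
have X0 := @integral_ge0 _ _ _ mu2 plane_disc _ g1.
have Y0 := @integral_ge0 _ _ _ mu2 plane_disc _ g2.
have Z0 := @integral_ge0 _ _ _ mu2 plane_disc _ g3.
move: X0 Y0 Z0.
move: (\int[mu2]_(p in plane_disc) _)%E => X.
move: (\int[mu2]_(p in plane_disc) _)%E => Y.
move: (\int[mu2]_(p in plane_disc) _)%E => Z.
case: X => [x||]//; case: Y => [y||]//; case: Z => [z||]//.
move=> _ _ _; rewrite -!EFinM -!EFinD => -[E1] [E2] [E3]; congr EFin.
have n0 : n.+1%:R != 0 :> R by [].
have n1 : n.+1%:R + 1 != 0 :> R by rewrite gt_eqF// ltr_pwDl.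
rewrite -(natr1 n.+1); apply: (mulIf n1); rewrite divfK//.
have <- : (y + z + x) * n.+1%:R = pi :> R by rewrite E3 divfK.
by move: (n.+1%:R) E1 E2 => N E1 E2; lra.
Qed.

Lemma measurable_beta_kernel k n : measurable_fun [set: RM * RM]
  ((fun p => sqnorm p ^+ k * (1 - sqnorm p) ^+ n) : RM * RM -> RM).
Proof.
apply: measurable_funM; last exact: measurable_rho_pow.
by apply: measurable_funX; exact: measurable_sqnorm.
Qed.

(** This is pi times the Beta integral B(k+1, n+1). The induction on k uses s^(k+1) t^n + s^k
    t^(n+1) = s^k t^n for s + t = 1. *)
Lemma disc_beta k n :
  (\int[mu2]_(p in plane_disc) (sqnorm p ^+ k * (1 - sqnorm p) ^+ n)%:E =
   (pi * (k`!%:R * n`!%:R / (k + n).+1`!%:R))%:E)%E.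
Proof.
have mD := measurable_plane_disc.
have fn0 (m : nat) : m`!%:R != 0 :> R by rewrite pnatr_eq0 -lt0n fact_gt0.
elim: k n => [|k IH] n.
  under eq_integral do rewrite expr0 mul1r.
  rewrite disc_rho fact0 mul1r add0n factS natrM; congr (_ * _)%:E.
  by rewrite invfM mulrCA mulfV ?mulr1.
have g0 i j p : plane_disc p -> (0 <= (sqnorm p ^+ i * (1 - sqnorm p) ^+ j)%:E)%E.
  move=> /rho_gt0/ltW pd; rewrite lee_fin; apply: mulr_ge0; last exact: exprn_ge0.
  by apply: exprn_ge0; exact: sqnorm_ge0.
have m i j : measurable_fun (plane_disc : set (RM * RM))
    (fun p => (sqnorm p ^+ i * (1 - sqnorm p) ^+ j)%:E).
  by apply/measurable_funTS/measurable_EFinP; exact: measurable_beta_kernel.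
have : (\int[mu2]_(p in plane_disc) (sqnorm p ^+ k.+1 * (1 - sqnorm p) ^+ n)%:E +
   \int[mu2]_(p in plane_disc) (sqnorm p ^+ k * (1 - sqnorm p) ^+ n.+1)%:E =
   \int[mu2]_(p in plane_disc) (sqnorm p ^+ k * (1 - sqnorm p) ^+ n)%:E)%E.
  rewrite -ge0_integralD//; try by [exact: g0|exact: m].
  apply: eq_integral => p _; rewrite -EFinD; congr EFin.
  by rewrite !exprS; ring.
rewrite !IH; have := @integral_ge0 _ _ _ mu2 plane_disc _ (@g0 k.+1 n).
move: (\int[mu2]_(p in plane_disc) _)%E => [x||]// _.
rewrite -EFinD => -[E]; congr EFin.
have -> : x = pi * (k`!%:R * n`!%:R / (k + n).+1`!%:R) -
   pi * (k`!%:R * n.+1`!%:R / (k + n.+1).+1`!%:R) by rewrite -E addrK.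
have fS (i : nat) : i.+1`!%:R = i.+1%:R * i`!%:R :> R by rewrite factS natrM.
rewrite addSn addnS (fS (k + n).+1) (fS k) (fS n).
have := fn0 (k + n).+1; have := fn0 k; have := fn0 n.
move: (k`!%:R) (n`!%:R) ((k + n).+1`!%:R) => a b c a0 b0 c0.
rewrite -(natr1 (k + n).+1) -(natr1 (k + n)) -(natr1 n) -(natr1 k) natrD.
field.
by rewrite c0 /= gt_eqF// !ltr_wpDl.
Qed.

End DiscIntegral.

(** * Parseval's identity on the roots of unity *)

Section DiscreteParseval.
Context {R : realType}.
Local Notation C := (Cplx R).
Implicit Types z w : C.

Lemma cabs_sqrC z : (cabs z ^+ 2)%:C = z * z^*%C.
Proof. by rewrite -sqr_normc norm_cabs rmorphXn. Qed.

Lemma unity_root_orth N (k l : 'I_N) : k != l ->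
  \sum_(m < N) (unity_root N ^+ k * (unity_root N ^+ l)^*%C) ^+ m = 0 :> C.
Proof.
move=> kl; set u := _ * _.
have o1 (i : nat) : unity_root N ^+ i * (unity_root N ^+ i)^*%C = 1 :> C.
  by rewrite -cabs_sqrC cabsX cabs_unity_root !expr1n.
have uN : u ^+ N = 1.
  rewrite /u exprMn exprAC unity_root_expn expr1n mul1r -rmorphXn /=.
  by rewrite exprAC unity_root_expn expr1n rmorph1.
have u1 : u != 1.
  apply/negP => /eqP u1.
  have E : unity_root N ^+ k = unity_root N ^+ l :> C.
    have u1' : unity_root N ^+ k * (unity_root N ^+ l)^*%C = 1 := u1.
    by rewrite -[LHS]mulr1 -(o1 l) [X in _ * X]mulrC mulrA u1' mul1r.
  have o0 : unity_root N != 0 :> C by rewrite -cabs_gt0 cabs_unity_root.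
  have aux (i j : 'I_N) : (i < j)%N -> unity_root N ^+ i = unity_root N ^+ j :> C -> False.
    move=> ij Eij; have jiN : (0 < j - i < N)%N.
      by rewrite subn_gt0 ij /= (leq_ltn_trans (leq_subr _ _)).
    have /negP := @unity_root_neq1 R N _ jiN; apply.
    apply/eqP/(mulIf (expf_neq0 i o0)).
    by rewrite -exprD subnK ?mul1r// ltnW.
  case: (ltngtP k l) => [kl'|lk|/val_inj /eqP]; [exact: aux kl' E|exact: aux lk (esym E)|].
  by rewrite (negPf kl).
have /eqP := subrX1 u N; rewrite uN subrr eq_sym mulf_eq0 subr_eq0 (negPf u1) /=.
by move/eqP.
Qed.

(** Expand the square as a double sum over coefficients and sum over the roots first: only the
    diagonal survives [unity_root_orth]. *)
Lemma discrete_parseval N (c : nat -> C) :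
  \sum_(m < N) cabs (\sum_(k < N) c k * (unity_root N ^+ m) ^+ k) ^+ 2 =
  N%:R * \sum_(k < N) cabs (c k) ^+ 2.
Proof.
apply: (@complexI R); rewrite rmorphM rmorph_nat !rmorph_sum /=.
have E m : (cabs (\sum_(k < N) c k * (unity_root N ^+ m) ^+ k) ^+ 2)%:C =
    \sum_(k < N) \sum_(l < N) (c k * (unity_root N ^+ m) ^+ k) *
      (c l * (unity_root N ^+ m) ^+ l)^*%C.
  rewrite cabs_sqrC rmorph_sum /= mulr_suml.
  by apply: eq_bigr => k _; rewrite mulr_sumr.
under eq_bigr do rewrite E.
rewrite exchange_big mulr_sumr /=; apply: eq_bigr => k _.
rewrite exchange_big /= (bigD1 k) //= [X in _ + X]big1 ?addr0.
  rewrite (eq_bigr (fun=> (cabs (c k) ^+ 2)%:C)).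
    by rewrite sumr_const card_ord mulr_natl.
  move=> m _; rewrite cabs_sqrC rmorphM mulrACA.
  rewrite [X in _ * X](_ : _ = 1) ?mulr1//=.
  by rewrite -cabs_sqrC -exprM cabsX cabs_unity_root !expr1n.
move=> l lk.
transitivity (\sum_(m < N) c k * (c l)^*%C * (unity_root N ^+ k * (unity_root N ^+ l)^*%C) ^+ m).
  apply: eq_bigr => m _; rewrite rmorphM mulrACA; congr (_ * _).
  by rewrite exprMn -rmorphXn /= ![_ ^+ m ^+ _]exprAC.
by rewrite -mulr_sumr unity_root_orth ?mulr0// eq_sym.
Qed.

End DiscreteParseval.

(** * Measurable functions on the disc and their rotation averages *)

Section DiscFunctions.
Context {R : realType}.
Local Notation C := (Cplx R).
Local Notation mu2 := (@lebesgue_measure R \x @lebesgue_measure R)%E.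
Local Notation RM := (measurableTypeR R).
Implicit Types (h : C -> R) (z w : C).

Definition toC (p : R * R) : C := Complex p.1 p.2.

Lemma cabs_toC p : cabs (toC p) ^+ 2 = sqnorm p.
Proof. exact: cabs_sqr. Qed.

Lemma plane_discE p : plane_disc p <-> cabs (toC p) < 1.
Proof.
rewrite /plane_disc /= -/(sqnorm p) -cabs_toC; split.
  by rewrite expr_lt1 ?cabs_ge0.
by move=> ?; rewrite expr_lt1 ?cabs_ge0.
Qed.

Definition cmeasurable (g : RM * RM -> C) :=
  measurable_fun setT ((fun p => complex.Re (g p)) : RM * RM -> RM) /\
  measurable_fun setT ((fun p => complex.Im (g p)) : RM * RM -> RM).

Lemma cmeasurable_cst z : cmeasurable (fun=> z).
Proof. by split; exact: measurable_cst. Qed.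

Lemma cmeasurable_toC : cmeasurable toC.
Proof. by split; [exact: measurable_fst|exact: measurable_snd]. Qed.

Lemma cmeasurableD g1 g2 : cmeasurable g1 -> cmeasurable g2 ->
  cmeasurable (fun p => g1 p + g2 p).
Proof.
move=> [r1 i1] [r2 i2]; split.
  have := measurable_funD r1 r2.
  by apply: eq_measurable_fun => p _; rewrite ReD.
have := measurable_funD i1 i2.
by apply: eq_measurable_fun => p _; rewrite ImD.
Qed.

Lemma ReM z w : complex.Re (z * w) =
  complex.Re z * complex.Re w - complex.Im z * complex.Im w.
Proof. by case: z w => ? ? []. Qed.

Lemma ImM z w : complex.Im (z * w) =
  complex.Re z * complex.Im w + complex.Im z * complex.Re w.
Proof. by case: z w => ? ? []. Qed.

Lemma cmeasurableM g1 g2 : cmeasurable g1 -> cmeasurable g2 ->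
  cmeasurable (fun p => g1 p * g2 p).
Proof.
move=> [r1 i1] [r2 i2]; split.
  have := measurable_funB (measurable_funM r1 r2) (measurable_funM i1 i2).
  by apply: eq_measurable_fun => p _; rewrite ReM.
have := measurable_funD (measurable_funM r1 i2) (measurable_funM i1 r2).
by apply: eq_measurable_fun => p _; rewrite ImM.
Qed.

Lemma cmeasurable_sum (a : nat -> C) N :
  cmeasurable (fun p => \sum_(k < N) a k * toC p ^+ k).
Proof.
have mX k : cmeasurable (fun p => toC p ^+ k).
  elim: k => [|k IH].
    by have := cmeasurable_cst 1; congr cmeasurable; apply/funext => p; rewrite expr0.
  have := cmeasurableM cmeasurable_toC IH; congr cmeasurable.
  by apply/funext => p; rewrite exprS.
elim: N => [|N IH].
  by have := cmeasurable_cst 0; congr cmeasurable; apply/funext => p; rewrite big_ord0.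
have := cmeasurableD IH (cmeasurableM (cmeasurable_cst (a N)) (mX N)).
by congr cmeasurable; apply/funext => p; rewrite big_ord_recr.
Qed.

Lemma cmeasurable_cabs_sqr g : cmeasurable g ->
  measurable_fun setT ((fun p => cabs (g p) ^+ 2) : RM * RM -> RM).
Proof.
move=> [r i]; have := measurable_funD (measurable_funX 2 r) (measurable_funX 2 i).
by apply: eq_measurable_fun => p _; rewrite cabs_sqr.
Qed.

(** Extension by 0 to the whole plane, where [integral_rotate] applies; it commutes with rotations
    because they preserve the disc. *)
Definition disc_ext h : RM * RM -> \bar R :=
  (fun p => (h (toC p))%:E) \_ (plane_disc : set (RM * RM)).

Lemma disc_ext_in h p : plane_disc p -> disc_ext h p = (h (toC p))%:E.
Proof. by move=> pd; rewrite /disc_ext patchE mem_set. Qed.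

Lemma disc_ext_out h p : ~ plane_disc p -> disc_ext h p = 0%E.
Proof. by move=> pd; rewrite /disc_ext patchE memNset. Qed.

Lemma disc_ext_ge0 h p : (forall z, cabs z < 1 -> 0 <= h z) -> (0 <= disc_ext h p)%E.
Proof.
move=> h0; have [pd|pd] := pselect (plane_disc p); last by rewrite disc_ext_out.
by rewrite disc_ext_in// lee_fin h0//; apply/plane_discE.
Qed.

Lemma integral_disc_ext h :
  (\int[mu2]_p disc_ext h p = \int[mu2]_(p in plane_disc) (h (toC p))%:E)%E.
Proof. by rewrite [RHS]integral_mkcond. Qed.

Lemma measurable_disc_ext h :
  measurable_fun (plane_disc : set (RM * RM)) ((fun p => h (toC p)) : RM * RM -> RM) ->
  measurable_fun setT (disc_ext h).
Proof.
move=> mh; apply/(measurable_restrictT _ measurable_plane_disc).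
exact/measurable_EFinP.
Qed.

Lemma disc_ext_rotate h w p : cabs w = 1 ->
  disc_ext h (linear2 (complex.Re w) (- complex.Im w) (complex.Im w) (complex.Re w) p) =
  disc_ext (fun z => h (w * z)) p.
Proof.
move=> w1; set p' := linear2 _ _ _ _ p.
have E : toC p' = w * toC p.
  by apply/eqP; rewrite eq_complex ReM ImM /= mulNr [X in _ && (X == _)]addrC addrC addrC !eqxx.
have pp : plane_disc p' <-> plane_disc p.
  by rewrite !plane_discE E cabsM w1 mul1r.
have [pd|pd] := pselect (plane_disc p).
  by rewrite !disc_ext_in ?E//; apply/pp.
by rewrite !disc_ext_out// => /pp.
Qed.

Lemma measurable_disc_ext_rotate h w : cabs w = 1 ->
  measurable_fun setT (disc_ext h) -> measurable_fun setT (disc_ext (fun z => h (w * z))).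
Proof.
move=> w1 mh.
have := measurableT_comp mh (measurable_linear2 (complex.Re w) (- complex.Im w) (complex.Im w) (complex.Re w)).
by apply: eq_measurable_fun => p _; rewrite /= disc_ext_rotate.
Qed.

Lemma integral_disc_ext_rotate h w : cabs w = 1 -> (forall z, cabs z < 1 -> 0 <= h z) ->
  measurable_fun setT (disc_ext h) ->
  (\int[mu2]_p disc_ext (fun z => h (w * z)%R) p = \int[mu2]_p disc_ext h p)%E.
Proof.
move=> w1 h0 mh.
rewrite -(@integral_rotate R (complex.Re w) (complex.Im w) (disc_ext h))//.
- by apply: eq_integral => p _; rewrite disc_ext_rotate.
- by rewrite -cabs_sqr w1 expr1n.
- by move=> p; exact: disc_ext_ge0.
Qed.

Definition rotation_average h N z : R := N%:R^-1 * \sum_(m < N) h (unity_root N ^+ m * z).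

Lemma disc_ext_rotation_average h N p : disc_ext (rotation_average h N) p =
  (N%:R^-1%:E * \sum_(m < N) disc_ext (fun z => h (unity_root N ^+ m * z)%R) p)%E.
Proof.
have [pd|pd] := pselect (plane_disc p); last first.
  by rewrite disc_ext_out// big1 ?mule0// => m _; rewrite disc_ext_out.
rewrite disc_ext_in// EFinM -sumEFin; congr (_ * _)%E.
by apply: eq_bigr => m _; rewrite disc_ext_in.
Qed.

Lemma measurable_rotation_average h N : measurable_fun setT (disc_ext h) ->
  measurable_fun setT (disc_ext (rotation_average h N)).
Proof.
move=> mh.
have mS : measurable_fun setT (fun p =>
    (N%:R^-1%:E * \sum_(m < N) disc_ext (fun z => h (unity_root N ^+ m * z)%R) p)%E).
  apply: measurable_funeM; apply: emeasurable_sum => m.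
  by apply: measurable_disc_ext_rotate => //; rewrite cabsX cabs_unity_root expr1n.
by apply: eq_measurable_fun mS => p _; rewrite disc_ext_rotation_average.
Qed.

Lemma integral_rotation_average h N : (0 < N)%N -> (forall z, cabs z < 1 -> 0 <= h z) ->
  measurable_fun setT (disc_ext h) ->
  (\int[mu2]_p disc_ext (rotation_average h N) p = \int[mu2]_p disc_ext h p)%E.
Proof.
move=> N0 h0 mh.
have o1 m : cabs (unity_root N ^+ m : C) = 1 by rewrite cabsX cabs_unity_root expr1n.
have g0 (m : 'I_N) p : (0 <= disc_ext (fun z => h (unity_root N ^+ m * z)%R) p)%E.
  by apply: disc_ext_ge0 => z z1; apply: h0; rewrite cabsM o1 mul1r.
have mg (m : 'I_N) : measurable_fun setT (disc_ext (fun z => h (unity_root N ^+ m * z)%R)).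
  exact: measurable_disc_ext_rotate.
under eq_integral do rewrite disc_ext_rotation_average.
rewrite ge0_integralZl_EFin//; first last.
- by apply: emeasurable_sum.
- by move=> p _; exact: sume_ge0.
rewrite ge0_integral_sum//; under eq_bigr do rewrite integral_disc_ext_rotate//.
have -> : (\sum_(m < N) \int[mu2]_p disc_ext h p =
    N%:R%:E * \int[mu2]_p disc_ext h p)%E by rewrite sumr_const card_ord mule_natl.
rewrite muleA -EFinM mulVf ?mul1e//.
by rewrite pnatr_eq0 -lt0n.
Qed.

End DiscFunctions.

(** * Weighted Parseval identity on the disc *)

Section DiscParseval.
Context {R : realType}.
Local Notation C := (Cplx R).
Local Notation mu2 := (@lebesgue_measure R \x @lebesgue_measure R)%E.
Local Notation RM := (measurableTypeR R).
Implicit Types (b : nat -> C) (F : C -> C) (z w : C).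

Lemma limn_einf_ge (u : nat -> \bar R) (c : R) :
  (forall e : R, 0 < e -> \forall N \near \oo, ((c - e)%:E <= u N)%E) ->
  (c%:E <= limn_einf u)%E.
Proof.
move=> H; apply/lee_addgt0Pr => e e0; rewrite -leeBlDr// -EFinB limn_einf_lim.
apply: lime_ge; first exact: is_cvg_einfs.
have [N0 _ HN] := H e e0; exists N0 => // N /= NN.
by apply: le_ereal_inf_tmp => _ [m /= Nm <-]; apply: HN; exact: leq_trans Nm.
Qed.

Definition wabs2 (n : nat) F (z : C) : R := cabs (F z) ^+ 2 * (1 - cabs z ^+ 2) ^+ n.

Definition partial b N (z : C) : C := \sum_(k < N) b k * z ^+ k.

(** By [disc_beta], pi times this number is the integral of |z|^(2k) (1 - |z|^2)^n over the disc. *)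
Definition beta_weight k n : R := k`!%:R * n`!%:R / (k + n).+1`!%:R.

Lemma beta_weight_ge0 k n : 0 <= beta_weight k n.
Proof. by rewrite divr_ge0. Qed.

Lemma disc_weight_ge0 n z : cabs z < 1 -> 0 <= (1 - cabs z ^+ 2) ^+ n.
Proof.
move=> z1; rewrite exprn_ge0// subr_ge0 ltW// expr_lt1 ?cabs_ge0//.
Qed.

Lemma wabs2_ge0 n F z : cabs z < 1 -> 0 <= wabs2 n F z.
Proof. by move=> z1; rewrite mulr_ge0 ?disc_weight_ge0// exprn_ge0 ?cabs_ge0. Qed.

Lemma measurable_wabs2_partial n b N :
  measurable_fun setT ((fun p => wabs2 n (partial b N) (toC p)) : RM * RM -> RM).
Proof.
apply: measurable_funM.
  apply: (cmeasurable_cabs_sqr (g := fun p => partial b N (toC p))).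
  exact: cmeasurable_sum.
have := @measurable_rho_pow R n.
by apply: eq_measurable_fun => p _; rewrite cabs_toC.
Qed.

Lemma psum_cabs_cvg b F z : psum_on 1 b F -> cabs z < 1 ->
  cabs (partial b N z) @[N --> \oo] --> cabs (F z).
Proof.
move=> [_ bF] z1; apply/cvgrPdist_lt => e e0.
apply: filterS (bF z z1 e e0) => N; apply: le_lt_trans.
have := cabsB (F z) (F z - partial b N z); have := cabsD (F z - partial b N z) (partial b N z).
have -> : F z - (F z - partial b N z) = partial b N z by ring.
have -> : F z - partial b N z + partial b N z = F z by ring.
by rewrite ler_norml -/(partial b N z); lra.
Qed.

Lemma wabs2_cvg n b F z : psum_on 1 b F -> cabs z < 1 ->
  wabs2 n (partial b N) z @[N --> \oo] --> wabs2 n F z.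
Proof.
by move=> bF z1; apply: cvgMl; rewrite expr2; apply: cvgM; exact: psum_cabs_cvg.
Qed.

Lemma measurable_wabs2 n b F : psum_on 1 b F -> measurable_fun setT (disc_ext (wabs2 n F)).
Proof.
move=> bF; apply: measurable_disc_ext.
apply: (measurable_fun_cvg (h := fun N (p : RM * RM) => wabs2 n (partial b N) (toC p))).
  by move=> N; apply: measurable_funTS; exact: measurable_wabs2_partial.
by move=> p /plane_discE pd; exact: wabs2_cvg bF pd.
Qed.

Lemma integral_weighted_sum n (c : nat -> R) N : (forall k, 0 <= c k) ->
  (\int[mu2]_p disc_ext (fun z => (\sum_(k < N) c k * (cabs z ^+ 2) ^+ k) * (1 - cabs z ^+ 2) ^+ n)%R p =
   (pi * \sum_(k < N) c k * beta_weight k n)%:E)%E.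
Proof.
move=> c0; rewrite integral_disc_ext.
transitivity (\int[mu2]_(p in plane_disc)
   (\sum_(k < N) (c k)%:E * (sqnorm p ^+ k * (1 - sqnorm p) ^+ n)%:E))%E.
  apply: eq_integral => p _; rewrite cabs_toC mulr_suml -sumEFin.
  by apply: eq_bigr => k _; rewrite -EFinM mulrA.
have g0 k p : plane_disc p -> (0 <= (sqnorm p ^+ k * (1 - sqnorm p) ^+ n)%:E)%E.
  move=> /rho_gt0/ltW pd; rewrite lee_fin; apply: mulr_ge0; last exact: exprn_ge0.
  by apply: exprn_ge0; exact: sqnorm_ge0.
have m k : measurable_fun (plane_disc : set (RM * RM))
    (fun p => (sqnorm p ^+ k * (1 - sqnorm p) ^+ n)%:E).
  by apply/measurable_funTS/measurable_EFinP; exact: measurable_beta_kernel.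
rewrite ge0_integral_sum//; first last.
- by move=> k p pd; apply: mule_ge0; [rewrite lee_fin|exact: g0].
- by move=> k; apply: emeasurable_funM => //; exact: measurable_cst.
- exact: measurable_plane_disc.
rewrite mulr_sumr -sumEFin; apply: eq_bigr => k _.
rewrite ge0_integralZl_EFin//; first last.
- exact: g0.
- exact: measurable_plane_disc.
by rewrite disc_beta -EFinM; congr EFin; rewrite /beta_weight; ring.
Qed.

Lemma parseval_circle b N z :
  \sum_(m < N) cabs (partial b N (unity_root N ^+ m * z)) ^+ 2 =
  N%:R * \sum_(k < N) cabs (b k) ^+ 2 * (cabs z ^+ 2) ^+ k.
Proof.
transitivity (N%:R * \sum_(k < N) cabs (b k * z ^+ k) ^+ 2).
  rewrite -(discrete_parseval N (fun k => b k * z ^+ k)); apply: eq_bigr => m _; congr (cabs _ ^+ 2).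
  by apply: eq_bigr => k _; rewrite exprMn mulrA mulrAC.
by congr (_ * _); apply: eq_bigr => k _; rewrite cabsM cabsX exprMn [X in _ * X]exprAC.
Qed.

(** There are as many rotations as coefficients, so averaging over them removes all cross terms and
    leaves a radial function whose moments are known. *)
Lemma integral_wabs2_partial n b N :
  (\int[mu2]_p disc_ext (wabs2 n (partial b N.+1)) p =
   (pi * \sum_(k < N.+1) cabs (b k) ^+ 2 * beta_weight k n)%:E)%E.
Proof.
have h0 z : cabs z < 1 -> 0 <= wabs2 n (partial b N.+1) z by exact: wabs2_ge0.
have mh : measurable_fun setT (disc_ext (wabs2 n (partial b N.+1))).
  by apply: measurable_disc_ext; apply: measurable_funTS; exact: measurable_wabs2_partial.
rewrite -(integral_rotation_average (ltn0Sn N) h0 mh).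
have o1 m : cabs (unity_root N.+1 ^+ m : C) = 1 by rewrite cabsX cabs_unity_root expr1n.
have n0 : N.+1%:R != 0 :> R by rewrite pnatr_eq0.
have -> : rotation_average (wabs2 n (partial b N.+1)) N.+1 =
  (fun z => (\sum_(k < N.+1) cabs (b k) ^+ 2 * (cabs z ^+ 2) ^+ k) * (1 - cabs z ^+ 2) ^+ n).
  apply/funext => z; apply: (mulfI n0).
  rewrite /rotation_average mulVKf// [RHS]mulrA -parseval_circle mulr_suml.
  by apply: eq_bigr => m _; rewrite /wabs2 cabsM o1 mul1r.
exact: (@integral_weighted_sum n (fun k => cabs (b k) ^+ 2) N.+1
  (fun k => exprn_ge0 _ (cabs_ge0 _))).
Qed.

(* Averaging over the [N] rotations by roots of unity isolates the diagonal terms,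
   so that no integration in polar coordinates is needed. *)
Lemma rotation_average_lower n b F z K : psum_on 1 b F -> cabs z < 1 ->
  forall e : R, 0 < e -> \forall N \near \oo,
    (\sum_(k < K.+1) cabs (b k) ^+ 2 * (cabs z ^+ 2) ^+ k) * (1 - cabs z ^+ 2) ^+ n - e <=
    rotation_average (wabs2 n F) N.+1 z.
Proof.
move=> bF z1 e e0; have z0 := cabs_ge0 z.
pose s := (cabs z + 1) / 2.
have s0 : 0 < s by rewrite /s; lra.
have s1 : s <= 1 by rewrite /s; lra.
have zs : cabs z < s by rewrite /s; lra.
have [M HM] := bF.1 s (ltac:(rewrite s0 /s; lra)).
pose q := cabs z / s.
have q01 : 0 <= q < 1.
  by rewrite divr_ge0 ?(ltW s0)//= ltr_pdivrMr ?mul1r.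
pose B := M * (q ^+ 0 / (1 - q)); pose t N := M * (q ^+ N / (1 - q)).
have M0 : 0 <= M by apply: le_trans (HM 0%N); rewrite expr0 mulr1 cabs_ge0.
have B0 : 0 <= B.
  by rewrite mulr_ge0// expr0 div1r invr_ge0 subr_ge0; case/andP: q01 => _ /ltW.
have t0 N : 0 <= t N.
  by case/andP: q01 => q0 q1; rewrite mulr_ge0// divr_ge0 ?exprn_ge0 ?subr_ge0 ?(ltW q1).
(* [parseval_circle] is exact only for polynomials, so F is compared with its partial sum: both have
   modulus at most B and differ by at most t_N, hence the error 2 B t_N of the squares. *)
have bound N w : cabs w = cabs z ->
    cabs (partial b N w) ^+ 2 - 2 * B * t N <= cabs (F w) ^+ 2.
  move=> wz; have ws : cabs w < s by rewrite wz.
  have h1 := psum_error N bF s0 s1 HM ws.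
  have h2 := psum_error 0 bF s0 s1 HM ws.
  have h3 := partial_sum_dist s0 HM ws (leq0n N).
  rewrite !big_ord0 !subr0 wz -/q in h1 h2 h3.
  have h4 : cabs (partial b N w) <= cabs (F w) + t N.
    have -> : partial b N w = F w - (F w - partial b N w) by ring.
    by apply: le_trans (cabsB _ _) _; rewrite lerD2l.
  have f0 := cabs_ge0 (F w); have p0 := cabs_ge0 (partial b N w).
  rewrite -/(partial b N w) -/B in h2 h3.
  have u0 := t0 N.
  move: h4 h2 h3 f0 p0 u0; move: (cabs (partial b N w)) (cabs (F w)) (t N) => S f u.
  move=> h4 h2 h3 f0 p0 u0.
  have : (S - f) * (S + f) <= u * (2 * B).
    apply: (@le_trans _ _ (u * (S + f))); first by apply: ler_wpM2r; lra.
    by apply: ler_wpM2l => //; lra.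
  rewrite !expr2; lra.
have W0 : 0 <= (1 - cabs z ^+ 2) ^+ n by exact: disc_weight_ge0.
have W1 : (1 - cabs z ^+ 2) ^+ n <= 1.
  by rewrite exprn_ile1 ?subr_ge0 ?gerBl ?sqr_ge0// ltW// expr_lt1.
have [N0 _ Ht] := geometric_tail_cvg0 (2 * B * M) q01 e0.
exists (N0 + K)%N => // N /= NN.
have tN : 2 * B * t N.+1 < e.
  by rewrite /t mulrA; apply: Ht; rewrite /= leqW// (leq_trans _ NN)// leq_addr.
have KN : (K.+1 <= N.+1)%N by rewrite ltnS (leq_trans _ NN)// leq_addl.
have n0 : 0 < N.+1%:R :> R by rewrite ltr0n.
pose P L := \sum_(k < L) cabs (b k) ^+ 2 * (cabs z ^+ 2) ^+ k.
have PKN : P K.+1 <= P N.+1.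
  rewrite /P -!(big_mkord xpredT (fun k => cabs (b k) ^+ 2 * (cabs z ^+ 2) ^+ k)).
  rewrite (big_cat_nat (leq0n K.+1) KN)/= lerDl sumr_ge0// => k _.
  by rewrite mulr_ge0 ?exprn_ge0 ?cabs_ge0.
have main : (P N.+1 - 2 * B * t N.+1) * (1 - cabs z ^+ 2) ^+ n <=
    rotation_average (wabs2 n F) N.+1 z.
  rewrite /rotation_average ler_pdivlMl//; set c := 2 * B * t N.+1.
  have -> : N.+1%:R * ((P N.+1 - c) * (1 - cabs z ^+ 2) ^+ n) =
      \sum_(m < N.+1) (cabs (partial b N.+1 (unity_root N.+1 ^+ m * z)) ^+ 2 - c) *
        (1 - cabs z ^+ 2) ^+ n.
    rewrite -mulr_suml sumrB parseval_circle sumr_const card_ord -[c *+ _]mulr_natl.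
    by rewrite -mulrBr mulrA.
  apply: ler_sum => m _.
  have wz : cabs (unity_root N.+1 ^+ m * z) = cabs z.
    by rewrite cabsM cabsX cabs_unity_root expr1n mul1r.
  by rewrite /wabs2 wz ler_wpM2r// bound.
rewrite -/(P K.+1); rewrite mulrBl in main.
have := ler_wpM2r W0 PKN.
have : 2 * B * t N.+1 * (1 - cabs z ^+ 2) ^+ n <= e.
  apply: (@le_trans _ _ (2 * B * t N.+1 * 1)); last by rewrite mulr1 ltW.
  by rewrite ler_wpM2l// mulr_ge0// mulr_ge0.
lra.
Qed.

(** Both inequalities come from Fatou's lemma. For the upper bound it is applied to the partial sums
    of F; for the lower bound, to the rotation averages, which all have the same integral and whose
    lower limit dominates every truncated diagonal sum. *)
Theorem disc_parseval n b F : psum_on 1 b F ->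
  (\int[mu2]_(p in plane_disc) (wabs2 n F (toC p))%:E =
   pi%:E * \sum_(0 <= k <oo) (cabs (b k) ^+ 2 * beta_weight k n)%:E)%E.
Proof.
move=> bF; rewrite -integral_disc_ext.
have c0 k : 0 <= cabs (b k) ^+ 2 * beta_weight k n.
  by rewrite mulr_ge0 ?beta_weight_ge0// exprn_ge0 ?cabs_ge0.
have ser_cvg : (\sum_(0 <= k < N.+1) (cabs (b k) ^+ 2 * beta_weight k n)%:E)%E @[N --> \oo] -->
    (\sum_(0 <= k <oo) (cabs (b k) ^+ 2 * beta_weight k n)%:E)%E.
  rewrite (cvg_shiftS (fun N => (\sum_(0 <= k < N) (cabs (b k) ^+ 2 * beta_weight k n)%:E)%E)).
  by apply: is_cvg_nneseries => k _ _; rewrite lee_fin.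
have sumE N : (pi * \sum_(k < N.+1) cabs (b k) ^+ 2 * beta_weight k n)%:E =
    (pi%:E * \sum_(0 <= k < N.+1) (cabs (b k) ^+ 2 * beta_weight k n)%:E)%E.
  by rewrite EFinM -sumEFin big_mkord.
have ser_cvg2 : (pi%:E * \sum_(0 <= k < N.+1) (cabs (b k) ^+ 2 * beta_weight k n)%:E)%E @[N --> \oo] -->
    (pi%:E * \sum_(0 <= k <oo) (cabs (b k) ^+ 2 * beta_weight k n)%:E)%E.
  by apply: cvgeZl.
have mhN N : measurable_fun setT (disc_ext (wabs2 n (partial b N))).
  by apply: measurable_disc_ext; apply: measurable_funTS; exact: measurable_wabs2_partial.
apply/eqP; rewrite eq_le; apply/andP; split.
  have Hf : (\int[mu2]_p limn_einf (fun N => disc_ext (wabs2 n (partial b N.+1)) p) <=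
      limn_einf (fun N => \int[mu2]_p disc_ext (wabs2 n (partial b N.+1)) p))%E.
    apply: fatou => // N p _; apply: disc_ext_ge0; exact: wabs2_ge0.
  have El : limn_einf (fun N => \int[mu2]_p disc_ext (wabs2 n (partial b N.+1)) p)%E =
      (pi%:E * \sum_(0 <= k <oo) (cabs (b k) ^+ 2 * beta_weight k n)%:E)%E.
    under eq_fun do rewrite integral_wabs2_partial sumE.
    by have [-> _] := cvg_limn_einf_sup ser_cvg2.
  rewrite -El; apply: le_trans Hf; rewrite le_eqVlt; apply/orP; left; apply/eqP.
  apply: eq_integral => p _; have [pd|pd] := pselect (plane_disc p).
    rewrite disc_ext_in//; under eq_fun do rewrite disc_ext_in//.
    have /plane_discE p1 := pd.
    have Hc : (wabs2 n (partial b N.+1) (toC p))%:E @[N --> \oo] --> (wabs2 n F (toC p))%:E.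
      apply/cvg_EFin; first by near=> N.
      by rewrite (cvg_shiftS (fun N => wabs2 n (partial b N) (toC p))); exact: wabs2_cvg bF p1.
    by have [-> _] := cvg_limn_einf_sup Hc.
  rewrite disc_ext_out//; under eq_fun do rewrite disc_ext_out//.
  have Hc : ((fun=> 0%E) : nat -> \bar R) @ \oo --> 0%E by exact: cvg_cst.
  by have [-> _] := cvg_limn_einf_sup Hc.
have lower K : (pi%:E * \sum_(0 <= k < K.+1) (cabs (b k) ^+ 2 * beta_weight k n)%:E <=
    \int[mu2]_p disc_ext (wabs2 n F) p)%E.
  rewrite -sumE; set h := fun z : C =>
    (\sum_(k < K.+1) cabs (b k) ^+ 2 * (cabs z ^+ 2) ^+ k) * (1 - cabs z ^+ 2) ^+ n.
  have Ih : (\int[mu2]_p disc_ext h p)%E =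
      (pi * \sum_(k < K.+1) cabs (b k) ^+ 2 * beta_weight k n)%:E.
    exact: (@integral_weighted_sum n (fun k => cabs (b k) ^+ 2) K.+1
      (fun k => exprn_ge0 _ (cabs_ge0 _))).
  have mh : measurable_fun setT (disc_ext h).
    apply: measurable_disc_ext; apply: measurable_funTS; apply: measurable_funM; last first.
      have := @measurable_rho_pow R n.
      by apply: eq_measurable_fun => p _; rewrite cabs_toC.
    apply: measurable_sum => k; apply: measurable_funM => //.
    have := measurable_funX k (@measurable_sqnorm R).
    by apply: eq_measurable_fun => p _; rewrite cabs_toC.
  have hF0 z : cabs z < 1 -> 0 <= wabs2 n F z by exact: wabs2_ge0.
  have mF := measurable_wabs2 n bF.
  pose u N := disc_ext (rotation_average (wabs2 n F) N.+1).
  have u0 N p : (0 <= u N p)%E.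
    apply: disc_ext_ge0 => z z1; rewrite mulr_ge0 ?invr_ge0// sumr_ge0// => m _.
    by apply: wabs2_ge0; rewrite cabsM cabsX cabs_unity_root expr1n mul1r.
  have mu_ N : measurable_fun setT (u N) by exact: measurable_rotation_average.
  have Hf : (\int[mu2]_p limn_einf (u^~ p) <= limn_einf (fun N => \int[mu2]_p u N p))%E.
    by apply: fatou => // N p _.
  have El : limn_einf (fun N => \int[mu2]_p u N p)%E = (\int[mu2]_p disc_ext (wabs2 n F) p)%E.
    under eq_fun do rewrite integral_rotation_average//.
    have Hc : (fun=> \int[mu2]_p disc_ext (wabs2 n F) p)%E @ \oo -->
      (\int[mu2]_p disc_ext (wabs2 n F) p)%E by exact: cvg_cst.
    by have [-> _] := cvg_limn_einf_sup Hc.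
  rewrite -Ih -El; apply: le_trans Hf; apply: ge0_le_integral => //.
  - move=> p _; apply: disc_ext_ge0 => z z1; rewrite mulr_ge0 ?disc_weight_ge0// sumr_ge0// => k _.
    by rewrite mulr_ge0 ?exprn_ge0 ?cabs_ge0.
  - rewrite /limn_einf; apply: measurableT_comp; first exact: oppe_measurable.
    by apply: measurable_fun_limn_esup => N; exact: measurableT_comp.
  - move=> p _; have [pd|pd] := pselect (plane_disc p); last first.
      rewrite disc_ext_out//; rewrite /u; under eq_fun do rewrite disc_ext_out//.
      have Hc : ((fun=> 0%E) : nat -> \bar R) @ \oo --> 0%E by exact: cvg_cst.
      by have [-> _] := cvg_limn_einf_sup Hc.
    rewrite disc_ext_in//; apply: limn_einf_ge => e e0.
    have /plane_discE p1 := pd.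
    apply: filterS (rotation_average_lower n K bF p1 e0) => N.
    by rewrite /u disc_ext_in// lee_fin.
rewrite -(cvg_lim _ ser_cvg2)//; apply: lime_le.
  by apply/cvg_ex; eexists; exact: ser_cvg2.
by near=> K; exact: lower.
Unshelve. all: by end_near. Qed.

End DiscParseval.

(** * The telescoping identity for coefficients *)

Section CoefficientSums.
Context {R : realType}.
Local Notation C := (Cplx R).
Variables (m : nat) (c : nat -> C).

Definition tau k : R := k`!%:R / (k + m.+1)`!%:R.
Definition wB k : R := k`!%:R / (k + m.+1).+1`!%:R.
Definition wc k : R := k`!%:R / (k + m)`!%:R.
Definition csum k : C := \sum_(j < k.+1) c j.
Definition cdiff k : C := k.+1%:R * c k.+1 - m.+1%:R * csum k.

Lemma fact_neq0 (i : nat) : i`!%:R != 0 :> R.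
Proof. by rewrite pnatr_eq0 -lt0n fact_gt0. Qed.

Lemma natS_neq0 (i : nat) : i.+1%:R != 0 :> R.
Proof. by rewrite pnatr_eq0. Qed.

Lemma factSR (i : nat) : i.+1`!%:R = i.+1%:R * i`!%:R :> R.
Proof. by rewrite factS natrM. Qed.

Lemma tau_gt0 k : 0 < tau k.
Proof. by rewrite divr_gt0// ltr0n fact_gt0. Qed.

Lemma wB_gt0 k : 0 < wB k.
Proof. by rewrite divr_gt0// ltr0n fact_gt0. Qed.

Lemma wc_gt0 k : 0 < wc k.
Proof. by rewrite divr_gt0// ltr0n fact_gt0. Qed.

Lemma wBE k : tau k = (k + m.+1).+1%:R * wB k.
Proof.
rewrite /tau /wB factSR; have := fact_neq0 (k + m.+1); have := natS_neq0 (k + m.+1).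
by move: ((k + m.+1).+1%:R) ((k + m.+1)`!%:R) => a b a0 b0; field; rewrite a0 b0.
Qed.

Lemma tauS k : tau k.+1 = k.+1%:R * wB k.
Proof. by rewrite /tau /wB addSn factSR mulrA. Qed.

Lemma wcS k : wc k.+1 = k.+1%:R * tau k.
Proof. by rewrite /wc /tau addSnnS factSR mulrA. Qed.

Lemma wc0 : wc 0 = m.+1%:R * tau 0.
Proof.
rewrite /wc /tau !add0n factSR fact0; have := fact_neq0 m; have := natS_neq0 m.
by move: (m.+1%:R) (m`!%:R) => a b a0 b0; field; rewrite a0 b0.
Qed.

Lemma csumS k : csum k.+1 = csum k + c k.+1.
Proof. by rewrite /csum big_ord_recr. Qed.

Definition boundary k : R := m.+1%:R * cabs (csum k) ^+ 2 * tau k.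

Lemma boundary_ge0 k : 0 <= boundary k.
Proof.
by apply: mulr_ge0 (ltW (tau_gt0 k)); apply: mulr_ge0 => //; exact: sqr_ge0.
Qed.

(** Both sides are quadratic in c_(k+1) and S_k; once all weights are written as multiples of wB_k,
    a polynomial identity in real and imaginary parts remains. *)
Lemma cdiff_telescope k : cabs (cdiff k) ^+ 2 * wB k =
  cabs (c k.+1) ^+ 2 * wc k.+1 + boundary k - boundary k.+1.
Proof.
rewrite /boundary wcS tauS wBE /cdiff csumS.
have -> : (k + m.+1).+1%:R = k.+1%:R + m.+1%:R :> R by rewrite -natrD addSn.
rewrite !cabs_sqr ReB ImB ReD ImD !natrC !ReMr !ImMr.
move: (complex.Re _) (complex.Im _) (complex.Re _) (complex.Im _) => a b d e.
move: (k.+1%:R) (m.+1%:R) (wB k) => K N w; ring.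
Qed.

(** By [wc0] the initial boundary term is |c_0|^2 wc_0, exactly the term that the shifted index k +
    1 leaves out. *)
Lemma sum_cdiff K : \sum_(k < K) cabs (cdiff k) ^+ 2 * wB k =
  \sum_(j < K.+1) cabs (c j) ^+ 2 * wc j - boundary K.
Proof.
elim: K => [|K IH].
  rewrite big_ord0 big_ord_recl big_ord0 addr0 /boundary /csum big_ord_recl big_ord0 addr0.
  by rewrite wc0 mulrCA mulrA subrr.
rewrite big_ord_recr IH [in RHS]big_ord_recr /= cdiff_telescope; ring.
Qed.

(** Inductive step of Cauchy-Schwarz without square roots; the cross term is handled by 2 s a <= X B
    + A Y. *)
Lemma cs_step (s a X Y A B : R) : 0 <= s -> 0 <= a -> 0 <= X -> 0 <= Y -> 0 <= A -> 0 <= B ->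
  s ^+ 2 <= X * Y -> a ^+ 2 <= A * B -> (s + a) ^+ 2 <= (X + A) * (Y + B).
Proof.
move=> s0 a0 X0 Y0 A0 B0 h1 h2.
have h3 : (s * a) ^+ 2 <= (X * B) * (A * Y).
  rewrite exprMn; apply: le_trans (_ : _ <= (X * Y) * (A * B)) _.
    by apply: ler_pM => //; exact: sqr_ge0.
  by rewrite le_eqVlt; apply/orP; left; apply/eqP; ring.
have h4 : 2 * (s * a) <= X * B + A * Y.
  rewrite -ler_sqr ?nnegrE ?addr_ge0 ?mulr_ge0//.
  have := sqr_ge0 (X * B - A * Y).
  move: h3; move: (s * a) (X * B) (A * Y) => p q r; rewrite !expr2; nra.
rewrite sqrrD mulrDl !mulrDr; move: h1 h2 h4; rewrite -mulr_natr; lra.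
Qed.

Lemma cauchy_schwarz_sum (a A B : nat -> R) i j : (forall k, 0 <= a k) ->
  (forall k, 0 <= A k) -> (forall k, 0 <= B k) -> (forall k, a k ^+ 2 <= A k * B k) ->
  (\sum_(i <= k < j) a k) ^+ 2 <= (\sum_(i <= k < j) A k) * (\sum_(i <= k < j) B k).
Proof.
move=> a0 A0 B0 aAB; elim: j => [|j IH]; first by rewrite !big_geq// expr0n mulr0.
have [ij|ji] := leqP i j; last by rewrite !big_geq// expr0n mulr0.
by rewrite !big_nat_recr//=; apply: cs_step => //; exact: sumr_ge0.
Qed.

(** Hockey-stick identity for the sum of (j+m)! / j!. It makes (m+1) tau_K the right normalization:
    it cancels the weight sum that Cauchy-Schwarz produces in [boundary_cvg0], and it makes the
    effect of a shift in [cnorm_shift] independent of k. *)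
Lemma sum_inv_wc K : m.+1%:R * tau K * \sum_(0 <= j < K.+1) (wc j)^-1 = 1.
Proof.
elim: K => [|K IH].
  by rewrite big_nat1 wc0 mulfV// mulf_neq0 ?natS_neq0// gt_eqF ?tau_gt0.
rewrite big_nat_recr//= wcS; move: IH; set X := \sum_(0 <= j < K.+1) _.
rewrite wBE tauS.
have -> : (K + m.+1).+1%:R = K.+1%:R + m.+1%:R :> R by rewrite -natrD addSn.
have w0 : wB K != 0 by rewrite gt_eqF ?wB_gt0.
have := natS_neq0 K; have := natS_neq0 m.
have : K.+1%:R + m.+1%:R != 0 :> R by rewrite -natrD addSn pnatr_eq0.
move: (K.+1%:R) (m.+1%:R) (wB K) w0 => k N w w0 kN N0 k0 E.
have -> : X = (N * ((k + N) * w))^-1.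
  by apply: (mulfI (mulf_neq0 N0 (mulf_neq0 kN w0))); rewrite E mulfV// !mulf_neq0.
by field; rewrite w0 k0 kN N0.
Qed.

Lemma tau_le k : tau k <= k.+1%:R^-1.
Proof.
rewrite /tau ler_pdivrMr ?ltr0n ?fact_gt0// mulrC ler_pdivlMr ?ltr0n//.
by rewrite -natrM mulnC -factS ler_nat addnS; apply: leq_fact; rewrite ltnS leq_addr.
Qed.

(** Split S_K at an index J beyond which the weighted series has a small tail. The first part is a
    fixed number, killed by tau_K; the second is controlled by Cauchy-Schwarz and [sum_inv_wc]. *)
Lemma boundary_cvg0 (D : R) :
  (forall K, \sum_(j < K) cabs (c j) ^+ 2 * wc j <= D) ->
  forall e : R, 0 < e -> \forall K \near \oo, boundary K < e.
Proof.
move=> HD e e0.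
pose Q K := \sum_(0 <= j < K) cabs (c j) ^+ 2 * wc j.
have Q0 i j : 0 <= \sum_(i <= k < j) cabs (c k) ^+ 2 * wc k.
  by rewrite sumr_ge0// => k _; rewrite mulr_ge0 ?(ltW (wc_gt0 k))// exprn_ge0 ?cabs_ge0.
have hS : has_sup (range Q).
  split; first by exists (Q 0%N), 0%N.
  by exists D => _ [K _ <-]; rewrite /Q big_mkord.
(* Two parts of size at most e/4 each enter with the factor 2 of (p + t)^2 <= 2 p^2 + 2 t^2. *)
have e4 : 0 < e / 4 by rewrite divr_gt0.
have [_ [J _ <-] QJ] := sup_adherent e4 hS.
have tail K : (J <= K)%N -> \sum_(J <= j < K) cabs (c j) ^+ 2 * wc j < e / 4.
  move=> JK; have : Q K <= sup (range Q) by apply: ub_le_sup; [case: hS|exists K].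
  rewrite /Q (big_cat_nat (leq0n J) JK)/= -/(Q J); lra.
pose A : R := cabs (\sum_(0 <= j < J) c j) ^+ 2.
have A0 : 0 <= A by rewrite exprn_ge0 ?cabs_ge0.
pose N0 := Num.bound (4 * (m.+1%:R * A) / e).
exists (J + N0)%N => // K /= JK.
have JK1 : (J <= K)%N by rewrite (leq_trans _ JK)// leq_addr.
have small : m.+1%:R * A * tau K < e / 4.
  apply: le_lt_trans (_ : m.+1%:R * A * K.+1%:R^-1 < _).
    by rewrite ler_wpM2l ?tau_le// mulr_ge0.
  rewrite ltr_pdivrMr ?ltr0n// -ltr_pdivrMl//.
  have -> : (e / 4)^-1 * (m.+1%:R * A) = 4 * (m.+1%:R * A) / e.
    by field; rewrite gt_eqF.
  apply: le_lt_trans (ler_norm _) _.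
  apply: lt_le_trans (archi_boundP (normr_ge0 _)) _.
  by rewrite ler_nat /Num.bound normr_id -/(Num.bound _) leqW// (leq_trans _ JK)// leq_addl.
have csE : csum K = \sum_(0 <= j < J) c j + \sum_(J <= j < K.+1) c j.
  by rewrite /csum -(big_mkord xpredT) (big_cat_nat (leq0n J))//= leqW.
pose t := \sum_(J <= j < K.+1) cabs (c j).
have t0 : 0 <= t by rewrite sumr_ge0// => k _; exact: cabs_ge0.
have ct : cabs (csum K) <= cabs (\sum_(0 <= j < J) c j) + t.
  by rewrite csE; apply: le_trans (cabsD _ _) _; rewrite lerD2l cabs_sum.
have ct2 : cabs (csum K) ^+ 2 <= 2 * A + 2 * t ^+ 2.
  have := cabs_ge0 (csum K); have := sqr_ge0 (cabs (\sum_(0 <= j < J) c j) - t).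
  rewrite /A; move: ct (cabs_ge0 (\sum_(0 <= j < J) c j)).
  move: (cabs (csum K)) (cabs _) => p q; rewrite !expr2; nra.
have cs : t ^+ 2 <= (\sum_(J <= j < K.+1) cabs (c j) ^+ 2 * wc j) *
    \sum_(J <= j < K.+1) (wc j)^-1.
  apply: cauchy_schwarz_sum => k; first exact: cabs_ge0.
  - by rewrite mulr_ge0 ?(ltW (wc_gt0 k))// exprn_ge0 ?cabs_ge0.
  - by rewrite invr_ge0 ltW ?wc_gt0.
  - by rewrite mulfK// gt_eqF ?wc_gt0.
have iw : \sum_(J <= j < K.+1) (wc j)^-1 <= \sum_(0 <= j < K.+1) (wc j)^-1.
  rewrite [leRHS](big_cat_nat (leq0n J))/= ?leqW// lerDr sumr_ge0// => k _.
  by rewrite invr_ge0 ltW ?wc_gt0.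
have nt : 0 < m.+1%:R * tau K by rewrite mulr_gt0 ?tau_gt0// ltr0n.
have : m.+1%:R * tau K * t ^+ 2 <= e / 4.
  apply: le_trans (ler_wpM2l (ltW nt) (le_trans cs (ler_wpM2l (Q0 J K.+1) iw))) _.
  by rewrite mulrCA sum_inv_wc mulr1 ltW// tail// leqW.
have : boundary K <= m.+1%:R * tau K * (2 * A + 2 * t ^+ 2).
  by rewrite /boundary mulrAC ler_wpM2l// ltW.
move: small; rewrite [m.+1%:R * A * _]mulrAC.
rewrite mulrDr !mulrA ![_ * 2]mulrC -!mulrA; move: (m.+1%:R * _) (m.+1%:R * _) => *; lra.
Qed.

Definition cnorm k : C := (m.+1%:R * tau k)%:C * csum k.

(** Since tau_k - tau_(k+1) = (m+1) wB_k, the normalization by tau_k is the one for which the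
    increments of S_k combine into [cdiff]. *)
Lemma cnormS k : cnorm k.+1 - cnorm k = (m.+1%:R * wB k)%:C * cdiff k.
Proof.
rewrite /cnorm tauS wBE /cdiff csumS.
have -> : (k + m.+1).+1%:R = k.+1%:R + m.+1%:R :> R by rewrite -natrD addSn.
by rewrite !natrC !rmorphM !rmorphD /=; ring.
Qed.

Lemma sum_wB K L : (K <= L)%N -> m.+1%:R * \sum_(K <= k < L) wB k <= tau K.
Proof.
move=> KL; rewrite mulr_sumr (_ : \sum_(K <= k < L) _ = - \sum_(K <= k < L) (tau k.+1 - tau k)).
  by rewrite telescope_sumr// opprB gerBl ltW ?tau_gt0.
rewrite -sumrN; apply: eq_bigr => k _; rewrite tauS wBE.
have -> : (k + m.+1).+1%:R = k.+1%:R + m.+1%:R :> R by rewrite -natrD addSn.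
ring.
Qed.

(** Cauchy-Schwarz on the telescoped increments with the weights wB, whose sum from K on is at most
    tau_K / (m+1). *)
Lemma cnorm_dist K L D : (K <= L)%N ->
  (forall N, \sum_(k < N) cabs (cdiff k) ^+ 2 * wB k <= D) ->
  cabs (cnorm L - cnorm K) ^+ 2 <= m.+1%:R * tau K * D.
Proof.
move=> KL HD.
pose t := \sum_(K <= k < L) wB k * cabs (cdiff k).
have t0 : 0 <= t.
  by rewrite sumr_ge0// => k _; rewrite mulr_ge0 ?cabs_ge0 ?(ltW (wB_gt0 k)).
have h1 : cabs (cnorm L - cnorm K) <= m.+1%:R * t.
  rewrite -telescope_sumr//; apply: le_trans (cabs_sum _ _ _) _.
  rewrite mulr_sumr; apply: ler_sum => k _.
  by rewrite cnormS cabsM cabs_real ger0_norm ?mulrA// mulr_ge0 ?(ltW (wB_gt0 k)).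
have h2 : t ^+ 2 <= (\sum_(K <= k < L) cabs (cdiff k) ^+ 2 * wB k) * \sum_(K <= k < L) wB k.
  apply: cauchy_schwarz_sum => k.
  - by rewrite mulr_ge0 ?cabs_ge0 ?(ltW (wB_gt0 k)).
  - by rewrite mulr_ge0 ?(ltW (wB_gt0 k))// exprn_ge0 ?cabs_ge0.
  - exact: ltW (wB_gt0 k).
  - by rewrite exprMn le_eqVlt; apply/orP; left; apply/eqP; ring.
have P0 i j : 0 <= \sum_(i <= k < j) cabs (cdiff k) ^+ 2 * wB k.
  by rewrite sumr_ge0// => k _; rewrite mulr_ge0 ?(ltW (wB_gt0 k))// exprn_ge0 ?cabs_ge0.
have h3 : \sum_(K <= k < L) cabs (cdiff k) ^+ 2 * wB k <= D.
  apply: le_trans (HD L); rewrite -(big_mkord xpredT (fun k => cabs (cdiff k) ^+ 2 * wB k)).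
  by rewrite (big_cat_nat (leq0n K) KL)/= lerDr.
apply: (@le_trans _ _ ((m.+1%:R * t) ^+ 2)).
  by rewrite lerXn2r ?nnegrE ?cabs_ge0// mulr_ge0.
have D0 : 0 <= D by exact: le_trans (P0 _ _) h3.
have W0 : 0 <= \sum_(K <= k < L) wB k.
  by rewrite sumr_ge0// => k _; exact: ltW (wB_gt0 k).
rewrite exprMn expr2 -!mulrA ler_wpM2l//.
apply: (@le_trans _ _ (m.+1%:R * (D * \sum_(K <= k < L) wB k))).
  by rewrite ler_wpM2l//; apply: le_trans h2 _; rewrite ler_wpM2r.
rewrite mulrCA [leRHS](_ : _ = D * tau K); last by rewrite /tau; ring.
by rewrite ler_wpM2l// sum_wB.
Qed.

Lemma cnorm_limit D : (forall N, \sum_(k < N) cabs (cdiff k) ^+ 2 * wB k <= D) ->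
  exists l : C, forall K, cabs (cnorm K - l) ^+ 2 <= m.+1%:R * tau K * D.
Proof.
move=> HD.
have [U [UU oU]] := @ultraFilterLemma nat \oo _.
have [l Hl] : exists l : C, forall e : R, 0 < e -> \forall N \near U, cabs (cnorm N - l) < e.
  apply: (@ultra_bounded _ _ _ (m.+1%:R * tau 0 * D + 1 + cabs (cnorm 0))) => //.
  near=> N; have -> : cnorm N = (cnorm N - cnorm 0) + cnorm 0 by ring.
  apply: le_trans (cabsD _ _) _; rewrite lerD2r.
  have := cnorm_dist (leq0n N) HD; have := cabs_ge0 (cnorm N - cnorm 0).
  move: (cabs _) (m.+1%:R * tau 0 * D) => x y; rewrite expr2; nra.
exists l => K; set Y := m.+1%:R * tau K * D.
have Y0 : 0 <= Y by apply: le_trans (cnorm_dist (leqnn K) HD); exact: sqr_ge0.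
rewrite -[leRHS]sqr_sqrtr// lerXn2r ?nnegrE ?cabs_ge0 ?sqrtr_ge0//.
apply/ler_addgt0Pl => e e0.
have [N [h1 h2]] : exists N, cabs (cnorm N - l) < e /\ (K <= N)%N.
  by near U => N; exists N; split; near: N; [exact: Hl|apply: oU; exists K].
have -> : cnorm K - l = (cnorm N - l) - (cnorm N - cnorm K) by ring.
apply: le_trans (cabsB _ _) _; apply: lerD; first exact: ltW.
have := cnorm_dist h2 HD; rewrite -/Y => /ler_wsqrtr.
by rewrite sqrtr_sqr ger0_norm ?cabs_ge0.
Unshelve. all: by end_near. Qed.

(** |cnorm_K|^2 is (m+1) tau_K times the boundary term, so the second hypothesis, which has the rate
    of [cnorm_limit], says precisely that the boundary terms are at most D; [sum_cdiff]
    concludes. *)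
Lemma sum_c_bounded D : (forall N, \sum_(k < N) cabs (cdiff k) ^+ 2 * wB k <= D) ->
  (forall K, cabs (cnorm K) ^+ 2 <= m.+1%:R * tau K * D) ->
  forall K, \sum_(j < K) cabs (c j) ^+ 2 * wc j <= D + D.
Proof.
move=> HD Hu K.
have bK : boundary K <= D.
  have nt : 0 < m.+1%:R * tau K by rewrite mulr_gt0 ?tau_gt0// ltr0n.
  rewrite -(ler_pM2l nt); apply: le_trans (Hu K).
  rewrite /cnorm cabsM cabs_real gtr0_norm// exprMn /boundary.
  by rewrite le_eqVlt; apply/orP; left; apply/eqP; ring.
have := sum_cdiff K; have := HD K; rewrite [in X in _ -> X -> _]big_ord_recr /=.
have : 0 <= cabs (c K) ^+ 2 * wc K.
  by rewrite mulr_ge0 ?(ltW (wc_gt0 K))// exprn_ge0 ?cabs_ge0.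
lra.
Qed.

End CoefficientSums.

(** * Effect of a change of the constant alpha *)

Section Shift.
Context {R : realType}.
Local Notation C := (Cplx R).
Variables (m : nat) (c : nat -> C) (x : C).
(** The form taken by [gcoef] after a change of alpha: g changes by a multiple of 1 / (z - lam),
    whose rotated coefficients are constant. *)
Let c' j : C := c j + x * ((wc m j)^-1)%:C.

Lemma csum_shift k : csum c' k = csum c k + x * ((m.+1%:R * tau m k)^-1)%:C.
Proof.
rewrite /csum /c' big_split /= -mulr_sumr; congr (_ + _ * _).
rewrite -rmorph_sum /=; congr (_%:C); rewrite -(big_mkord xpredT (fun j => (wc m j)^-1)).
have nt : m.+1%:R * tau m k != 0 :> R by rewrite mulf_neq0// gt_eqF ?tau_gt0.
by apply: (mulfI nt); rewrite sum_inv_wc mulfV.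
Qed.

Lemma cnorm_shift k : cnorm m c' k = cnorm m c k + x.
Proof.
have E (a : R) : a != 0 -> a%:C * (x * (a^-1)%:C) = x.
  by move=> a0; rewrite mulrCA -rmorphM /= mulfV ?mulr1.
by rewrite /cnorm csum_shift mulrDr E// mulf_neq0// gt_eqF ?tau_gt0.
Qed.

(** As it must be, since [cdiff] describes f^(n) / (z - lam), which does not see the constant
    alpha. *)
Lemma cdiff_shift k : cdiff m c' k = cdiff m c k.
Proof.
have E (a : nat) (t : R) : a.+1%:R * (x * ((a.+1%:R * t)^-1)%:C) = x * (t^-1)%:C.
  by rewrite invfM natrC mulrCA -rmorphM /= mulrA mulfV ?natS_neq0// mul1r.
by rewrite /cdiff csum_shift /c' wcS !mulrDr !E; ring.
Qed.

End Shift.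

(** * Relations between the coefficients of f, g and F *)

Section CoefficientLink.
Context {R : realType}.
Local Notation C := (Cplx R).
Implicit Types (f g F : C -> C) (a b : nat -> C) (lam alpha z : C).

Lemma psum_congr r a f g : psum_on r a f -> (forall z, cabs z < r -> f z = g z) ->
  psum_on r a g.
Proof. by move=> [Ha af] fg; split=> // z zr; rewrite -fg//; exact: af. Qed.

Lemma psum_unique (r : R) a b f g : 0 < r -> psum_on r a f -> psum_on r b g ->
  (forall z, cabs z < r -> f z = g z) -> forall k, a k = b k.
Proof.
move=> r0 af bg fg k; rewrite -(psum_taylor_coef k r0 (psum_congr af fg)).
exact: psum_taylor_coef bg.
Qed.

Definition shift_coef lam b k : C := (if k is k'.+1 then b k' else 0) - lam * b k.

Lemma psum_mul_linear r b F lam : psum_on r b F ->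
  psum_on r (shift_coef lam b) (fun z => (z - lam) * F z).
Proof.
move=> [Hb bF]; split=> [s s0r|z zr e e0].
  have [M HM] := Hb s s0r; have /andP[s0 _] := s0r.
  have M0 : 0 <= M by apply: le_trans (HM 0%N); rewrite expr0 mulr1 cabs_ge0.
  exists (M * s + cabs lam * M) => k.
  apply: le_trans (ler_wpM2r (exprn_ge0 _ (ltW s0)) (cabsB _ _)) _.
  rewrite mulrDl cabsM -mulrA; apply: lerD; last by rewrite ler_wpM2l ?cabs_ge0.
  case: k => [|k]; first by rewrite cabs0 mul0r mulr_ge0// ltW.
  by rewrite exprSr mulrA ler_wpM2r// ltW.
have D0 : 0 < 1 + cabs z + cabs lam by rewrite -addrA ltr_pwDl// addr_ge0 ?cabs_ge0.
have [N _ HN] := bF z zr _ (divr_gt0 e0 D0).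
exists N.+1 => // -[//|L] /= NL.
have h1 := HN L NL; have h2 := HN L.+1 (leqW NL); rewrite /= in h1 h2.
have E : \sum_(k < L.+1) shift_coef lam b k * z ^+ k =
    z * (\sum_(k < L) b k * z ^+ k) - lam * \sum_(k < L.+1) b k * z ^+ k.
  rewrite /shift_coef; under eq_bigr do rewrite mulrBl -mulrA.
  rewrite sumrB -mulr_sumr; congr (_ - _).
  rewrite big_ord_recl mul0r add0r mulr_sumr; apply: eq_bigr => k _ /=.
  by rewrite /bump /= add1n /= exprS; ring.
rewrite E; set S := \sum_(k < L) _ in h1 *; set S' := \sum_(k < L.+1) _ in h2 *.
have -> : (z - lam) * F z - (z * S - lam * S') = z * (F z - S) - lam * (F z - S') by ring.
apply: le_lt_trans (cabsB _ _) _; rewrite !cabsM.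
have e1 : 0 < e / (1 + cabs z + cabs lam) by rewrite divr_gt0.
have h3 := ler_wpM2l (cabs_ge0 z) (ltW h1); have h4 := ler_wpM2l (cabs_ge0 lam) (ltW h2).
apply: le_lt_trans (lerD h3 h4) _; rewrite -mulrDl mulrCA gtr_pMr//.
by rewrite ltr_pdivrMr// mul1r -addrA ltrDr.
Qed.

Definition const_coef alpha k : C := if k is 0%N then alpha else 0.

Lemma psum_addc r a f alpha : psum_on r a f ->
  psum_on r (fun k => const_coef alpha k + a k) (fun z => alpha + f z).
Proof.
move=> [Ha af]; split=> [s s0r|z zr e e0].
  have [M HM] := Ha s s0r; have /andP[s0 _] := s0r.
  exists (cabs alpha + M) => k.
  apply: le_trans (ler_wpM2r (exprn_ge0 _ (ltW s0)) (cabsD _ _)) _.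
  rewrite mulrDl; apply: lerD => //.
  by case: k => [|k] /=; rewrite ?expr0 ?mulr1// cabs0 mul0r cabs_ge0.
have [N _ HN] := af z zr e e0; exists N.+1 => // -[//|L] /= NL.
have -> : \sum_(k < L.+1) (const_coef alpha k + a k) * z ^+ k =
    alpha + \sum_(k < L.+1) a k * z ^+ k.
  under eq_bigr do rewrite mulrDl.
  rewrite big_split /=; congr (_ + _); rewrite big_ord_recl /= expr0 mulr1 big1 ?addr0//.
  by move=> k _; rewrite mul0r.
have -> (x y t : C) : x + y - (x + t) = y - t by ring.
by apply: HN; exact: leqW.
Qed.

Lemma has_cderiv_quotient f w l z : w != z -> has_cderiv f w l ->
  exists l', has_cderiv (fun y => f y / (y - z)) w l'.
Proof.
move=> wz /has_cderiv_is_derive fw.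
pose g (y : C) : C := f y / (y - z).
have wz0 : w - z != 0 by rewrite subr_eq0.
suff dg : derivable g w 1 by exists (derive1 g w); exact: derivable_has_cderiv.
apply: (@derivableM _ _ f (fun y => (y - z)^-1)); first by case: fw.
by apply: derivableV => //; apply: derivableB.
Qed.

Lemma quotient_holo h lam : holo_disc h -> cabs lam = 1 ->
  holo_disc (fun z => h z / (z - lam)).
Proof.
move=> Hh lam1 z zD; have dz := derivable_has_cderiv (Hh z zD).
have z1 : cabs z < 1 by move: zD; rewrite inE.
have zl : z != lam by apply: contraTneq z1 => ->; rewrite lam1 ltxx.
by have [l /has_cderiv_is_derive] := has_cderiv_quotient zl dz; case.
Qed.

Lemma unit_neq0 lam : cabs lam = 1 -> lam != 0.
Proof. by move=> l1; rewrite -cabs_gt0 l1. Qed.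

Lemma disc_neq lam z : cabs lam = 1 -> cabs z < 1 -> z - lam != 0.
Proof.
by move=> l1 z1; rewrite subr_eq0; apply: contraTneq z1 => ->; rewrite l1 ltxx.
Qed.

(* Rotated so that [lam] becomes [1], and weighted as in [D_sigma m]. *)
Definition gcoef (m : nat) lam (gk : nat -> C) j : C :=
  ((wc m j)^-1)%:C * (lam ^+ (j + m) * gk (j + m)%N).

Lemma coefficient_link (m : nat) lam alpha f g F a b gk : cabs lam = 1 ->
  psum_on 1 a f -> psum_on 1 gk g -> psum_on 1 b F ->
  (forall z, cabs z < 1 -> f z = alpha + (z - lam) * g z) ->
  (forall z, cabs z < 1 -> cderiv m.+1 f z = (z - lam) * F z) ->
  forall k, lam ^+ (k + m.+1) * b k = cdiff m (gcoef m lam gk) k.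
Proof.
move=> l1 af gg bF fg fF.
have l0 := unit_neq0 l1.
(* Only the coefficients of index at least 1 are read off, so alpha drops out. *)
have aE k : a k.+1 = gk k - lam * gk k.+1.
  have := psum_unique ltr01 af (psum_addc alpha (psum_mul_linear lam gg)) fg k.+1.
  by rewrite /= add0r.
have bE k : ((k + m.+1)`!%:R / k`!%:R) * a (k + m.+1)%N = shift_coef lam b k.
  exact: psum_unique ltr01 (psum_derive1n m.+1 af) (psum_mul_linear lam bF) fF k.
pose c := gcoef m lam gk.
have facE k : ((k + m.+1)`!%:R / k`!%:R : C) = ((tau m k)^-1)%:C :> C.
  by rewrite /tau invf_div rmorphM fmorphV !rmorph_nat.
have canc (i : nat) (t : R) : i.+1%:R * ((i.+1%:R * t)^-1)%:C = (t^-1)%:C :> C.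
  by rewrite invfM natrC -rmorphM /= mulrA mulfV ?natS_neq0// mul1r.
have c1 k : ((tau m k)^-1)%:C * (lam ^+ (k + m.+1) * gk (k + m.+1)%N) = k.+1%:R * c k.+1.
  by rewrite /c /gcoef addSnnS [RHS]mulrA wcS canc.
have wct k : wc m k = (k + m).+1%:R * tau m k.
  rewrite /wc /tau addnS factSR invfM [RHS]mulrCA mulVKf ?natS_neq0//.
have c2 k : ((tau m k)^-1)%:C * (lam ^+ (k + m) * gk (k + m)%N) = (k + m.+1)%:R * c k.
  by rewrite /c /gcoef [RHS]mulrA wct addnS canc.
(* The k-th coefficient of the derivative of order m + 1, rotated by lam^(k+m), computed from (z -
   lam) F and from alpha + (z - lam) g. It is a first-order recursion for b_k, solved by the
   induction below. *)
have rel k : lam ^+ (k + m) * shift_coef lam b k = (k + m.+1)%:R * c k - k.+1%:R * c k.+1.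
  rewrite -c1 -c2 -bE facE addnS aE exprS; ring.
elim=> [|k IH].
  have := rel 0%N; rewrite /shift_coef !add0n sub0r mul1r /cdiff /csum big_ord_recl big_ord0 addr0 mul1r.
  move=> E; rewrite -/c exprS.
  have -> : lam * lam ^+ m * b 0%N = - (lam ^+ m * - (lam * b 0%N)) by ring.
  by rewrite E opprB.
have := rel k.+1; rewrite /shift_coef => E.
have -> : lam ^+ (k.+1 + m.+1) * b k.+1 =
    lam ^+ (k + m.+1) * b k - lam ^+ (k.+1 + m) * (b k - lam * b k.+1).
  by rewrite !(addSn, addnS) !exprS; ring.
rewrite E IH /cdiff csumS -/c natrD -(natr1 k.+1); ring.
Qed.

End CoefficientLink.

(** * The two Dirichlet integrals as weighted series *)

Section DirichletSeries.
Context {R : realType}.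
Local Notation C := (Cplx R).
Implicit Types (f g F : C -> C) (a b : nat -> C) (lam alpha z : C).

Lemma beta_weightE k m : beta_weight k m.+1 = (m.+1)`!%:R * wB m k :> R.
Proof. by rewrite /beta_weight /wB mulrAC mulrC. Qed.

(** The numerator of the Poisson kernel raises the exponent of 1 - |z|^2 from m to m + 1. The
    factors (m+1)! and pi from [disc_parseval] then cancel against the normalizations, leaving 1 /
    m!. *)
Lemma D_lambda_eq m lam f F b : cabs lam = 1 -> psum_on 1 b F ->
  (forall z, cabs z < 1 -> cderiv m.+1 f z = (z - lam) * F z) ->
  D_lambda m.+1 lam f =
  ((m`!%:R^-1)%:E * \sum_(0 <= k <oo) (cabs (b k) ^+ 2 * wB m k)%:E)%E.
Proof.
move=> l1 bF fF; rewrite /D_lambda /area_int_disc.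
have -> : (\int[(@lebesgue_measure R \x @lebesgue_measure R)]_(p in
    [set p : R * R | (p.1 ^+ 2 + p.2 ^+ 2 < 1)%R])
    (cabs (cderiv m.+1 f (Complex p.1 p.2)) ^+ 2 * poisson_dirac lam (Complex p.1 p.2) *
      (1 - cabs (Complex p.1 p.2 : C) ^+ 2) ^+ m)%:E)%E =
    (\int[(@lebesgue_measure R \x @lebesgue_measure R)]_(p in plane_disc)
      (wabs2 m.+1 F (toC p))%:E)%E.
  apply: eq_integral => p; rewrite inE => pD; congr EFin.
  have /plane_discE p1 : plane_disc p := pD.
  rewrite -/(toC p) /wabs2 fF// cabsM /poisson_dirac [(1 - _) ^+ m.+1]exprS.
  have d0 : cabs (toC p - lam) != 0 by rewrite cabs_eq0 disc_neq.
  move: (cabs (toC p - lam)) d0 (cabs (F (toC p))) ((1 - _) ^+ m) => d d0 x y.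
  by field.
rewrite (disc_parseval m.+1 bF).
under eq_eseriesr do rewrite beta_weightE mulrCA EFinM.
rewrite nneseriesZl; last first.
  by move=> k _; rewrite lee_fin mulr_ge0 ?(ltW (wB_gt0 _ _))// exprn_ge0 ?cabs_ge0.
set S := (\sum_(0 <= k <oo) _)%E.
have pi0 : pi != 0 :> R by rewrite gt_eqF ?pi_gt0.
have f0 := fact_neq0 (R:=R) m.+1; have g0 := fact_neq0 (R:=R) m.
rewrite -[(_ * _ * (pi^-1)%:E)%E]muleA [((m.+1)`!%:R%:E * S * _)%E]muleAC.
rewrite !muleA -!EFinM natrM succnK; congr (_%:E * _)%E.
move: (m.+1`!%:R : R) (m`!%:R : R) f0 g0 => x y x0 y0.
by move: (pi : R) pi0 => p p0; field; rewrite x0 y0 p0.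
Qed.

Lemma nneseries_shift (u : nat -> \bar R) m : (forall k, (0 <= u k)%E) ->
  (\sum_(m <= k <oo) u k = \sum_(0 <= k <oo) u (k + m)%N)%E.
Proof. by move=> u0; rewrite -nneseries_addn. Qed.

(** The binomial C(k+m, m) is 1 / (m! wc_k), while [gcoef] carries a factor 1 / wc_k, so that
    |c_k|^2 wc_k = |g_(k+m)|^2 / wc_k. *)
Lemma D_sigma_eq m lam g gk : cabs lam = 1 -> psum_on 1 gk g ->
  D_sigma m g =
  ((m`!%:R^-1)%:E * \sum_(0 <= k <oo) (cabs (gcoef m lam gk k) ^+ 2 * wc m k)%:E)%E.
Proof.
move=> l1 gg; rewrite /D_sigma nneseries_shift; last first.
  by move=> k; rewrite lee_fin mulr_ge0// exprn_ge0 ?cabs_ge0.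
rewrite -nneseriesZl; last first.
  by move=> k _; rewrite lee_fin mulr_ge0 ?(ltW (wc_gt0 _ _))// exprn_ge0 ?cabs_ge0.
apply: eq_eseriesr => k _; rewrite -EFinM; congr EFin.
rewrite (psum_taylor_coef _ ltr01 gg) /gcoef !cabsM cabsX l1 expr1n mul1r cabs_real.
rewrite ger0_norm; last by rewrite invr_ge0 ltW ?wc_gt0.
have w0 : wc m k != 0 :> R by rewrite gt_eqF ?wc_gt0.
have -> : 'C(k + m, m)%:R = (m`!%:R * wc m k)^-1 :> R.
  have := bin_fact (leq_addl k m); rewrite addnK => /(congr1 (fun i => i%:R : R)).
  rewrite !natrM /wc => E; have := fact_neq0 (R:=R) k; have := fact_neq0 (R:=R) m; have := fact_neq0 (R:=R) (k + m).
  rewrite -E; move: ('C(k + m, m)%:R : R) (m`!%:R : R) (k`!%:R : R) => x y z h y0 z0.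
  have x0 : x != 0 by apply: contraNneq h => ->; rewrite mul0r.
  by field; rewrite x0 y0 z0.
have := fact_neq0 (R:=R) m; move: (m`!%:R : R) (wc m k : R) w0 (cabs _) => x w w0 y x0.
by field; rewrite w0 x0.
Qed.

Lemma partial_sum_bounded (x : nat -> R) : (forall k, 0 <= x k) ->
  (\sum_(0 <= k <oo) (x k)%:E < +oo)%E ->
  exists D : R, forall K, \sum_(k < K) x k <= D.
Proof.
move=> x0 xoo; have x0' k : (0 <= (x k)%:E)%E by rewrite lee_fin.
have S0 := nneseries_ge0 (fun k (_ : (0 <= k)%N) (_ : true) => x0' k).
exists (fine (\sum_(0 <= k <oo) (x k)%:E)%E) => K.
rewrite -lee_fin fineK ?ge0_fin_numE// -sumEFin -(big_mkord xpredT (fun k => (x k)%:E)).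
exact: nneseries_lim_ge.
Qed.

Lemma bounded_series_lty (x : nat -> R) (D : R) : (forall k, 0 <= x k) ->
  (forall K, \sum_(k < K) x k <= D) -> (\sum_(0 <= k <oo) (x k)%:E < +oo)%E.
Proof.
move=> x0 xD; apply: le_lt_trans (ltry D); apply: lime_le.
  by apply: is_cvg_nneseries => k _ _; rewrite lee_fin.
by apply: nearW => K; rewrite big_mkord sumEFin lee_fin.
Qed.

Lemma series_cvg (x : nat -> R) (l : R) : (forall k, 0 <= x k) ->
  \sum_(k < K) x k @[K --> \oo] --> l -> (\sum_(0 <= k <oo) (x k)%:E = l%:E)%E.
Proof.
move=> x0 xl; apply/cvg_lim => //; apply: cvg_EFin; first by apply: nearW => K; rewrite big_mkord sumEFin.
by under eq_fun do rewrite /= big_mkord sumEFin.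
Qed.

Lemma weighted_sum_eq m (c : nat -> C) (D : R) :
  (forall K, \sum_(k < K) cabs (c k) ^+ 2 * wc m k <= D) ->
  (\sum_(0 <= k <oo) (cabs (cdiff m c k) ^+ 2 * wB m k)%:E =
   \sum_(0 <= k <oo) (cabs (c k) ^+ 2 * wc m k)%:E)%E.
Proof.
move=> HD.
have c0 k : 0 <= cabs (c k) ^+ 2 * wc m k.
  by rewrite mulr_ge0 ?(ltW (wc_gt0 _ _))// exprn_ge0 ?cabs_ge0.
have B0 k : 0 <= cabs (cdiff m c k) ^+ 2 * wB m k.
  by rewrite mulr_ge0 ?(ltW (wB_gt0 _ _))// exprn_ge0 ?cabs_ge0.
have [l Hl] : exists l : R, \sum_(k < K) cabs (c k) ^+ 2 * wc m k @[K --> \oo] --> l.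
  apply/cvg_ex/nondecreasing_is_cvgn.
    apply/nondecreasing_seqP => K; by rewrite big_ord_recr /= lerDl.
  by exists D => _ [K _ <-].
rewrite (series_cvg c0 Hl); apply: series_cvg => //.
have Hs : \sum_(k < K.+1) cabs (c k) ^+ 2 * wc m k @[K --> \oo] --> l.
  by rewrite (cvg_shiftS (fun K => \sum_(k < K) cabs (c k) ^+ 2 * wc m k)).
have Hb : boundary m c K @[K --> \oo] --> (0 : R).
  apply/cvgrPdist_lt => e e0; apply: filterS (boundary_cvg0 HD e0) => K.
  by rewrite sub0r normrN ger0_norm// boundary_ge0.
have -> : (fun K => \sum_(k < K) cabs (cdiff m c k) ^+ 2 * wB m k) =
    (fun K => \sum_(k < K.+1) cabs (c k) ^+ 2 * wc m k - boundary m c K).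
  by apply/funext => K; rewrite sum_cdiff.
by rewrite -[l]subr0; exact: cvgB.
Qed.

End DirichletSeries.

(** * The factorization and its boundary behaviour *)

Section Factorization.
Context {R : realType}.
Local Notation C := (Cplx R).
Implicit Types (f g F : C -> C) (a b gk : nat -> C) (lam alpha z : C).

Lemma pos_mul_lty (x : R) (S : \bar R) : 0 < x -> ((x%:E * S < +oo) = (S < +oo))%E.
Proof.
move=> x0; case: S => [r| |]; first by rewrite -EFinM !ltry.
  by rewrite gt0_muley ?lte_fin.
by rewrite gt0_muleNy ?lte_fin.
Qed.

Lemma derivative_quotient m lam f : cabs lam = 1 -> holo_disc f ->
  exists b F, psum_on 1 b F /\
    forall z, cabs z < 1 -> cderiv m.+1 f z = (z - lam) * F z.
Proof.
move=> l1 Hf; have df := psum_holo_disc (psum_derive1n m.+1 (holo_disc_psum Hf)).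
exists (taylor_coef (fun z => cderiv m.+1 f z / (z - lam))), (fun z => cderiv m.+1 f z / (z - lam)).
split=> [|z z1]; first exact: holo_disc_psum (quotient_holo df l1).
by rewrite mulrC divfK// disc_neq.
Qed.

Lemma sigma_partial_sums m lam g gk : cabs lam = 1 -> psum_on 1 gk g ->
  (D_sigma m g < +oo)%E ->
  exists D : R, forall K, \sum_(k < K) cabs (gcoef m lam gk k) ^+ 2 * wc m k <= D.
Proof.
move=> l1 gg; rewrite (D_sigma_eq m l1 gg) pos_mul_lty; last first.
  by rewrite invr_gt0 lt0r fact_neq0 ler0n.
apply: partial_sum_bounded => k.
by rewrite mulr_ge0 ?(ltW (wc_gt0 _ _))// exprn_ge0 ?cabs_ge0.
Qed.

Lemma D_lambda_sigma m lam alpha f g : cabs lam = 1 -> holo_disc f -> H_sigma m g ->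
  (forall z, cabs z < 1 -> f z = alpha + (z - lam) * g z) ->
  D_lambda m.+1 lam f = D_sigma m g.
Proof.
move=> l1 Hf [Hg Dg] fg; have [b [F [bF fF]]] := derivative_quotient m l1 Hf.
have gg := holo_disc_psum Hg.
have link := coefficient_link l1 (holo_disc_psum Hf) gg bF fg fF.
have [D HD] := sigma_partial_sums l1 gg Dg.
rewrite (D_lambda_eq l1 bF fF) (D_sigma_eq m l1 gg) -(weighted_sum_eq HD).
congr (_ * _)%E; apply: eq_eseriesr => k _.
by rewrite -link cabsM cabsX l1 expr1n mul1r.
Qed.

(** Here g - g' = (alpha - alpha') / (lam - z), a geometric series with coefficients (alpha -
    alpha') lam^(-k-1). *)
Lemma quotient_coef lam alpha alpha' g g' gk gk' : psum_on 1 gk g -> psum_on 1 gk' g' ->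
  (forall z, cabs z < 1 -> alpha + (z - lam) * g z = alpha' + (z - lam) * g' z) ->
  forall k, lam ^+ k.+1 * (gk k - gk' k) = alpha - alpha'.
Proof.
move=> gg gg' E.
have U := psum_unique ltr01 (psum_addc alpha (psum_mul_linear lam gg))
  (psum_addc alpha' (psum_mul_linear lam gg')) E.
elim=> [|k IH].
  have := U 0%N; rewrite /= /shift_coef !sub0r expr1 => /eqP.
  rewrite -subr_eq0 => /eqP h; apply/eqP; rewrite -subr_eq0; apply/eqP.
  by rewrite -[RHS]oppr0 -h; ring.
rewrite -IH; have := U k.+1; rewrite /= /shift_coef !add0r => /eqP.
rewrite -subr_eq0 => /eqP h; apply/eqP; rewrite -subr_eq0; apply/eqP.
by rewrite -[RHS](mulr0 (- lam ^+ k.+1)) -h (exprS lam k.+1); ring.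
Qed.

Lemma H_lambda_factor m lam f : cabs lam = 1 -> H_lambda m.+1 lam f ->
  exists g alpha, H_sigma m g /\
    forall z, cabs z < 1 -> f z = alpha + (z - lam) * g z.
Proof.
move=> l1 [Hf]; have [b [F [bF fF]]] := derivative_quotient m l1 Hf.
rewrite (D_lambda_eq l1 bF fF) pos_mul_lty; last first.
  by rewrite invr_gt0 lt0r fact_neq0 ler0n.
case/partial_sum_bounded => [k|D HD].
  by rewrite mulr_ge0 ?(ltW (wB_gt0 _ _))// exprn_ge0 ?cabs_ge0.
have factor alpha z : cabs z < 1 -> f z = alpha + (z - lam) * ((f z - alpha) / (z - lam)).
  by move=> z1; rewrite mulrC divfK ?disc_neq// addrCA subrr addr0.
have Hq alpha : holo_disc (fun z => (f z - alpha) / (z - lam)).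
  apply: (fun H => @quotient_holo _ (fun z => f z - alpha) lam H l1) => z zD.
  apply: (@derivableB _ _ _ f (cst alpha)); first exact: Hf zD.
  exact: derivable_cst.
pose gk alpha := taylor_coef (fun z => (f z - alpha) / (z - lam)).
have gg alpha : psum_on 1 (gk alpha) (fun z => (f z - alpha) / (z - lam)).
  exact: (holo_disc_psum (Hq alpha)).
(* Start from the constant 0; the limit l of [cnorm] measures by how much it must be corrected. *)
pose c := gcoef m lam (gk 0).
have link := coefficient_link l1 (holo_disc_psum Hf) (gg 0) bF (factor 0) fF.
have Hc N : \sum_(k < N) cabs (cdiff m c k) ^+ 2 * wB m k <= D.
  apply: le_trans (HD N); apply: ler_sum => k _.
  by rewrite -link cabsM cabsX l1 expr1n mul1r.
have [l Hl] := cnorm_limit Hc.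
(* By [quotient_coef], the constant - lam l changes c_j by - l / wc_j, so [cnorm] is translated by -
   l. *)
exists (fun z => (f z - - lam * l) / (z - lam)), (- lam * l); split; last exact: factor.
split; first exact: Hq.
have E : gcoef m lam (gk (- lam * l)) = (fun j => c j + - l * ((wc m j)^-1)%:C).
  apply/funext => j; rewrite /c /gcoef [- l * _]mulrC -mulrDr; congr (_ * _).
  apply: (mulfI (unit_neq0 l1)).
  have EE z : cabs z < 1 -> - lam * l + (z - lam) * ((f z - - lam * l) / (z - lam)) =
      0 + (z - lam) * ((f z - 0) / (z - lam)).
    by move=> z1; rewrite -!factor.
  have := quotient_coef (gg (- lam * l)) (gg 0) EE (j + m).
  rewrite exprS subr0; move: (gk _ (j + m)%N) (gk 0 (j + m)%N) (lam ^+ (j + m)) => x y w h.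
  have -> : lam * (w * x) = lam * w * (x - y) + lam * (w * y) by ring.
  by rewrite h; ring.
rewrite (D_sigma_eq m l1 (gg (- lam * l))) pos_mul_lty; last first.
  by rewrite invr_gt0 lt0r fact_neq0 ler0n.
apply: (@bounded_series_lty _ _ (D + D)) => [k|].
  by rewrite mulr_ge0 ?(ltW (wc_gt0 _ _))// exprn_ge0 ?cabs_ge0.
rewrite E; apply: (@sum_c_bounded _ m (fun j => c j + - l * ((wc m j)^-1)%:C)) => [N|K]; last first.
  by rewrite cnorm_shift; exact: Hl.
by apply: le_trans (Hc N); apply: ler_sum => k _; rewrite cdiff_shift.
Qed.

End Factorization.

(** * Limits at the boundary point *)

Section OricyclicLimit.
Context {R : realType}.
Local Notation C := (Cplx R).
Implicit Types (f g : C -> C) (gk : nat -> C) (lam alpha z : C).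

Lemma small_tail (x : nat -> R) (D e : R) : (forall k, 0 <= x k) ->
  (forall K, \sum_(k < K) x k <= D) -> 0 < e ->
  exists J, forall L, \sum_(J <= k < L) x k <= e.
Proof.
move=> x0 xD e0; pose s K := \sum_(k < K) x k.
have si : {homo s : i j / (i <= j)%N >-> i <= j}.
  by apply/nondecreasing_seqP => K; rewrite /s big_ord_recr /= lerDl.
have cs : s @ \oo --> sup (range s).
  by apply: nondecreasing_cvgn => //; exists D => _ [K _ <-]; exact: xD.
have /cvgrPdist_lt /(_ e e0) [J _ HJ] := cs.
have := HJ J (leqnn J); rewrite /= => hJ.
exists J => L; case: (leqP J L) => [JL|/ltnW LJ]; last by rewrite big_geq// ltW.
have sL : s L <= sup (range s).
  by apply: ub_le_sup; [exists D => _ [K _ <-]; exact: xD|exists L].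
have E : s L = s J + \sum_(J <= k < L) x k.
  by rewrite /s -!(big_mkord xpredT) -big_cat_nat.
have := ler_norm (sup (range s) - s J); move: E hJ sL => ->; lra.
Qed.

(** Since wc_j <= 1, the term |c_j|^2 wc_j = |g_(j+m)|^2 / wc_j dominates |g_(j+m)|^2; the index
    shift by m is absorbed into J. *)
Lemma sigma_tail m lam g gk (e : R) : cabs lam = 1 -> psum_on 1 gk g ->
  (D_sigma m g < +oo)%E -> 0 < e ->
  exists J, forall L, \sum_(J <= k < L) cabs (gk k) ^+ 2 <= e.
Proof.
move=> l1 gg Dg e0; have [D HD] := sigma_partial_sums l1 gg Dg.
have [|J HJ] := @small_tail (fun k => cabs (gcoef m lam gk k) ^+ 2 * wc m k) _ _ _ HD e0.
  by move=> k /=; rewrite mulr_ge0 ?(ltW (wc_gt0 _ _))// exprn_ge0 ?cabs_ge0.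
exists (J + m)%N => L; rewrite big_addn; apply: le_trans (HJ (L - m)%N).
apply: ler_sum => k _; rewrite /gcoef !cabsM cabsX l1 expr1n mul1r cabs_real.
rewrite ger0_norm; last by rewrite invr_ge0 ltW ?wc_gt0.
have w0 : 0 < wc m k :> R := wc_gt0 m k.
have w1 : wc m k <= 1 :> R.
  rewrite /wc ler_pdivrMr ?lt0r ?fact_neq0 ?ler0n// mul1r ler_nat.
  by rewrite leq_fact// leq_addr.
rewrite exprMn -mulrA mulrC -mulrA -[X in X <= _]mulr1 ler_wpM2l ?exprn_ge0 ?cabs_ge0//.
by rewrite expr2 mulrA mulfV ?gt_eqF// mul1r invf_ge1.
Qed.

(* The [H^2] tail contributes [o((1 - |z|^2)^(-1/2))] by Cauchy-Schwarz. *)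
Lemma sigma_growth m lam g (d : R) : cabs lam = 1 -> H_sigma m g -> 0 < d ->
  exists2 H : R, 0 <= H & forall z, cabs z < 1 ->
    cabs (g z) * Num.sqrt (1 - cabs z ^+ 2) <= H * Num.sqrt (1 - cabs z ^+ 2) + d.
Proof.
move=> l1 [Hg Dg] d0; have gg := holo_disc_psum Hg.
have [J HJ] := sigma_tail l1 gg Dg (exprn_gt0 2 d0).
set gk := taylor_coef g in gg HJ.
exists (\sum_(0 <= k < J) cabs (gk k)) => [|z z1]; first by apply: sumr_ge0 => k _; exact: cabs_ge0.
set H := \sum_(0 <= k < J) _; have z0 := cabs_ge0 z.
have q01 : 0 <= cabs z ^+ 2 < 1 by rewrite exprn_ge0//= expr_lt1.
have q0 : 0 < 1 - cabs z ^+ 2 by rewrite subr_gt0; case/andP: q01.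
set s := Num.sqrt _; have s0 : 0 < s by rewrite sqrtr_gt0.
have ss : s ^+ 2 = 1 - cabs z ^+ 2 by rewrite sqr_sqrtr// ltW.
have tail L : (\sum_(J <= k < L) cabs (gk k) * cabs z ^+ k) * s <= d.
  have t0 : 0 <= \sum_(J <= k < L) cabs (gk k) * cabs z ^+ k.
    by apply: sumr_ge0 => k _; rewrite mulr_ge0 ?exprn_ge0 ?cabs_ge0.
  rewrite -(@ler_pXn2r _ 2) ?nnegrE ?mulr_ge0 ?(ltW s0) ?(ltW d0)//.
  rewrite exprMn ss.
  have CS := @cauchy_schwarz_sum R (fun k => cabs (gk k) * cabs z ^+ k)
    (fun k => cabs (gk k) ^+ 2) (fun k => (cabs z ^+ 2) ^+ k) J L.
  have {}CS := CS (fun k => mulr_ge0 (cabs_ge0 _) (exprn_ge0 _ z0))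
    (fun k => exprn_ge0 _ (cabs_ge0 _)) (fun k => exprn_ge0 _ (exprn_ge0 _ z0)).
  have {}CS : (\sum_(J <= k < L) cabs (gk k) * cabs z ^+ k) ^+ 2 <=
      (\sum_(J <= k < L) cabs (gk k) ^+ 2) * \sum_(J <= k < L) (cabs z ^+ 2) ^+ k.
    by apply: CS => k; rewrite exprMn [(cabs z ^+ k) ^+ 2]exprAC.
  have geo : (\sum_(J <= k < L) (cabs z ^+ 2) ^+ k) * (1 - cabs z ^+ 2) <= 1.
    have := geometric_sum_le J L q01; rewrite ler_pdivlMr// => h; apply: le_trans h _.
    by apply: exprn_ile1; case/andP: q01 => // ? /ltW.
  apply: le_trans (ler_wpM2r (ltW q0) CS) _; rewrite -mulrA -[leRHS]mulr1.
  apply: ler_pM (HJ L) geo; first by apply: sumr_ge0 => k _; rewrite exprn_ge0 ?cabs_ge0.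
  by rewrite mulr_ge0 ?(ltW q0)// sumr_ge0// => k _; rewrite !exprn_ge0.
have partial L : (J <= L)%N -> cabs (\sum_(k < L) gk k * z ^+ k) * s <= H * s + d.
  move=> JL; apply: le_trans (ler_wpM2r (ltW s0) (cabs_sum _ _ _)) _.
  rewrite -(big_mkord xpredT (fun k => cabs (gk k * z ^+ k))) (big_cat_nat _ (n := J))//=.
  rewrite mulrDl; apply: lerD.
    rewrite ler_wpM2r ?(ltW s0)//; apply: ler_sum => k _; rewrite cabsM cabsX.
    by rewrite -[leRHS]mulr1 ler_wpM2l ?cabs_ge0// exprn_ile1// ltW.
  by under eq_bigr do rewrite cabsM cabsX; exact: tail.
apply/ler_addgt0Pr => e e0; have es : 0 < e / s by rewrite divr_gt0.
have [N _ HN] := gg.2 z z1 _ es.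
have h1 := HN (maxn N J) (leq_maxl _ _); have h2 := partial (maxn N J) (leq_maxr _ _).
move: h1 h2; rewrite /=; set S := \sum_(k < _) _ => h1 h2.
have h3 : cabs (g z) <= cabs (g z - S) + cabs S by rewrite -{1}(subrK S (g z)) cabsD.
apply: le_trans (ler_wpM2r (ltW s0) h3) _; rewrite mulrDl addrC; apply: lerD => //.
by rewrite -ler_pdivlMr// ltW.
Qed.

(** With s = (1 - |z|^2)^(1/2), [sigma_growth] reads |g z| <= H + d / s. Inside the region |z - lam|
    d / s <= kappa d, which is e/2 by the choice of d, and |z - lam| H tends to 0. *)
Lemma oricyclic_limit m lam alpha f g (kappa : R) : cabs lam = 1 -> H_sigma m g ->
  (forall z, cabs z < 1 -> f z = alpha + (z - lam) * g z) -> 0 < kappa ->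
  f z @[z --> within (oricyclic kappa lam) (nbhs lam)] --> alpha.
Proof.
move=> l1 Hg fg k0; apply/cvg_cabsP => e e0.
pose d := e / 2 / kappa; have d0 : 0 < d by rewrite !divr_gt0.
have [H H0 HH] := sigma_growth l1 Hg d0.
(* Chosen so that |z - lam| H < e/2; the summand 1 keeps the denominator positive when H = 0. *)
apply/nbhs_cabsP; exists (e / (H + H + 1)).
  by rewrite divr_gt0// ltr_wpDl// addr_ge0.
move=> z zl [] /set_mem; rewrite /disc /= => z1 zk; have -> : f z - alpha = (z - lam) * g z.
  by rewrite (fg z z1) addrC addKr.
rewrite cabsM.
have q0 : 0 < 1 - cabs z ^+ 2 by rewrite subr_gt0 expr_lt1 ?cabs_ge0.
have := HH z z1; move: zk; set s := Num.sqrt _ => zk.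
have s0 : 0 < s by rewrite sqrtr_gt0.
set w := cabs (z - lam) in zl zk *; have w0 : 0 <= w := cabs_ge0 _.
rewrite -ler_pdivlMr// mulrDl mulfK ?gt_eqF// => hg.
apply: le_lt_trans (ler_wpM2l w0 hg) _; rewrite mulrDr.
have h1 : w * (d / s) <= kappa * d.
  rewrite mulrCA mulrC ler_wpM2r ?(ltW d0)// ler_pdivrMr//; exact: ltW.
have E1 : kappa * d = e / 2 by rewrite /d mulrC divfK// gt_eqF.
have h2 : w * H < e / 2.
  rewrite ltr_pdivlMr// -mulrA; move: zl; rewrite ltr_pdivlMr; last by rewrite ltr_wpDl// addr_ge0.
  nra.
lra.
Unshelve. all: by end_near. Qed.

(** The radius lies in the region with kappa = 1, because (1 - r)^2 < 1 - r^2 for 0 < r < 1. *)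
Lemma radial_limit lam alpha f : cabs lam = 1 ->
  f z @[z --> within (oricyclic 1 lam) (nbhs lam)] --> alpha ->
  (fun r : R => f (r%:C * lam)) r @[r --> 1^'-] --> alpha.
Proof.
move=> l1 /cvg_cabsP fa; apply/cvg_cabsP => e /fa/nbhs_cabsP[d d0 Hd].
near=> r.
have r0 : 0 < r by near: r; apply: nbhs_left_gt.
have r1 : r < 1 by near: r; exact: nbhs_left_lt.
have rd : 1 - d < r by near: r; apply: nbhs_left_gt; rewrite ltrBlDr ltrDl.
have E : cabs (r%:C * lam - lam) = 1 - r.
  have -> : r%:C * lam - lam = (r - 1)%:C * lam by rewrite rmorphB rmorph1 mulrBl mul1r.
  rewrite cabsM l1 mulr1 cabs_real.
  by rewrite distrC ger0_norm// subr_ge0 ltW.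
have E' : cabs (r%:C * lam) = r by rewrite cabsM l1 mulr1 cabs_real ger0_norm// ltW.
apply: Hd; first by rewrite E ltrBlDl -ltrBlDr.
split; first by rewrite inE /disc /= E'.
rewrite E E' mul1r -(@ltr_pXn2r _ 2) ?nnegrE ?sqrtr_ge0 ?subr_ge0 ?(ltW r1)//.
rewrite sqr_sqrtr; first nra.
by rewrite subr_ge0 exprn_ile1// ltW.
Unshelve. all: by end_near. Qed.

End OricyclicLimit.

Theorem theorem1p1 (R : realType) (n : nat) (lam : Cplx R) (f : Cplx R -> Cplx R) :
  (0 < n)%N -> cabs lam = 1 -> holo_disc f ->
  (H_lambda n lam f <->
     exists (g : Cplx R -> Cplx R) (alpha : Cplx R),
       H_sigma n.-1 g /\ forall z, z \in @disc R -> f z = alpha + (z - lam) * g z)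
  /\
  (forall (g : Cplx R -> Cplx R) (alpha : Cplx R),
     H_sigma n.-1 g -> (forall z, z \in @disc R -> f z = alpha + (z - lam) * g z) ->
     [/\ D_lambda n lam f = D_sigma n.-1 g,
         (forall kappa : R, 0 < kappa ->
            f z @[z --> within (oricyclic kappa lam) (nbhs lam)] --> alpha)
       & (fun r : R => f (r%:C * lam)) r @[r --> 1^'-] --> alpha]).
Proof.
case: n => // m _ l1 Hf; rewrite succnK.
have unfold (g : Cplx R -> Cplx R) (alpha : Cplx R) :
    (forall z, z \in @disc R -> f z = alpha + (z - lam) * g z) ->
    forall z, cabs z < 1 -> f z = alpha + (z - lam) * g z.
  by move=> fg z z1; apply: fg; rewrite inE.
split; [split=> [Hl|[g [alpha [Hg /unfold fg]]]]|move=> g alpha Hg /unfold fg].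
- have [g [alpha [Hg fg]]] := H_lambda_factor l1 Hl.
  by exists g, alpha; split=> // z; rewrite inE; exact: fg.
- by split=> //; rewrite (D_lambda_sigma l1 Hf Hg fg); case: Hg.
- split; first exact: D_lambda_sigma l1 Hf Hg fg.
    by move=> kappa; exact: oricyclic_limit l1 Hg fg.
  exact: radial_limit l1 (oricyclic_limit l1 Hg fg ltr01).
Qed.
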